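(* Consider the nonlinear programming (NLP) problem $\min\{\theta(x):x\in S\}$, where $$S:=\left\{x\in\mathbb{R}^n: h_1(x)=\dots=h_m(x)=0,\ \max_{j=1,\dots,k}g_j(x)\le0\right\},\qquad m<n,$$ and $\theta,h_i,g_j:\mathbb{R}^n\to\mathbb{R}$ ($i=1,\dots,m$, $j=1,\dots,k$) are twice continuously differentiable. Let $h,g,A,B$, the penalty function $V$, the vector field $F$ and the set $\Phi\subseteq S$ of Karush-Kuhn-Tucker (KKT) points be defined as in the context. Suppose that the following assumptions hold: (A1) For every $z\in\mathbb{R}^n$ and every $y\in\{x\in\mathbb{R}^n:V(x)\le V(z)\}$ the set $\{x\in\mathbb{R}^n:V(x)\le V(z),\ \theta(x)\le\theta(y)\}$ is compact. (A2) For all $x\in S$ the row vectors $\nabla h_i(x)$ ($i=1,\dots,m$) together with $\nabla g_j(x)$, for all $j\in\{1,\dots,k\}$ with $g_j(x)=0$, are linearly independent. (A3) For $x\in\mathbb{R}^n$: if $A'(x)h(x)+B'(x)(g(x))^+=0$ then $h(x)=0$ and $(g(x))^+=0$. (A4) There exist locally Lipschitz functions $\psi_1,\psi_2\in C^0(\mathbb{R}^n;(0,+\infty))$ such that for every $z\in\mathbb{R}^n$ there exists $y_z\in\{x\in\mathbb{R}^n:V(x)\le V(z)\}$ with $\theta(y_z)\ge\theta(z)$ and $$\{x\in\mathbb{R}^n:a(x)>0,\ V(x)\le V(z)\}\subseteq\{x\in\mathbb{R}^n:\theta(x)\le\theta(y_z)\},$$ where $$a(x):=\psi_1(x)\nabla\theta(x)F(x)-|\nabla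 V(x)|^2|\nabla\theta(x)|^2-\psi_2(x)\nabla V(x)(\nabla\theta(x))'+\left|\nabla V(x)(\nabla\theta(x))'\right|^2.$$ Let $\sigma:\mathbb{R}^n\to(0,+\infty)$ be an arbitrary locally Lipschitz function, and, with $\psi_1,\psi_2$ as in (A4), define the locally Lipschitz vector field $$f(x):=\sigma(x)\psi_1(x)F(x)-\sigma(x)\left(\psi_2(x)(\nabla V(x))'+\left(|\nabla V(x)|^2I_n-(\nabla V(x))'\nabla V(x)\right)(\nabla\theta(x))'\right),\quad x\in\mathbb{R}^n.$$ Then the following properties hold for the dynamical system $\dot x=f(x)$: (i) For every $x_0\in\mathbb{R}^n$ the unique solution $x(t)$ of $\dot x=f(x)$ with $x(0)=x_0$ is defined for all $t\ge0$ and is bounded. Moreover, its positive limit set $\omega(x_0)$ is a non-empty, compact, connected, invariant set which satisfies $\omega(x_0)\subseteq\Phi$. (ii) Every KKT point of the NLP problem is an equilibrium point of $\dot x=f(x)$, and every equilibrium point of $\dot x=f(x)$ is a KKT point of the NLP problem. (iii) Every isolated KKT point which is a strict local minimum of the NLP problem is a locally asymptotically stable equilibrium point of $\dot x=f(x)$. (iv) The feasible set $S$ is positively invariant for $\dot x=f(x)$.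
   Context: Gradients are row vectors; a prime denotes transpose; $|\cdot|$ is the Euclidean norm; $I_n$ is the identity matrix; $adj(M)$ is the adjugate of a square matrix $M$ (the transpose of its cofactor matrix); $diag(v)$ is the diagonal matrix with the vector $v$ on its diagonal. For a vector $v$, $v^+$ and $v^-$ are defined componentwise by $(v^+)_i=\max(0,v_i)$ and $(v^-)_i=\min(0,v_i)$. Define $h(x)=(h_1(x),\dots,h_m(x))'\in\mathbb{R}^m$, $g(x)=(g_1(x),\dots,g_k(x))'\in\mathbb{R}^k$; $A(x)\in\mathbb{R}^{m\times n}$ is the matrix with rows $\nabla h_1(x),\dots,\nabla h_m(x)$ and $B(x)\in\mathbb{R}^{k\times n}$ the matrix with rows $\nabla g_1(x),\dots,\nabla g_k(x)$. ($A'(x)$ means $(A(x))'$, etc.) Penalty function: $V(x):=\frac12|h(x)|^2+\frac12|(g(x))^+|^2$. Writing $d(x):=\det(A(x)A'(x))$, define for $x\in\mathbb{R}^n$: $$H(x)=d(x)I_n-A'(x)\,adj(A(x)A'(x))A(x)\in\mathbb{R}^{n\times n},$$ $$Q(x)=d(x)B(x)H(x)B'(x)-d(x)^2\,diag((g(x))^-)\in\mathbb{R}^{k\times k},$$ $$R(x)=H(x)B'(x)\,adj(Q(x))\in\mathbb{R}^{n\times k},$$ $$F(x)=d(x)^4R(x)\,diag((g(x))^-)R'(x)(\nabla\theta(x))'-d(x)^4R(x)\left[R'(x)(\nabla\theta(x))'\right]^+$$ $$\qquad-d(x)\left(\det(Q(x))I_n-d(x)R(x)B(x)\right)H(x)\left(\det(Q(x))I_n-d(x)B'(x)R'(x)\right)(\nabla\theta(x))'.$$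 KKT points: $\Phi\subseteq S$ is the set of all $x\in S$ for which there exist $\lambda\in\mathbb{R}^m$ and $\mu\in\mathbb{R}^k$ with all components of $\mu$ nonnegative such that $(\nabla\theta(x))'+A'(x)\lambda+B'(x)\mu=0$ and $\mu'g(x)=0$. A KKT point $x^*$ is isolated if it is the only element of $\Phi$ in some neighborhood of $x^*$; $x^*\in S$ is a strict local minimum if $\theta(x^* )<\theta(x)$ for all $x\in S\setminus\{x^*\}$ in some neighborhood of $x^*$. The positive limit set $\omega(x_0)$ is the set of all $p\in\mathbb{R}^n$ for which there is a sequence $t_i\to+\infty$ with $x(t_i)\to p$. A set is invariant if the solution starting at any of its points exists for all $t\in\mathbb{R}$ and stays in the set; positively invariant if solutions starting in it stay in it for all $t\ge0$. *)

(* Defs.v *)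
From HB Require Import structures.
From mathcomp Require Export all_boot all_order all_algebra.
From mathcomp Require Export all_classical all_reals all_analysis.
Export Order.TTheory GRing.Theory Num.Theory.
Export numFieldNormedType.Exports.

Set Implicit Arguments.
Unset Strict Implicit.
Unset Printing Implicit Defensive.

Local Open Scope classical_set_scope.
Local Open Scope ring_scope.

Section Calculus.
Context {R : realType} {n : nat}.
Implicit Type phi : 'cV[R]_n -> R.

Definition enorm {p q : nat} (v : 'M[R]_(p, q)) : R :=
  Num.sqrt (\sum_i \sum_j v i j ^+ 2).

(* Gradient, as a row vector, of a function on column vectors: the entries are
   the directional derivatives along the standard basis. *)
Definition grad phi (x : 'cV[R]_n) : 'rV[R]_n :=
  \row_j 'D_(delta_mx j 0) phi x.

Definition C1 phi : Prop :=
  (forall x, differentiable phi x) /\ continuous (grad phi).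

Definition C2 phi : Prop :=
  C1 phi /\ forall j, C1 (fun x => grad phi x 0 j).

Definition locally_lipschitz phi : Prop :=
  forall x : 'cV[R]_n, exists2 U, nbhs x U & [lipschitz phi y | y in U].

Definition pos_part {k : nat} (v : 'cV[R]_k) : 'cV[R]_k :=
  map_mx (Num.max 0) v.

Definition neg_part {k : nat} (v : 'cV[R]_k) : 'cV[R]_k :=
  map_mx (Num.min 0) v.

(* [diag_mx] takes a row vector *)
Definition diag {k : nat} (v : 'cV[R]_k) : 'M[R]_k := diag_mx v^T.

End Calculus.

Section Dynamics.
Context {R : realType} {n : nat}.
Variable f : 'cV[R]_n -> 'cV[R]_n.
Implicit Types (x y : R -> 'cV[R]_n) (I J : interval R) (M : set 'cV[R]_n).

(* x' = f(x) on I; the derivative is one-sided at an endpoint belonging to I *)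
Definition solves I x : Prop :=
  forall t, t \in I ->
    (s - t)^-1 *: (x s - x t) @[s --> within [set` I] t^'] --> f (x t).

(* x is, on I, the unique solution starting at p at time 0: it agrees with any
   other solution, on whatever interval containing 0 the latter is defined *)
Definition unique_solution I (p : 'cV[R]_n) x : Prop :=
  [/\ x 0 = p, solves I x &
      forall J y, 0 \in J -> y 0 = p -> solves J y ->
        forall t, t \in I -> t \in J -> y t = x t].

Definition invariant M : Prop :=
  forall p, M p -> exists x, unique_solution `]-oo, +oo[ p x /\ forall t, M (x t).

Definition positively_invariant M : Prop :=
  forall p, M p -> exists x,
    unique_solution `[0, +oo[ p x /\ forall t, 0 <= t -> M (x t).

Definition equilibrium (p : 'cV[R]_n) : Prop := f p = 0.

Definition lyapunov_stable (p : 'cV[R]_n) : Prop :=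
  forall U, nbhs p U -> \forall q \near p, exists x,
    unique_solution `[0, +oo[ q x /\ forall t, 0 <= t -> U (x t).

Definition attractive (p : 'cV[R]_n) : Prop :=
  \forall q \near p, exists x,
    unique_solution `[0, +oo[ q x /\ x t @[t --> +oo] --> p.

Definition locally_asymptotically_stable (p : 'cV[R]_n) : Prop :=
  [/\ equilibrium p, lyapunov_stable p & attractive p].

End Dynamics.

Definition omega_limit {R : realType} {n : nat} (x : R -> 'cV[R]_n) :
    set 'cV[R]_n :=
  [set p | exists t : nat -> R,
     t i @[i --> \oo] --> +oo /\ x (t i) @[i --> \oo] --> p].

Section NLP.
Context {R : realType} {n m k : nat}.
Variables (theta : 'cV[R]_n -> R).
Variables (h : 'I_m -> 'cV[R]_n -> R) (g : 'I_k -> 'cV[R]_n -> R).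
Implicit Type x : 'cV[R]_n.

Definition feasible : set 'cV[R]_n :=
  [set x | (forall i, h i x = 0) /\ (forall j, g j x <= 0)].

Definition hvec x : 'cV[R]_m := \col_i h i x.
Definition gvec x : 'cV[R]_k := \col_j g j x.
Definition Amx x : 'M[R]_(m, n) := \matrix_i grad (h i) x.
Definition Bmx x : 'M[R]_(k, n) := \matrix_j grad (g j) x.

Definition penalty x : R :=
  2^-1 * enorm (hvec x) ^+ 2 + 2^-1 * enorm (pos_part (gvec x)) ^+ 2.

Definition dfun x : R := \det (Amx x *m (Amx x)^T).

Definition Hmx x : 'M[R]_n :=
  dfun x *: 1%:M - (Amx x)^T *m \adj (Amx x *m (Amx x)^T) *m Amx x.

Definition Qmx x : 'M[R]_k :=
  dfun x *: (Bmx x *m Hmx x *m (Bmx x)^T)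
  - dfun x ^+ 2 *: diag (neg_part (gvec x)).

Definition Rmx x : 'M[R]_(n, k) := Hmx x *m (Bmx x)^T *m \adj (Qmx x).

Definition Ffield x : 'cV[R]_n :=
  dfun x ^+ 4 *: (Rmx x *m diag (neg_part (gvec x)) *m (Rmx x)^T
                  *m (grad theta x)^T)
  - dfun x ^+ 4 *: (Rmx x *m pos_part ((Rmx x)^T *m (grad theta x)^T))
  - dfun x *: ((\det (Qmx x) *: 1%:M - dfun x *: (Rmx x *m Bmx x)) *m Hmx x
               *m (\det (Qmx x) *: 1%:M - dfun x *: ((Bmx x)^T *m (Rmx x)^T))
               *m (grad theta x)^T).

Definition KKT : set 'cV[R]_n :=
  [set x | feasible x /\ exists (lambda : 'cV[R]_m) (mu : 'cV[R]_k),
     [/\ forall j, 0 <= mu j 0,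
         (grad theta x)^T + (Amx x)^T *m lambda + (Bmx x)^T *m mu = 0 &
         mu^T *m gvec x = 0]].

Definition isolated_KKT x : Prop :=
  KKT x /\ \forall y \near x, KKT y -> y = x.

Definition strict_local_min x : Prop :=
  feasible x /\ \forall y \near x, feasible y -> y <> x -> theta x < theta y.

Definition active_gradients x : seq 'rV[R]_n :=
  [seq grad (h i) x | i : 'I_m] ++
  [seq grad (g j) x | j in [pred j | g j x == 0]].

Definition afun (psi1 psi2 : 'cV[R]_n -> R) x : R :=
  psi1 x * (grad theta x *m Ffield x) 0 0
  - enorm (grad penalty x) ^+ 2 * enorm (grad theta x) ^+ 2
  - psi2 x * (grad penalty x *m (grad theta x)^T) 0 0
  + `| (grad penalty x *m (grad theta x)^T) 0 0 | ^+ 2.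

Definition nlp_field (sigma psi1 psi2 : 'cV[R]_n -> R) x : 'cV[R]_n :=
  (sigma x * psi1 x) *: Ffield x
  - sigma x *: (psi2 x *: (grad penalty x)^T
      + (enorm (grad penalty x) ^+ 2 *: 1%:M
         - (grad penalty x)^T *m grad penalty x) *m (grad theta x)^T).

End NLP.

(* Main.v *)
(* The field [F] annihilates the rows of [A] and satisfies grad V . F <= 0 and
   grad theta . F <= 0 (the matrix [Q] is positive semidefinite), so along a
   trajectory V' <= - sigma psi2 |grad V|^2.  By (A2) and (A3), on every compact
   set |grad V|^2 >= e V for some e > 0; since theta' is at most
   sigma psi2 |grad theta| |grad V|, there is a constant c such that
   theta + c sqrt V decreases along trajectories.
   By (A1) and (A4) the trajectory of x0 stays in a compact set
   {V <= V x0, theta <= theta y}; cutting off [sigma] outside a ball makes the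
   field globally Lipschitz without changing it on that set.
   On a limit set both [V] and [theta] are constant, so grad V = 0, i.e. the
   limit set is feasible, and then grad theta . F = 0, which forces the KKT
   conditions with multipliers read off from the definition of [F].
   Near an isolated KKT strict minimum p, the same monotone quantity, compared
   with the values of [theta] on a small sphere around p, confines trajectories. *)
Require Import Defs.
From mathcomp Require Import ring lra.

Set Implicit Arguments.
Unset Strict Implicit.
Unset Printing Implicit Defensive.

Local Open Scope classical_set_scope.
Local Open Scope ring_scope.

(** * Limits and derivatives of vector-valued functions *)

(** Outside the feasible set [theta] may grow, so LaSalle's principle cannot be applied to it
    directly; the quantity with [sqrt V] takes its place. Its constant [c] depends on the compact
    set only: a weight [s >= 0] in front of the field multiplies both the possible growth of [theta]
    and the decay of [V], and cancels. The estimates along curves are therefore proved for an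
    arbitrary nonnegative weight, which covers the truncated one. Existence is then needed only for
    globally Lipschitz fields, where Picard iteration gives solutions on the whole line at once;
    local existence and blow-up never enter. Determinants and adjugates replace inverses in [F], so
    that it is locally Lipschitz everywhere. The determinants are nonnegative at every point, which
    yields the signs; their positivity comes from (A2), on the feasible set, where multipliers have
    to be extracted. The square root fits the error bound: near a feasible point [|grad V|] is at
    least of order [sqrt V], so [sqrt V] decays at a rate of order [|grad V|], the order of the
    growth of [theta]. *)

Section MatrixNorm.
Context {R : realType} {p q : nat}.
Implicit Types M : 'M[R]_(p, q).

Lemma mx_norm_coord M i j : `|M i j| <= `|M|.
Proof.
rewrite [leRHS]/Num.Def.normr/= mx_normrE.
exact: (@le_bigmax _ _ _ _ (fun k : 'I_p * 'I_q => `|M k.1 k.2|) (i, j)).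
Qed.

Lemma mx_norm_le M c : 0 <= c -> (forall i j, `|M i j| <= c) -> `|M| <= c.
Proof.
by move=> c0 Mc; rewrite [leLHS]/Num.Def.normr/= mx_normrE bigmax_le.
Qed.

Lemma cvg_mx (T : Type) (F : set_system T) (FF : Filter F)
    (f : T -> 'M[R]_(p, q)) (l : 'M[R]_(p, q)) :
  (forall i j, f x i j @[x --> F] --> l i j) -> f x @[x --> F] --> l.
Proof.
move=> fl; apply/cvgrPdist_le => e e0.
have : \forall x \near F, forall i, forall j, `|l i j - f x i j| <= e.
  apply: filter_forall => i; apply: filter_forall => j.
  by move/cvgrPdist_le: (fl i j); exact.
apply: filterS => x H; apply: mx_norm_le; first exact: ltW.
by move=> i j; rewrite !mxE.
Qed.

Lemma cvg_mx_coord (T : Type) (F : set_system T) (FF : Filter F)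
    (f : T -> 'M[R]_(p, q)) (l : 'M[R]_(p, q)) i j :
  f x @[x --> F] --> l -> f x i j @[x --> F] --> l i j.
Proof. by move=> fl; apply: (cvg_comp _ (fun M : 'M[R]_(p, q) => M i j) fl); exact: coord_continuous. Qed.

Lemma is_derive_mx (M : R -> 'M[R]_(p, q)) (t : R) (v : 'M[R]_(p, q)) :
  (forall i j, is_derive t 1 (fun s => M s i j) (v i j)) ->
  is_derive t 1 M v.
Proof.
move=> dM.
have DM : derivable M t 1 by apply/derivable_mxP => i j; case: (dM i j).
split=> //; rewrite derive_mx//; apply/matrixP => i j; rewrite !mxE.
by case: (dM i j).
Qed.

Lemma is_derive_mx_coord (M : R -> 'M[R]_(p, q)) (t : R) (v : 'M[R]_(p, q)) i j :
  is_derive t 1 M v -> is_derive t 1 (fun s => M s i j) (v i j).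
Proof.
move=> [dM vE]; split; first by move/derivable_mxP: dM; exact.
by rewrite -vE derive_mx// mxE.
Qed.

End MatrixNorm.

Lemma cvg_sumr {R : realType} (I T : Type) (F : set_system T) (FF : Filter F)
    (r : seq I) (P : pred I) (f : I -> T -> R) (l : I -> R) :
  (forall i, f i x @[x --> F] --> l i) ->
  \sum_(i <- r | P i) f i x @[x --> F] --> \sum_(i <- r | P i) l i.
Proof.
move=> fl; elim: r => [|i r IH].
  by rewrite big_nil; under eq_fun do rewrite big_nil; exact: cvg_cst.
rewrite big_cons; under eq_fun do rewrite big_cons.
by case: ifP => _ //; apply: cvgD.
Qed.

Section NormedModule.
Context {R : realType} {V W : normedModType R}.

Lemma near_norm_lt (x : V) (e : R) : 0 < e -> \forall y \near x, `|x - y| < e.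
Proof.
by move=> e0; have := nbhsx_ballx x e e0; apply: filterS => y; rewrite -ball_normE.
Qed.

Lemma near_norm_le (x : V) (e : R) : 0 < e -> \forall y \near x, `|x - y| <= e.
Proof. by move=> /(near_norm_lt x); apply: filterS => y /ltW. Qed.

Lemma continuousP_dist (f : V -> W) :
  (forall x (e : R), 0 < e -> \forall y \near x, `|f x - f y| <= e) -> continuous f.
Proof. by move=> H x; apply/cvgrPdist_le => e e0; exact: H. Qed.

Lemma is_deriveN_fun (x : R -> V) (t : R) (u : V) :
  is_derive t 1 x u -> is_derive t 1 (fun s => - x s) (- u).
Proof. exact: is_deriveN. Qed.

Lemma is_deriveB_fun (x y : R -> V) (t : R) (u v : V) :
  is_derive t 1 x u -> is_derive t 1 y v ->
  is_derive t 1 (fun s => x s - y s) (u - v).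
Proof. exact: is_deriveB. Qed.

End NormedModule.

Section Gradient.
Context {R : realType} {n : nat}.
Implicit Types (phi : 'cV[R]_n -> R) (x v : 'cV[R]_n).

Lemma diff_grad phi x v : differentiable phi x ->
  'd phi x v = (grad phi x *m v) 0 0.
Proof.
move=> dphi; rewrite {1}(matrix_sum_delta v) linear_sum/= mxE.
apply: eq_bigr => i _; rewrite big_ord1 linearZ/= mxE deriveE// mulrC.
by rewrite -/(_ *: _).
Qed.

Lemma is_derive_comp_grad phi (x : R -> 'cV[R]_n) (t : R) v :
  is_derive t 1 x v -> differentiable phi (x t) ->
  is_derive t 1 (phi \o x) ((grad phi (x t) *m v) 0 0).
Proof.
move=> [/derivable1_diffP dx xE] dphi.
have dc : differentiable (phi \o x) t by exact: differentiable_comp.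
split; first exact/derivable1_diffP.
by rewrite deriveE// diff_comp//= -(diff_grad _ dphi) -xE deriveE.
Qed.

End Gradient.

(** * Monotone functions and Grönwall inequalities *)

Section Monotone.
Context {R : realType}.
Implicit Types (u du : R -> R) (a b : R).

Lemma is_derive_nincr u du a b : a <= b ->
  (forall t, a < t < b -> is_derive t 1 u (du t)) ->
  (forall t, a < t < b -> du t <= 0) ->
  {within `[a, b], continuous u} -> u b <= u a.
Proof.
move=> ab dudt du0 cu.
have du' t : t \in `]a, b[%R -> is_derive t 1 u (du t).
  by rewrite in_itv/=; exact: dudt.
move: ab; rewrite le_eqVlt => /predU1P[->//|ab].
have [c cab E] := MVT ab du' cu.
by rewrite -subr_le0 E mulr_le0_ge0 ?du0 ?subr_ge0 1?ltW//; move: cab; rewrite in_itv.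
Qed.

Lemma within_continuousT (T : topologicalType) (A : set R) (u : R -> T) :
  continuous u -> {within A, continuous u}.
Proof. by move=> cu; apply: continuous_subspaceT. Qed.

Lemma is_derive_continuous (V : normedModType R) (x dx : R -> V) :
  (forall t : R, is_derive t 1 x (dx t)) -> continuous x.
Proof.
move=> dxdt t; apply: differentiable_continuous; apply/derivable1_diffP.
by case: (dxdt t).
Qed.

Lemma is_derive_expR_lin (c t : R) :
  is_derive t 1 (fun s => expR (c * s)) (c * expR (c * t)).
Proof.
have h : is_derive t 1 (fun s : R => c * s) c.
  by apply: is_derive_eq; rewrite /= ?scaler0 ?addr0 /GRing.scale/= ?mulr1.
have := @is_derive1_comp _ expR (fun s : R => c * s) t _ _ _ h.
by move=> H; rewrite mulrC; apply: H; exact: is_derive_expR.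
Qed.

(** The product [E s * expR (- c * s)] is nonincreasing. Derivatives are asked for only inside the
    interval, so that solutions that are one-sided at an endpoint are covered. *)
Lemma gronwall (E dE : R -> R) a b c : a <= b ->
  (forall t, a < t < b -> is_derive t 1 E (dE t)) ->
  (forall t, a < t < b -> dE t <= c * E t) ->
  {within `[a, b], continuous E} -> E b <= E a * expR (c * (b - a)).
Proof.
move=> ab dEdt dEc cE.
have h : forall t, a < t < b -> is_derive t 1 (fun s => E s * expR (- c * s))
   ((dE t - c * E t) * expR (- c * t)).
  move=> t /dEdt dt; have h2 := is_derive_expR_lin (- c) t.
  apply: is_derive_eq; rewrite /GRing.scale/=.
  by rewrite /=; ring.
have := is_derive_nincr ab h.
have -> : forall x y : R, x * expR (- c * b) <= y * expR (- c * a) =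
  (x <= y * expR (c * (b - a))).
  move=> x y.
  have -> : expR (c * (b - a)) = expR (- c * a) / expR (- c * b).
    by rewrite -expRN -expRD; congr expR; ring.
  by rewrite mulrA ler_pdivlMr// expR_gt0.
apply.
  by move=> t /dEc H; rewrite mulr_le0_ge0 ?expR_ge0// subr_le0.
move=> t; apply: (@continuousM _ (subspace `[a, b]) E); first exact: cE.
apply: within_continuousT => s.
apply: (continuous_comp (g := expR)); last exact: continuous_expR.
by apply: cvgM; [exact: cvg_cst|exact: cvg_id].
Qed.

(** The forward form for [- E] with rate [- c]. It serves to compare solutions at negative times. *)
Lemma gronwall_backward (E dE : R -> R) a b c : a <= b ->
  (forall t, a < t < b -> is_derive t 1 E (dE t)) ->
  (forall t, a < t < b -> - (c * E t) <= dE t) ->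
  {within `[a, b], continuous E} -> E a <= E b * expR (c * (b - a)).
Proof.
move=> ab dEdt dEc cE.
pose F s := - E s.
have : F b <= F a * expR ((- c) * (b - a)).
  apply: (@gronwall F (fun t => - dE t)) => //.
  - by move=> t /dEdt dt; exact: is_deriveN.
  - by move=> t /dEc; rewrite /F mulrNN lerNl.
  - by move=> t; apply: (@continuousN _ _ (subspace `[a, b]) E); exact: cE.
by rewrite /F mulNr lerN2 mulNr expRN ler_pdivrMr ?expR_gt0.
Qed.

End Monotone.

(** * Solutions of differential equations *)

Section DifferenceQuotient.
Context {R : realType} {V : normedModType R}.
Implicit Types (x : R -> V) (t : R) (v : V).

Lemma dnbhs_shift t (P : set R) :
  (\forall s \near t^', P s) <-> (\forall h \near 0^', P (h + t)).
Proof.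
rewrite !near_withinE; split => H.
  have c : h + t @[h --> (0 : R)] --> t.
    by rewrite -[X in _ --> X]add0r; apply: cvgD; [exact: cvg_id|exact: cvg_cst].
  have := c _ H; rewrite !nbhs_simpl/=; apply: filterS => h /=.
  by move=> + h0; apply; rewrite -subr_eq0 addrK.
have c : s - t @[s --> t] --> (0 : R).
  by rewrite -(subrr t); apply: cvgB; [exact: cvg_id|exact: cvg_cst].
have := c _ H; rewrite !nbhs_simpl/=; apply: filterS => s /=.
by rewrite subrK subr_eq0.
Qed.

Lemma is_derive_quotientP x t v :
  is_derive t 1 x v <->
  ((s - t)^-1 *: (x s - x t) @[s --> t^'] --> v).
Proof.
have E : ((s - t)^-1 *: (x s - x t) @[s --> t^'] --> v) <->
    (h^-1 *: ((x \o shift t) (h *: 1) - x t) @[h --> 0^'] --> v).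
  have E2 h : h^-1 *: ((x \o shift t) (h *: 1) - x t) =
     (h + t - t)^-1 *: (x (h + t) - x t) by rewrite addrK /GRing.scale/= mulr1.
  split => H A /H /=.
    by move/(dnbhs_shift t); rewrite /nbhs/=; apply: filterS => h; rewrite /= E2.
  move=> HA; apply/(dnbhs_shift t); move: HA; rewrite /nbhs/=.
  by apply: filterS => h; rewrite /= E2.
rewrite E; split.
  by move=> [dx <-]; exact: dx.
move=> H; split; first by apply/cvg_ex; exists v.
exact/cvg_lim.
Qed.

Lemma quotient_interior x t v (I : set R) : nbhs t I ->
  ((s - t)^-1 *: (x s - x t) @[s --> within I t^'] --> v) ->
  is_derive t 1 x v.
Proof.
move=> It H; apply/is_derive_quotientP => A /H.
move=> H1; have h1 : \forall s \near t^', I s -> A ((s - t)^-1 *: (x s - x t)) by exact: H1.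
have h2 : \forall s \near t^', I s by exact: nbhs_dnbhs.
suff : \forall s \near t^', A ((s - t)^-1 *: (x s - x t)) by [].
by apply: filterS2 h1 h2 => s; exact.
Qed.

Lemma is_derive_quotient_within x t v (I : set R) :
  is_derive t 1 x v ->
  ((s - t)^-1 *: (x s - x t) @[s --> within I t^'] --> v).
Proof.
move=> /is_derive_quotientP; apply: cvg_trans; apply: cvg_app; exact: cvg_within.
Qed.

(** The increment of [x] is the difference quotient times [s - t], which tends to 0. The limit is
    punctured, so the value at [s = t] is treated apart. *)
Lemma quotient_continuous x t v (I : set R) :
  ((s - t)^-1 *: (x s - x t) @[s --> within I t^'] --> v) ->
  x s @[s --> within I (nbhs t)] --> x t.
Proof.
move=> H.
have c0 : s - t @[s --> within I t^'] --> (0 : R).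
  rewrite -(subrr t); apply: cvgB; last exact: cvg_cst.
  by move=> A At; apply: cvg_within; exact: nbhs_dnbhs.
have := cvgD (cvgZ c0 H) (cvg_cst (x t)).
rewrite scale0r add0r => H2 A Ax; have Axt := nbhs_singleton Ax.
have H3 : \forall s \near t, s != t -> I s ->
    A ((s - t) *: ((s - t)^-1 *: (x s - x t)) + x t) by exact: (H2 _ _ _ A Ax).
suff : \forall s \near t, I s -> A (x s) by [].
apply: filterS H3 => s Hs Is.
have [->//|st] := eqVneq s t.
move: (Hs st Is).
by rewrite scalerA divff ?subr_eq0// scale1r subrK.
Qed.

End DifferenceQuotient.

Section Solutions.
Context {R : realType} {n : nat}.
Implicit Types (f : 'cV[R]_n -> 'cV[R]_n) (x y : R -> 'cV[R]_n) (I : interval R).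

Lemma solves_within_continuous f I x (A : set R) : solves f I x ->
  A `<=` [set` I] -> {within A, continuous x}.
Proof.
move=> fx AI; apply: (continuous_subspaceW AI).
by apply/subspace_continuousP => t It; apply: quotient_continuous (fx t It).
Qed.

Lemma solves_is_derive f I x t : solves f I x -> nbhs t [set` I] ->
  is_derive t 1 x (f (x t)).
Proof.
by move=> fx It; apply: (quotient_interior It); exact/fx/(nbhs_singleton It).
Qed.

Lemma solves_is_derive_oo f I x a b : solves f I x -> `]a, b[ `<=` [set` I] ->
  forall t : R, a < t < b -> is_derive t 1 x (f (x t)).
Proof.
move=> fx abI t tab; apply: (solves_is_derive fx).
apply: filterS abI _; apply: near_in_itvoo; exact: tab.
Qed.

Lemma is_derive_solves f I x :
  (forall t, t \in I -> is_derive t 1 x (f (x t))) -> solves f I x.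
Proof. by move=> dx t /dx; exact: is_derive_quotient_within. Qed.

Lemma eq_solves f g I x : (forall t, t \in I -> f (x t) = g (x t)) ->
  solves f I x -> solves g I x.
Proof. by move=> fg fx t It; rewrite -fg//; exact: fx. Qed.

(** The squared Euclidean norm. The norm of matrices is the maximum of the entries and is not
    differentiable along curves, so Grönwall arguments use this one. *)
Definition sqn (v : 'cV[R]_n) : R := \sum_i v i 0 ^+ 2.

Lemma sqn_ge0 v : 0 <= sqn v.
Proof. by apply: sumr_ge0 => i _; exact: sqr_ge0. Qed.

Lemma sqn_continuous : continuous sqn.
Proof.
move=> v; apply: (@cvg_sumr R _ _ (nbhs v) _ _ _ (fun i (w : 'cV[R]_n) => w i 0 ^+ 2)
  (fun i => v i 0 ^+ 2)) => i.
rewrite expr2; under eq_fun do rewrite expr2.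
by apply: cvgM; exact: coord_continuous.
Qed.

Lemma norm_sqn v : `|v| ^+ 2 <= sqn v.
Proof.
rewrite -(sqr_sqrtr (sqn_ge0 v)) lerXn2r ?nnegrE ?sqrtr_ge0//.
apply: mx_norm_le => [|i j]; first exact: sqrtr_ge0.
rewrite (ord1 j) -sqrtr_sqr ler_sqrt ?sqn_ge0//.
by rewrite /sqn (bigD1 i)//= lerDl sumr_ge0// => k _; exact: sqr_ge0.
Qed.

Lemma sqn_norm v : sqn v <= n%:R * `|v| ^+ 2.
Proof.
rewrite /sqn; apply: (@le_trans _ _ (\sum_(i < n) `|v| ^+ 2)).
  apply: ler_sum => i _; rewrite -real_normK ?num_real//.
  by rewrite lerXn2r ?nnegrE//; exact: mx_norm_coord.
by rewrite sumr_const card_ord mulr_natl.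
Qed.

Lemma sqn0_eq0 v : sqn v <= 0 -> v = 0.
Proof.
move=> h; apply/normr0_eq0/eqP; rewrite -sqrf_eq0 eq_le sqr_ge0 andbT.
exact: le_trans (norm_sqn v) h.
Qed.

Lemma is_derive_sqnB x y (t : R) (u v : 'cV[R]_n) :
  is_derive t 1 x u -> is_derive t 1 y v ->
  is_derive t 1 (fun s => sqn (x s - y s))
    (\sum_i 2 * (x t i 0 - y t i 0) * (u i 0 - v i 0)).
Proof.
move=> dx dy.
have -> : (fun s => sqn (x s - y s)) =
    \sum_(i < n) (fun s => (x s i 0 - y s i 0) ^+ 2).
  apply/funext => s; rewrite fct_sumE; apply: eq_bigr => i _.
  by rewrite !mxE.
apply: is_derive_sum => i.
have d1 := is_derive_mx_coord i 0 dx; have d2 := is_derive_mx_coord i 0 dy.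
by apply: is_derive_eq; rewrite /GRing.scale/= mulrC [RHS]mulrC; ring.
Qed.

(** Each of the [n] terms in the derivative of [E] is at most [2 * L * |x - y| ^+ 2], and the
    squared maximum norm is at most [E]; hence the rate [2 * n * L]. The second inequality is the
    one for negative times. *)
Lemma sqnB_gronwall x y (dx dy : R -> 'cV[R]_n) (a b L : R) : a <= b ->
  (forall t : R, a < t < b -> is_derive t 1 x (dx t)) ->
  (forall t : R, a < t < b -> is_derive t 1 y (dy t)) ->
  (forall t : R, a < t < b -> `|dx t - dy t| <= L * `|x t - y t|) ->
  {within `[a, b], continuous x} -> {within `[a, b], continuous y} ->
  let E t := sqn (x t - y t) in let c := 2 * n%:R * L in
  E b <= E a * expR (c * (b - a)) /\ E a <= E b * expR (c * (b - a)).
Proof.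
move=> ab dxt dyt H cx cy E c.
pose dE t := \sum_i 2 * (x t i 0 - y t i 0) * (dx t i 0 - dy t i 0).
have dEt t : a < t < b -> is_derive t 1 E (dE t).
  by move=> tab; apply: is_derive_sqnB; [exact: dxt|exact: dyt].
have dEc t : a < t < b -> `|dE t| <= c * E t.
  move=> tab.
  have L0 : 0 <= L * `|x t - y t| by exact: le_trans (H t tab).
  have le1 : `|dE t| <= \sum_(i < n) 2 * (L * `|x t - y t| ^+ 2).
    apply: le_trans (ler_norm_sum _ _ _) _; apply: ler_sum => i _.
    rewrite !normrM ger0_norm// -mulrA ler_pM2l//.
    have -> : L * `|x t - y t| ^+ 2 = `|x t - y t| * (L * `|x t - y t|).
      by rewrite expr2; ring.
    apply: ler_pM => //.
      by have := mx_norm_coord (x t - y t) i 0; rewrite !mxE.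
    by have := mx_norm_coord (dx t - dy t) i 0; rewrite !mxE => /le_trans; apply; exact: H.
  apply: le_trans le1 _; rewrite sumr_const card_ord -mulr_natl /c /E.
  (* No sign of [L] is assumed; the Lipschitz inequality forces [0 <= L] only where the two curves
     differ. *)
  have [xy0|xy0] := eqVneq `|x t - y t| 0.
    by rewrite (normr0_eq0 xy0) normr0 /sqn big1 ?expr0n/= ?mulr0// => i _; rewrite mxE expr0n.
  have L00 : 0 <= L by rewrite -(pmulr_lge0 _ (_ : 0 < `|x t - y t|))// lt0r xy0 normr_ge0.
  have := norm_sqn (x t - y t) => h.
  rewrite [X in X <= _](_ : _ = 2 * n%:R * L * `|x t - y t| ^+ 2); last by ring.
  by rewrite ler_wpM2l// !mulr_ge0.
have cE : {within `[a, b], continuous E}.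
  apply/subspace_continuousP => t tab.
  have /subspace_continuousP/(_ t tab) hx := cx; have /subspace_continuousP/(_ t tab) hy := cy.
  exact: (cvg_comp _ _ (cvgB hx hy) (@sqn_continuous _)).
split.
  apply: (gronwall ab dEt) => // t tab.
  by apply: le_trans (dEc t tab); exact: ler_norm.
apply: (gronwall_backward ab dEt) => // t tab.
by rewrite lerNl; apply: le_trans (dEc t tab); rewrite -normrN; exact: ler_norm.
Qed.

End Solutions.

(** * Picard iteration *)

Section Antiderivative.
Context {R : realType}.

Lemma is_derive0_cst (u : R -> R) a b : a <= b ->
  (forall t : R, a < t < b -> is_derive t 1 u 0) ->
  {within `[a, b], continuous u} -> u b = u a.
Proof.
move=> ab du cu; apply/eqP; rewrite eq_le; apply/andP; split.
  by apply: (is_derive_nincr (du := cst 0)).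
rewrite -lerN2; apply: (is_derive_nincr (u := fun s => - u s) (du := cst 0)) => //.
  by move=> t /du dt; rewrite /cst -oppr0; exact: is_deriveN.
by move=> t; apply: (@continuousN _ _ (subspace `[a, b]) u); exact: cu.
Qed.

Lemma antiderivative_gt (phi : R -> R) (a : R) : continuous phi ->
  exists Phi : R -> R, forall t : R, a < t -> is_derive t 1 Phi (phi t).
Proof.
move=> cphi.
exists (fun x => \int[lebesgue_measure]_(s in [set` `[a, x]]) (phi s))%R => t at_.
have int : lebesgue_measure.-integrable `[a, t + 1] (EFin \o phi).
  apply: continuous_compact_integrable; first exact: segment_compact.
  exact: continuous_subspaceT.
have tt1 : t < t + 1 by rewrite ltrDl.
have [d1 d2] := @continuous_FTC1_closed R phi a t (t + 1) tt1 int at_ (cphi t).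
split; first exact: d1.
by rewrite -derive1E; exact: d2.
Qed.

(** An integral from a base point is used as a primitive only to the right of that point. Primitives
    with different base points differ by a constant, and are glued after normalisation at 0. *)
Lemma antiderivative (phi : R -> R) : continuous phi ->
  exists2 Phi : R -> R, Phi 0 = 0 & forall t : R, is_derive t 1 Phi (phi t).
Proof.
move=> cphi; have [P dP] := choice (fun a => antiderivative_gt a cphi).
have Pind a b t : a <= b -> b < 0 -> b < t -> P a t - P a 0 = P b t - P b 0.
  move=> ab b0 bt; pose u s := P a s - P b s.
  have du (s : R) : b < s -> is_derive s 1 u 0.
    move=> bs; rewrite -(subrr (phi s)).
    by apply: is_deriveB; apply: dP => //; exact: le_lt_trans bs.
  have cu c d : b < c -> {within `[c, d], continuous u}.
    move=> bc; apply: derivable_within_continuous => s; rewrite in_itv/= => /andP[cs _].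
    by case: (du s (lt_le_trans bc cs)).
  suff : u t = u 0 by rewrite /u => h; lra.
  have [t0|t0] := leP 0 t.
    apply: is_derive0_cst => //; last exact: cu.
    by move=> s /andP[s0 _]; apply: du; lra.
  apply/esym; apply: is_derive0_cst; [exact: ltW| |exact: cu].
  by move=> s /andP[s0 _]; apply: du; lra.
(* The base point [N t] lies to the left of both [t] and 0. For [s] at distance less than 1 from
   [t], [N s] lies to the right of the fixed point [b] below, so near [t] a single primitive is at
   work. *)
pose N (t : R) : R := - (`|t| + 1); pose Phi t := P (N t) t - P (N t) 0.
exists Phi; first by rewrite /Phi subrr.
move=> t; pose b := - (`|t| + 2).
have b0 : b < 0 by rewrite /b; have := normr_ge0 t; lra.
have bt : b < t by rewrite /b; have := ler_norm (- t); rewrite normrN; lra.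
have d0 : is_derive t 1 (fun s => P b s - P b 0) (phi t).
  by rewrite -[X in is_derive _ _ _ X]subr0; apply: is_deriveB; exact: dP.
have E : {near t, Phi =1 (fun s => P b s - P b 0)}.
  have : \forall s \near t, `|t - s| < 1.
    exact: near_norm_lt.
  apply: filterS => s ts; rewrite /Phi.
  have := ler_normB t (t - s); rewrite subKr => h1.
  have := ler_norm (- s); rewrite normrN => h2.
  by apply/esym/Pind; rewrite /b /N; have := normr_ge0 s; lra.
case: d0 => d1 d2; split.
  by apply: near_eq_derivable d1; apply: filterS E => s ->.
by rewrite -d2; apply: near_eq_derive => //; exact: oner_neq0.
Qed.

Lemma antiderivative_cV n (phi : R -> 'cV[R]_n) (p : 'cV[R]_n) : continuous phi ->
  exists2 Phi : R -> 'cV[R]_n, Phi 0 = p & forall t : R, is_derive t 1 Phi (phi t).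
Proof.
move=> cphi.
have H i : exists Phi : R -> R, Phi 0 = 0 /\ forall t : R, is_derive t 1 Phi (phi t i 0).
  have [|Phi P0 dP] := @antiderivative (fun t => phi t i 0); last by exists Phi.
  by move=> t; apply: cvg_mx_coord; exact: cphi.
have [Phi HPhi] := choice H.
exists (fun t => \col_i (Phi i t + p i 0)).
  by apply/colP => i; rewrite mxE (HPhi i).1 add0r.
move=> t; apply: is_derive_mx => i j; rewrite (ord1 j).
have -> : (fun s => (\col_i0 (Phi i0 s + p i0 0)) i 0) = Phi i + cst (p i 0).
  by apply/funext => s; rewrite mxE.
rewrite -[X in is_derive _ _ _ X]addr0; apply: is_deriveD; exact: (HPhi i).2.
Qed.

End Antiderivative.

Section Picard.
Context {R : realType} {n : nat}.

Lemma exp_bound_ge0 (y dy : R -> R) (M c : R) : 0 < c -> 0 <= M -> y 0 = 0 ->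
  (forall t : R, is_derive t 1 y (dy t)) ->
  (forall t, 0 <= t -> dy t <= M * expR (c * t)) ->
  forall t, 0 <= t -> y t <= M / c * expR (c * t).
Proof.
move=> c0 M0 y0 dyt H t t0.
pose u s := y s - M / c * expR (c * s).
have du (s : R) : is_derive s 1 u (dy s - M * expR (c * s)).
  rewrite (_ : M * _ = M / c *: (c * expR (c * s))); last first.
    by rewrite /GRing.scale/= mulrA divfK ?gt_eqF.
  by apply: is_deriveB; apply: is_deriveZ; exact: is_derive_expR_lin.
have : u t <= u 0.
  apply: (is_derive_nincr t0 (fun s _ => du s)).
    by move=> s /andP[s0 _]; rewrite subr_le0; apply: H; exact: ltW.
  by apply: within_continuousT; exact: is_derive_continuous du.
rewrite /u y0 mulr0 expR0 mulr1 sub0r => /le_trans.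
by rewrite -subr_le0 => h; apply: h; rewrite oppr_le0 divr_ge0// ltW.
Qed.

Lemma is_derive_reverse (V : normedModType R) (y : R -> V) (t : R) v :
  is_derive (- t) 1 y v -> is_derive t 1 (fun s => y (- s)) (- v).
Proof.
move=> [/derivable1_diffP dy <-].
have dc : differentiable (y \o -%R) t by apply: differentiable_comp.
split; first exact/derivable1_diffP.
rewrite deriveE// diff_comp//= deriveE//.
have -> : 'd -%R t 1 = - (1 : R) by rewrite -deriveE// derive_val.
by rewrite linearN.
Qed.

(** In the norm weighted by [expR (- c * |t|)], integration from 0 has norm at most [1 / c]. The
    scalar comparison is applied to every entry, with both signs and in reversed time. *)
Lemma exp_bound (y dy : R -> 'cV[R]_n) (M c : R) : 0 < c -> 0 <= M -> y 0 = 0 ->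
  (forall t : R, is_derive t 1 y (dy t)) ->
  (forall t, `|dy t| <= M * expR (c * `|t|)) ->
  forall t, `|y t| <= M / c * expR (c * `|t|).
Proof.
move=> c0 M0 y0 dyt H t.
apply: mx_norm_le => [|i j]; first by rewrite mulr_ge0 ?expR_ge0// divr_ge0// ltW.
have K (z dz : R -> 'cV[R]_n) : z 0 = 0 -> (forall s : R, is_derive s 1 z (dz s)) ->
    (forall s, `|dz s| <= M * expR (c * `|s|)) ->
    forall s, 0 <= s -> z s i j <= M / c * expR (c * s).
  move=> z0 dzs Hz; apply: (@exp_bound_ge0 _ (fun s => dz s i j)) => //.
  - by rewrite z0 mxE.
  - by move=> s; exact: is_derive_mx_coord.
  - move=> s s0; apply: le_trans (ler_norm _) _.
    apply: le_trans (mx_norm_coord _ _ _) _; apply: le_trans (Hz s) _.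
    by rewrite ger0_norm.
have Kpm (z dz : R -> 'cV[R]_n) : z 0 = 0 -> (forall s : R, is_derive s 1 z (dz s)) ->
    (forall s, `|dz s| <= M * expR (c * `|s|)) ->
    forall s, 0 <= s -> `|z s i j| <= M / c * expR (c * s).
  move=> z0 dzs Hz s s0; rewrite ler_norml (K z dz)// andbT.
  have := K (fun s => - z s) (fun s => - dz s); rewrite z0 oppr0.
  have d' (r : R) : is_derive r 1 (fun s => - z s) (- dz r).
    exact: (is_deriveN_fun (dzs r)).
  have n' r : `|- dz r| <= M * expR (c * `|r|) by rewrite normrN.
  by move=> /(_ erefl d' n' s s0); rewrite mxE lerNl.
have [t0|t0] := leP 0 t; first by rewrite (ger0_norm t0); exact: (Kpm y dy).
rewrite (ltr0_norm t0).
have := Kpm (fun s => y (- s)) (fun s => - dy (- s)); rewrite oppr0 y0.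
have d' (s : R) : is_derive s 1 (fun s => y (- s)) (- dy (- s)).
  exact: is_derive_reverse.
have n' s : `|- dy (- s)| <= M * expR (c * `|s|).
  by rewrite normrN; have := H (- s); rewrite normrN.
by move=> /(_ erefl d' n' (- t)); rewrite opprK oppr_ge0; apply; exact: ltW.
Qed.

Variables (f : 'cV[R]_n -> 'cV[R]_n) (L : R).
Hypothesis L0 : 0 < L.
Hypothesis fL : forall x y, `|f x - f y| <= L * `|x - y|.

Lemma globally_lipschitz_continuous : continuous f.
Proof.
apply: continuousP_dist => x e e0.
have : \forall y \near x, `|x - y| <= e / L by apply: near_norm_le; rewrite divr_gt0.
apply: filterS => y xy; apply: le_trans (fL x y) _.
by rewrite mulrC -ler_pdivlMr.
Qed.

Lemma geometric_lt (a e : R) : 0 < e -> exists k, a * 2^-1 ^+ k < e.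
Proof.
move=> e0.
have h : a * 2^-1 ^+ k @[k --> \oo] --> (0 : R).
  rewrite -[X in _ --> X](mulr0 a); apply: cvgM; first exact: cvg_cst.
  by apply: cvg_expr; rewrite ger0_norm ?invr_ge0// invf_lt1// ltr1n.
have /cvgr_lt/(_ e) := h; move=> /(_ e0) [k _ kP].
by exists k; apply: kP => /=.
Qed.

(* The iterates contract by 1/2 in the weighted norm sup_t exp(-2L|t|)|u(t)|. *)
Lemma global_solution (p : 'cV[R]_n) :
  exists2 x : R -> 'cV[R]_n, x 0 = p & forall t : R, is_derive t 1 x (f (x t)).
Proof.
(* The Picard map is chosen as a total function, with a junk value at discontinuous curves; all
   iterates from a constant curve are continuous. *)
have step (u : R -> 'cV[R]_n) : exists v : R -> 'cV[R]_n, continuous u ->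
    v 0 = p /\ forall t : R, is_derive t 1 v (f (u t)).
  have [cu|ncu] := pselect (continuous u); last by exists u.
  have [|v v0 dv] := @antiderivative_cV R n (f \o u) p; last by exists v.
  by move=> t; apply: continuous_comp; [exact: cu|exact: globally_lipschitz_continuous].
have [T HT] := choice step.
pose u k := iter k T (cst p).
have cu k : continuous (u k).
  elim: k => [|k IH]; first by move=> t; exact: cvg_cst.
  by apply: (is_derive_continuous (dx := fun t => f (u k t))) => t; apply: (HT _ IH).2.
have u0 k : u k 0 = p by case: k => [//|k]; exact: (HT _ (cu k)).1.
have du k (t : R) : is_derive t 1 (u k.+1) (f (u k t)) by exact: (HT _ (cu k)).2.
(* With this weight, the Lipschitz factor [L] followed by one integration contributes [L / c], which
   is the contraction rate 1/2. *)
pose c := 2 * L; have c0 : 0 < c by rewrite mulr_gt0.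
pose C := `|f p| / c; have C0 : 0 <= C by rewrite divr_ge0// ltW.
have half (M : R) : L * M / c = M * 2^-1.
  by rewrite /c invfM; field; rewrite gt_eqF.
have e1 (t : R) : 1 <= expR (c * `|t|) by rewrite -expR0 ler_expR mulr_ge0// ltW.
have bd k t : `|u k.+1 t - u k t| <= C * 2^-1 ^+ k * expR (c * `|t|).
  elim: k t => [|k IH] t.
    rewrite expr0 mulr1; apply: (@exp_bound (fun t => u 1%N t - u 0%N t) (fun=> f p - 0)) => //.
    - by rewrite !u0 subrr.
    - by move=> s; rewrite subr0 ler_peMr.
  rewrite exprSr mulrA -half.
  have M0 : 0 <= L * (C * 2^-1 ^+ k).
    by apply: mulr_ge0; [exact: ltW|apply: mulr_ge0 => //; exact: exprn_ge0].
  have y0 : u k.+2 0 - u k.+1 0 = 0 by rewrite !u0 subrr.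
  apply: (exp_bound c0 M0 y0 (fun s => is_deriveB_fun (du k.+1 s) (du k s))) => s.
  by apply: le_trans (fL _ _) _; rewrite -mulrA ler_pM2l.
have bd2 k j t : `|u (k + j)%N t - u k t| <= 2 * C * 2^-1 ^+ k * expR (c * `|t|).
  (* The sharper bound with the partial geometric sum is what the induction on [j] can carry. *)
  suff : `|u (k + j)%N t - u k t| <= 2 * C * 2^-1 ^+ k * (1 - 2^-1 ^+ j) * expR (c * `|t|).
    move=> /le_trans; apply; rewrite ler_pM2r ?expR_gt0//; apply: ler_piMr.
      by apply: mulr_ge0; [exact: mulr_ge0|exact: exprn_ge0].
    by rewrite gerBl exprn_ge0.
  elim: j => [|j IH]; first by rewrite addn0 subrr normr0 expr0 subrr mulr0 mul0r.
  rewrite addnS -(subrKA (u (k + j)%N t)).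
  apply: le_trans (ler_normD _ _) _; apply: le_trans (lerD (bd _ _) IH) _.
  by rewrite -mulrDl ler_pM2r ?expR_gt0// exprD exprSr; set A := _ ^+ k; set B := _ ^+ j; lra.
have cv t : exists l : 'cV[R]_n, u k t @[k --> \oo] --> l.
  apply/cvg_ex/cauchy_cvgP/cauchy_ballP => e e0; near_simpl.
  have [N HN] := geometric_lt (2 * (2 * C) * expR (c * `|t|)) e0.
  have HN' k : (N <= k)%N -> `|u k t - u N t| < e / 2.
    move=> Nk; have := bd2 N (k - N)%N t; rewrite subnKC// => /le_lt_trans; apply.
    by move: HN; set A := _ ^+ N; set B := expR _; lra.
  exists ([set k | (N <= k)%N], [set k | (N <= k)%N]) => /=; first by split; exists N.
  move=> [k l] /= [Nk Nl]; rewrite -ball_normE/= -(subrKA (u N t)).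
  apply: le_lt_trans (ler_normD _ _) _; rewrite (splitr e).
  by apply: ltrD; [exact: HN'|rewrite distrC; exact: HN'].
have [x ux] := choice cv.
have ux_le k t : `|x t - u k t| <= 2 * C * 2^-1 ^+ k * expR (c * `|t|).
  have h : `|u j t - u k t| @[j --> \oo] --> `|x t - u k t|.
    by apply: cvg_norm; apply: cvgB; [exact: ux|exact: cvg_cst].
  rewrite -(cvg_lim _ h)//; apply: limr_le; first by apply/cvg_ex; eexists; exact: h.
  exists k => // j /= kj.
  by have := bd2 k (j - k)%N t; rewrite subnKC.
(* For [|s| <= |t| + 1] the weight is bounded, so the convergence is uniform there and a
   three-epsilon argument applies. *)
have cx : continuous x.
  apply: continuousP_dist => t e e0.
  have e3 : 0 < e / 3 by rewrite divr_gt0.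
  have [N HN] := geometric_lt (2 * C * expR (c * (`|t| + 1))) e3.
  have near1 : \forall s \near t, `|t - s| <= 1.
    exact: near_norm_le.
  have near2 : \forall s \near t, `|u N t - u N s| <= e / 3.
    by have /cvgrPdist_le := cu N t; exact.
  have bN s : `|s| <= `|t| + 1 -> `|x s - u N s| <= e / 3.
    move=> st; apply: le_trans (ux_le N s) _; apply: ltW; apply: le_lt_trans HN.
    rewrite mulrAC; apply: ler_wpM2r; first exact: exprn_ge0.
    by apply: ler_wpM2l; [exact: mulr_ge0|rewrite ler_expR ler_pM2l].
  apply: filterS2 near1 near2 => s ts uts.
  rewrite -(subrKA (u N t)) -(subrKA (u N s) (u N t)).
  have -> : e = e / 3 + (e / 3 + e / 3) by field.
  apply: le_trans (ler_normD _ _) _; apply: lerD; first by apply: bN; rewrite lerDl.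
  apply: le_trans (ler_normD _ _) _; apply: lerD => //.
  rewrite distrC; apply: bN.
  by have := ler_normB t (t - s); rewrite subKr; lra.
(* [w] is the Picard image of the limit [x]. Both are close to the iterate [u N.+1], hence they
   coincide and [x] solves the equation. *)
have [|w w0 dw] := @antiderivative_cV R n (f \o x) p.
  by move=> t; apply: continuous_comp; [exact: cx|exact: globally_lipschitz_continuous].
suff xw : x = w by exists w => // t; have := dw t; rewrite -xw.
apply/funext => t; apply/eqP; rewrite -subr_eq0 -normr_le0; apply/ler_addgt0Pr => e e0.
have [N HN] := geometric_lt (2 * (C * expR (c * `|t|))) e0.
rewrite add0r -(subrKA (u N.+1 t)); apply: le_trans (ler_normD _ _) _.
have h1 : `|u N.+1 t - w t| <= 2 * C * 2^-1 ^+ N * 2^-1 * expR (c * `|t|).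
  rewrite -half.
  have M0 : 0 <= L * (2 * C * 2^-1 ^+ N).
    apply: mulr_ge0; first exact: ltW.
    by apply: mulr_ge0; [exact: mulr_ge0|exact: exprn_ge0].
  have y0 : u N.+1 0 - w 0 = 0 by rewrite !u0 w0 subrr.
  apply: (exp_bound c0 M0 y0 (fun s => is_deriveB_fun (du N s) (dw s))) => s.
  by apply: le_trans (fL _ _) _; rewrite -mulrA ler_pM2l// distrC.
apply: le_trans (lerD (ux_le _ _) h1) _; apply: ltW; apply: le_lt_trans HN.
by rewrite exprSr; set A := _ ^+ N; set B := expR _; lra.
Unshelve. all: by end_near. Qed.

End Picard.

(** * Determinants of positive semidefinite matrices *)

Section PositiveSemidefinite.
Context {R : realType}.

Definition qform {n} (M : 'M[R]_n) (u : 'cV[R]_n) : R := (u^T *m M *m u) 0 0.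

Definition sumsq {n} (u : 'cV[R]_n) : R := (u^T *m u) 0 0.

Lemma sumsqE n (u : 'cV[R]_n) : sumsq u = \sum_i u i 0 ^+ 2.
Proof. by rewrite /sumsq mxE; apply: eq_bigr => i _; rewrite mxE expr2. Qed.

Lemma sumsq_ge0 n (u : 'cV[R]_n) : 0 <= sumsq u.
Proof. by rewrite sumsqE; apply: sumr_ge0 => i _; exact: sqr_ge0. Qed.

Lemma sumsq_eq0 n (u : 'cV[R]_n) : sumsq u <= 0 -> u = 0.
Proof.
move=> u0; have {u0} : sumsq u == 0 by rewrite eq_le u0 sumsq_ge0.
rewrite sumsqE psumr_eq0; last by move=> i _; exact: sqr_ge0.
move=> /allP H; apply/colP => i; rewrite mxE.
by apply/eqP; rewrite -sqrf_eq0; exact: H (mem_index_enum i).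
Qed.

Lemma injective_det_neq0 n (M : 'M[R]_n) :
  (forall u : 'cV[R]_n, M *m u = 0 -> u = 0) -> \det M != 0.
Proof.
move=> Minj; rewrite -det_tr -unitfE -[_ \is a _]/(_ \in unitmx) -row_free_unit.
apply/inj_row_free => v vM; apply: trmx_inj; rewrite trmx0; apply: Minj.
by apply: trmx_inj; rewrite trmx_mul trmxK vM trmx0.
Qed.

(* The polynomial det((1 - X) I + X M) is 1 at 0 and has no root in [0, 1). *)
Lemma psd_det_ge0 n (M : 'M[R]_n) : (forall u, 0 <= qform M u) -> 0 <= \det M.
Proof.
move=> Mpsd; rewrite leNgt; apply/negP => M0.
pose p : {poly R} := \det (\matrix_(i < n, j < n) (('X * (M i j)%:P + (1 - 'X) *+ (i == j)) : {poly R})).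
have pE t : p.[t] = \det (t *: M + (1 - t)%:M).
  rewrite /p -horner_evalE -det_map_mx; congr (\det _).
  apply/matrixP => i j; rewrite !mxE /= /horner_eval.
  by rewrite hornerD hornerM hornerX hornerC hornerMn hornerD hornerN hornerX hornerC.
have p0 : 0 < p.[0] by rewrite pE scale0r add0r subr0 det1.
have p1 : p.[1] < 0 by rewrite pE scale1r subrr raddf0 addr0.
have : (- p).[0] <= 0 <= (- p).[1] by rewrite !hornerN oppr_le0 oppr_ge0 !ltW.
move=> /(poly_ivt ler01) [t /andP[t0 t1]]; rewrite rootN => /rootP pt.
have {}t1 : t < 1.
  by rewrite lt_neqAle t1 andbT; apply/eqP => t1'; move: p1; rewrite -t1' pt ltxx.
(* The quadratic form of this matrix dominates [(1 - t) * sumsq u], so its kernel is trivial for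
   [t < 1]. *)
have : \det (t *: M + (1 - t)%:M) != 0.
  apply: injective_det_neq0 => u Mu; apply: sumsq_eq0.
  have : t * qform M u + (1 - t) * sumsq u = 0.
    have -> : t * qform M u + (1 - t) * sumsq u =
        (u^T *m ((t *: M + (1 - t)%:M) *m u)) 0 0.
      rewrite mulmxDl mulmxDr mul_scalar_mx -!scalemxAl -!scalemxAr mulmxA.
      by rewrite [RHS]mxE [X in _ = X + _]mxE [X in _ = _ + X]mxE.
    by rewrite Mu mulmx0 mxE.
  have h1 : 0 <= t * qform M u by rewrite mulr_ge0.
  have h0 : 0 < 1 - t by rewrite subr_gt0.
  by move=> h2; rewrite -(pmulr_rle0 _ h0); lra.
by rewrite -pE pt eqxx.
Qed.

End PositiveSemidefinite.

(** * Algebra of the field at a point *)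

Section FieldAlgebra.
Context {R : realType} {n m k : nat}.
Variables (A : 'M[R]_(m, n)) (B : 'M[R]_(k, n)) (gv : 'cV[R]_k) (v : 'cV[R]_n).

Let d := \det (A *m A^T).
Let H := d *: 1%:M - A^T *m \adj (A *m A^T) *m A.
Let D := diag (neg_part gv).
Let Q := d *: (B *m H *m B^T) - d ^+ 2 *: D.
Let q := \det Q.
Let Rm := H *m B^T *m \adj Q.
Let w := Rm^T *m v.
Let F := d ^+ 4 *: (Rm *m D *m Rm^T *m v)
  - d ^+ 4 *: (Rm *m pos_part (Rm^T *m v))
  - d *: ((q *: 1%:M - d *: (Rm *m B)) *m H *m (q *: 1%:M - d *: (B^T *m Rm^T)) *m v).

Let neg_le0 j : neg_part gv j 0 <= 0.
Proof. by rewrite mxE ge_min lexx. Qed.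

Let mulD p (M : 'M[R]_(k, p)) i j : (D *m M) i j = neg_part gv i 0 * M i j.
Proof. by rewrite /D /diag mul_diag_mx mxE [_^T _ _]mxE. Qed.

(** Where [A *m A^T] is invertible, [H] is [d] times the orthogonal projection onto the kernel of
    [A]. The identities below hold without invertibility, since a matrix times its adjugate is its
    determinant. *)
Lemma projA : A *m H = 0.
Proof.
rewrite /H mulmxBr -scalemxAr mulmx1 !mulmxA mul_mx_adj mul_scalar_mx.
by rewrite subrr.
Qed.

Lemma proj_sym : H^T = H.
Proof.
rewrite /H linearB/= linearZ/= trmx1; congr (_ - _).
by rewrite !trmx_mul trmxK trmx_adj trmx_mul trmxK mulmxA.
Qed.

Lemma projAT : H *m A^T = 0.
Proof. by rewrite -proj_sym -trmx_mul projA trmx0. Qed.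

Lemma projK : H *m H = d *: H.
Proof.
rewrite {2}/H mulmxBr -scalemxAr mulmx1 !mulmxA projAT !mul0mx subr0.
by [].
Qed.

Lemma gram_psd p r (M : 'M[R]_(p, r)) (u : 'cV[R]_p) :
  qform (M *m M^T) u = sumsq (M^T *m u).
Proof. by rewrite /qform /sumsq trmx_mul trmxK !mulmxA. Qed.

Lemma gram_det_ge0 : 0 <= d.
Proof. by apply: psd_det_ge0 => u; rewrite gram_psd sumsq_ge0. Qed.

(** The factor [d] in front of [B H B'] in [Q] turns it into the Gram matrix of [B H], because
    [H H = d H]. The other term is nonnegative since [neg_part gv] is nonpositive. *)
Lemma qformQ (u : 'cV[R]_k) :
  qform Q u = sumsq (H *m B^T *m u) - d ^+ 2 * \sum_j neg_part gv j 0 * u j 0 ^+ 2.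
Proof.
have E : d *: (B *m H *m B^T) = (B *m H) *m (B *m H)^T.
  by rewrite trmx_mul proj_sym mulmxA -(mulmxA B H H) projK -scalemxAr -scalemxAl.
rewrite /qform /Q E mulmxBr mulmxBl [LHS]mxE; congr (_ + _).
  by rewrite -/(qform _ _) gram_psd trmx_mul proj_sym.
rewrite mxE -scalemxAr -scalemxAl mxE; congr (- (_ * _)).
rewrite -mulmxA mxE; apply: eq_bigr => j _.
by rewrite mulD mxE expr2 mulrCA.
Qed.

Lemma Q_psd (u : 'cV[R]_k) : 0 <= qform Q u.
Proof.
rewrite qformQ subr_ge0 (le_trans _ (sumsq_ge0 _))// mulr_ge0_le0 ?sqr_ge0//.
by apply: sumr_le0 => j _; rewrite mulr_le0_ge0 ?sqr_ge0.
Qed.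

Lemma detQ_ge0 : 0 <= q.
Proof. by apply: psd_det_ge0 => u; exact: Q_psd. Qed.

Lemma Q_sym : Q^T = Q.
Proof.
rewrite /Q linearB/= !linearZ/= !trmx_mul trmxK proj_sym mulmxA.
by rewrite /D /diag tr_diag_mx.
Qed.

Lemma RmT : Rm^T = \adj Q *m B *m H.
Proof. by rewrite /Rm !trmx_mul trmxK proj_sym trmx_adj Q_sym mulmxA. Qed.

(** This is [Q *m \adj Q = q] with the diagonal term moved to the right: up to that term, [B *m Rm]
    is a multiple of the identity. *)
Lemma BRm : d *: (B *m Rm) = q%:M + d ^+ 2 *: (D *m \adj Q).
Proof.
rewrite -mul_mx_adj {1}/Q mulmxBl -!scalemxAl subrK /Rm !mulmxA.
by rewrite scalemxAl.
Qed.

(** With the candidate multiplier [mu = - (d / q) w], [z] equals [q (v + B' mu)]. When [d] is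
    positive, [H z = 0] says that [v + B' mu] lies in the range of [A']. *)
Let z := q *: v - d *: (B^T *m w).

Lemma mul_field p (u : 'M[R]_(p, n)) : u *m F =
  d ^+ 4 *: (u *m Rm *m (D *m w)) - d ^+ 4 *: (u *m Rm *m pos_part w)
  - d *: ((q *: u - d *: (u *m Rm *m B)) *m (H *m z)).
Proof.
have zE : (q *: 1%:M - d *: (B^T *m Rm^T)) *m v = z.
  by rewrite mulmxBl -!scalemxAl mul1mx -mulmxA.
have uE : u *m (q *: 1%:M - d *: (Rm *m B)) = q *: u - d *: (u *m Rm *m B).
  by rewrite mulmxBr -!scalemxAr mulmx1 mulmxA.
rewrite /F -[_ *m H *m _ *m v]mulmxA zE; set N := q *: 1%:M - _ in uE *.
rewrite mulmxBr [u *m (_ - _)]mulmxBr -!scalemxAr -uE /w.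
by rewrite !mulmxA.
Qed.

Lemma A_field : A *m F = 0.
Proof.
have AR : A *m Rm = 0 by rewrite /Rm !mulmxA projA !mul0mx.
rewrite mul_field AR !mul0mx !scaler0 subrr sub0r subr0 -scalemxAl mulmxA projA.
by rewrite mul0mx !scaler0 oppr0.
Qed.

Lemma pos_part_D : (pos_part gv)^T *m D = 0.
Proof.
apply/rowP => j; rewrite /D /diag mul_mx_diag !mxE.
by rewrite minEle maxEle; case: ifP => _; rewrite ?mul0r ?mulr0.
Qed.

(** By complementarity [pos_part gv] annihilates [D], so [d * (gp B R) = q * gp], where [gp] is the
    transposed positive part. The first and third terms of [F] then vanish against [gp B], and only
    the one with [pos_part w] survives. *)
Lemma gB_field : (pos_part gv)^T *m B *m F =
  - (d ^+ 3 * q) *: ((pos_part gv)^T *m pos_part w).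
Proof.
set gp := (pos_part gv)^T.
have gBR : d *: (gp *m B *m Rm) = q *: gp.
  rewrite -mulmxA scalemxAr BRm mulmxDr mul_mx_scalar -scalemxAr mulmxA.
  by rewrite pos_part_D mul0mx scaler0 addr0.
have gBR4 : d ^+ 4 *: (gp *m B *m Rm) = (d ^+ 3 * q) *: gp.
  by rewrite exprSr -scalerA gBR scalerA.
have g4 (M : 'cV[R]_k) : d ^+ 4 *: (gp *m B *m Rm *m M) = (d ^+ 3 * q) *: (gp *m M).
  by rewrite scalemxAl gBR4 -scalemxAl.
have gB : d *: (gp *m B *m Rm *m B) = q *: (gp *m B) by rewrite scalemxAl gBR -scalemxAl.
rewrite mul_field !g4 gB mulmxA pos_part_D.
by rewrite !mul0mx scaler0 sub0r subrr mul0mx scaler0 subr0 scaleNr.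
Qed.

Lemma gB_field_le0 : ((pos_part gv)^T *m B *m F) 0 0 <= 0.
Proof.
rewrite gB_field mxE mulNr oppr_le0 mulr_ge0//.
  by rewrite mulr_ge0 ?detQ_ge0// exprn_ge0// gram_det_ge0.
rewrite mxE sumr_ge0// => j _.
by rewrite !mxE mulr_ge0// le_max lexx.
Qed.

(** The last term of [F] contributes [d * z' H z], which is a sum of squares because [d H = H H].
    All three contributions are thus nonpositive, each measuring the failure of one KKT
    condition. *)
Lemma v_field : (v^T *m F) 0 0 =
  d ^+ 4 * (\sum_j neg_part gv j 0 * w j 0 ^+ 2)
  - d ^+ 4 * (\sum_j pos_part w j 0 ^+ 2) - sumsq (H *m z).
Proof.
have vR : v^T *m Rm = w^T by rewrite /w trmx_mul trmxK.
have zT : q *: v^T - d *: (w^T *m B) = z^T.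
  by rewrite /z linearB/= !linearZ/= (trmx_mul B^T w) trmxK.
rewrite mul_field vR zT [LHS]mxE [X in X + _ = _]mxE; congr (_ + _ + _).
- rewrite mxE mxE; congr (_ * _); apply: eq_bigr => j _.
  by rewrite mulD mxE expr2 mulrCA.
- rewrite mxE [X in - X]mxE mxE; congr (- (_ * _)); apply: eq_bigr => j _.
  rewrite [w^T _ _]mxE [pos_part _ _ _]mxE maxEle; case: ifP => _; first by rewrite expr2.
  by rewrite expr2 !mulr0.
- rewrite mxE scalemxAr scalemxAl -projK /sumsq trmx_mul proj_sym; congr (- _).
  by rewrite !mulmxA.
Qed.

Lemma v_field_le0 : (v^T *m F) 0 0 <= 0.
Proof.
have d4 : 0 <= d ^+ 4 by rewrite exprn_ge0// gram_det_ge0.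
rewrite v_field; set s1 := \sum_j _; set s2 := \sum_j _.
have h1 : d ^+ 4 * s1 <= 0.
  by rewrite mulr_ge0_le0// sumr_le0// => j _; rewrite mulr_le0_ge0// sqr_ge0.
have h2 : 0 <= d ^+ 4 * s2 by rewrite mulr_ge0// sumr_ge0// => j _; exact: sqr_ge0.
by have := sumsq_ge0 (H *m z); lra.
Qed.

Hypothesis gv_le0 : forall j, gv j 0 <= 0.
Hypothesis licq : forall (lambda : 'cV[R]_m) (mu : 'cV[R]_k),
  (forall j, gv j 0 < 0 -> mu j 0 = 0) ->
  A^T *m lambda + B^T *m mu = 0 -> lambda = 0 /\ mu = 0.

Let negE j : neg_part gv j 0 = gv j 0.
Proof. by rewrite mxE; apply/min_idPr. Qed.

Lemma gram_det_gt0 : 0 < d.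
Proof.
rewrite lt_neqAle gram_det_ge0 andbT eq_sym; apply: injective_det_neq0 => u Au.
have Atu : A^T *m u = 0.
  apply: sumsq_eq0; rewrite /sumsq trmx_mul trmxK.
  by rewrite -mulmxA (mulmxA A) Au mulmx0 mxE.
have [||-> //] := @licq u 0; first by move=> j _; rewrite mxE.
by rewrite Atu mulmx0 addr0.
Qed.

Lemma proj_eq0 (y : 'cV[R]_n) : H *m y = 0 ->
  y = A^T *m (d^-1 *: (\adj (A *m A^T) *m A *m y)).
Proof.
rewrite /H mulmxBl -scalemxAl mul1mx => /eqP; rewrite subr_eq0 => /eqP E.
rewrite -scalemxAr !mulmxA -E scalerA mulVf ?scale1r// gt_eqF//.
exact: gram_det_gt0.
Qed.

(** If [Q u = 0], both nonnegative parts of the quadratic form vanish: [u] is supported on the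
    active constraints and [B' u] lies in the range of [A']. Independence of the active gradients
    then gives [u = 0]. *)
Lemma detQ_gt0 : 0 < q.
Proof.
rewrite lt_neqAle detQ_ge0 andbT eq_sym; apply: injective_det_neq0 => u Qu.
have d2 : 0 < d ^+ 2 by rewrite exprn_gt0// gram_det_gt0.
have : qform Q u = 0 by rewrite /qform -mulmxA Qu mulmx0 mxE.
rewrite qformQ.
have s0 : \sum_j - (neg_part gv j 0 * u j 0 ^+ 2) >= 0.
  by rewrite sumr_ge0// => j _; rewrite oppr_ge0 mulr_le0_ge0// sqr_ge0.
have := sumsq_ge0 (H *m B^T *m u) => h1 h2.
have h3 : \sum_j - (neg_part gv j 0 * u j 0 ^+ 2) == 0.
  rewrite eq_le s0 andbT -(pmulr_rle0 _ d2) sumrN mulrN; lra.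
have HBu : H *m (B^T *m u) = 0.
  apply: sumsq_eq0; rewrite mulmxA; move/eqP: h3; rewrite sumrN => /eqP.
  rewrite oppr_eq0 => /eqP h3; move: h2; rewrite h3; lra.
have u0 j : gv j 0 < 0 -> u j 0 = 0.
  move=> gj; move: h3; rewrite psumr_eq0; last first.
    by move=> i _; rewrite oppr_ge0 mulr_le0_ge0// sqr_ge0.
  move=> /allP /(_ j (mem_index_enum j)); rewrite /= oppr_eq0 mulf_eq0 sqrf_eq0.
  by rewrite negE lt_eqF//= => /eqP.
have := proj_eq0 HBu; set l := _ *: _ => E.
have [|_ -> //] := @licq (- l) u u0.
by rewrite mulmxN E addNr.
Qed.

(** The three terms vanish separately. The one with [neg_part gv] gives complementarity, the one
    with [pos_part w] gives [w <= 0], hence the sign of [mu = - (d / q) w], and [H z = 0] gives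
    stationarity, with [lambda] read off from a preimage under [A']. *)
Lemma v_field_eq0 : (v^T *m F) 0 0 = 0 ->
  exists (lambda : 'cV[R]_m) (mu : 'cV[R]_k),
  [/\ forall j, 0 <= mu j 0, v + A^T *m lambda + B^T *m mu = 0 & mu^T *m gv = 0].
Proof.
have d0 := gram_det_gt0; have q0 := detQ_gt0.
have d4 : 0 < d ^+ 4 by rewrite exprn_gt0.
rewrite v_field; set s1 := \sum_j _; set s2 := \sum_j _.
have h1 : s1 <= 0.
  by rewrite sumr_le0// => j _; rewrite mulr_le0_ge0// sqr_ge0.
have h2 : 0 <= s2 by rewrite sumr_ge0// => j _; exact: sqr_ge0.
have h1' : d ^+ 4 * s1 <= 0 by rewrite pmulr_rle0.
have h2' : 0 <= d ^+ 4 * s2 by rewrite pmulr_rge0.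
have h3 := sumsq_ge0 (H *m z) => E.
have s10 : - s1 == 0 by rewrite oppr_eq0 eq_le h1 -(pmulr_rge0 _ d4); lra.
have s20 : s2 == 0 by rewrite eq_le h2 andbT -(pmulr_rle0 _ d4); lra.
have /proj_eq0 zE : H *m z = 0 by apply: sumsq_eq0; lra.
have w_le0 j : w j 0 <= 0.
  move: s20; rewrite psumr_eq0; last by move=> i _; exact: sqr_ge0.
  move=> /allP /(_ j (mem_index_enum j)); rewrite /= sqrf_eq0 mxE => /eqP <-.
  by rewrite le_max lexx orbT.
have gw j : w j 0 * gv j 0 = 0.
  move: s10; rewrite -sumrN psumr_eq0; last first.
    by move=> i _; rewrite oppr_ge0 mulr_le0_ge0// sqr_ge0.
  move=> /allP /(_ j (mem_index_enum j)); rewrite /= oppr_eq0 mulf_eq0 sqrf_eq0.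
  by rewrite negE => /orP[] /eqP ->; rewrite ?mulr0 ?mul0r.
move: zE; set l := _ *: (_ *m z) => zE.
exists (- (q^-1 *: l)), (- ((d / q) *: w)); split.
- by move=> j; rewrite mxE [X in - X]mxE oppr_ge0 pmulr_rle0// divr_gt0.
- have -> : v = q^-1 *: (z + d *: (B^T *m w)).
    by rewrite subrK scalerA mulVf ?scale1r// gt_eqF.
  rewrite zE scalerDr scalerA !mulmxN -!scalemxAr (mulrC d).
  by rewrite addrAC addrK subrr.
- rewrite linearN linearZ/= mulNmx -scalemxAl (_ : w^T *m gv = 0) ?scaler0 ?oppr0//.
  apply/matrixP => i j; rewrite (ord1 i) (ord1 j) mxE big1 ?mxE// => r _.
  by rewrite [w^T _ _]mxE gw.
Qed.

(** The KKT conditions force [w = - (q / d) mu] and [z = - q A' lambda], so [D w], [pos_part w] and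
    [H z] all vanish. *)
Lemma field_eq0 (lambda : 'cV[R]_m) (mu : 'cV[R]_k) :
  (forall j, 0 <= mu j 0) -> v + A^T *m lambda + B^T *m mu = 0 ->
  mu^T *m gv = 0 -> F = 0.
Proof.
move=> mu0 /eqP vE mug; have d0 := gram_det_gt0; have q0 := detQ_gt0.
have {}vE : v = - (A^T *m lambda) - B^T *m mu.
  by apply/eqP; rewrite -subr_eq0 !opprD !opprK addrA.
have gmu j : gv j 0 * mu j 0 = 0.
  have /matrixP/(_ 0 0) := mug; rewrite !mxE => /eqP.
  under eq_bigr do rewrite mxE.
  rewrite -oppr_eq0 -sumrN psumr_eq0; last first.
    by move=> i _; rewrite oppr_ge0 mulr_ge0_le0.
  move=> /allP /(_ j (mem_index_enum j)); rewrite /= oppr_eq0 mulrC => /eqP //.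
have Dmu : D *m mu = 0.
  by apply/colP => j; rewrite mulD negE gmu mxE.
(* [H A' = 0] removes [lambda], and [D mu = 0] gives [d B H B' mu = Q mu], which [\adj Q] sends to
   [q mu]. *)
have dw : d *: w = - (q *: mu).
  rewrite /w RmT vE mulmxBr mulmxN -[_ *m H *m (_ *m lambda)]mulmxA (mulmxA H).
  rewrite projAT mul0mx mulmx0 oppr0 sub0r scalerN; congr (- _).
  have Qmu : Q *m mu = d *: (B *m H *m B^T *m mu).
    by rewrite mulmxBl -!scalemxAl Dmu scaler0 subr0.
  have -> : q *: mu = \adj Q *m (Q *m mu) by rewrite mulmxA mul_adj_mx mul_scalar_mx.
  by rewrite Qmu -scalemxAr !mulmxA.
have wE : w = - ((q / d) *: mu).
  have : d^-1 *: (d *: w) = d^-1 *: - (q *: mu) by rewrite dw.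
  by rewrite scalerA mulVf ?gt_eqF// scale1r scalerN scalerA (mulrC d^-1).
have Dw : D *m w = 0 by rewrite wE mulmxN -scalemxAr Dmu scaler0 oppr0.
have pw : pos_part w = 0.
  apply/colP => j; rewrite [LHS]mxE [RHS]mxE; apply/max_idPl.
  by rewrite wE !mxE oppr_le0 mulr_ge0// divr_ge0// ltW.
have Hz : H *m z = 0.
  rewrite /z (scalemxAr d B^T w) dw vE mulmxN -scalemxAr opprK scalerBr scalerN subrK.
  by rewrite mulmxN -scalemxAr mulmxA projAT mul0mx scaler0 oppr0.
by rewrite -[LHS]mul1mx mul_field pw Hz Dw !mulmx0 !scaler0 !subr0.
Qed.

End FieldAlgebra.

(** * Local Lipschitz continuity *)

Section LipschitzAt.
Context {R : realType} {V : normedModType R}.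
Implicit Types (x y z : V).

(** Phrased with the filter of neighbourhoods of [(x, x)] in the product, so that bounds for sums
    and products combine by intersecting neighbourhoods. *)
Definition lip_at (W : normedModType R) (f : V -> W) x := exists2 M : R, 0 <= M &
  \forall p \near (x, x), `|f p.1 - f p.2| <= M * `|p.1 - p.2|.

Lemma lip_at_continuous (W : normedModType R) (f : V -> W) x :
  lip_at f x -> f y @[y --> x] --> f x.
Proof.
move=> [M M0 [[/= U1 U2] [U1x U2x] H]]; apply/cvgrPdist_le => e e0.
have M1 : 0 < M + 1 by rewrite ltr_wpDl.
have near1 : \forall y \near x, `|x - y| <= e / (M + 1).
  by apply: near_norm_le; rewrite divr_gt0.
apply: filterS2 near1 U1x => y xy U1y; rewrite distrC.
have := H (y, x) (conj U1y (nbhs_singleton U2x)) => /= /le_trans; apply.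
rewrite distrC; apply: (@le_trans _ _ ((M + 1) * `|x - y|)).
  by rewrite ler_wpM2r// lerDl.
by rewrite mulrC -ler_pdivlMr.
Qed.

Lemma lip_at_cst (W : normedModType R) (c : W) x : lip_at (fun=> c) x.
Proof.
exists 0 => //; exists (setT, setT) => [|p _] /=; first by split; exact: filterT.
by rewrite subrr normr0 mul0r.
Qed.

Lemma lip_atD (W : normedModType R) (f g : V -> W) x :
  lip_at f x -> lip_at g x -> lip_at (fun y => f y + g y) x.
Proof.
move=> [M M0 Hf] [N N0 Hg]; exists (M + N); first exact: addr_ge0.
apply: filterS2 Hf Hg => p Hf Hg.
by rewrite opprD addrACA mulrDl; apply: le_trans (ler_normD _ _) _; exact: lerD.
Qed.

Lemma lip_atN (W : normedModType R) (f : V -> W) x :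
  lip_at f x -> lip_at (fun y => - f y) x.
Proof.
move=> [M M0 Hf]; exists M => //; apply: filterS Hf => p.
by rewrite -opprD normrN.
Qed.

Lemma lip_atB (W : normedModType R) (f g : V -> W) x :
  lip_at f x -> lip_at g x -> lip_at (fun y => f y - g y) x.
Proof. by move=> fx gx; apply: lip_atD => //; exact: lip_atN. Qed.

Lemma lip_atM (f g : V -> R) x :
  lip_at f x -> lip_at g x -> lip_at (fun y => f y * g y) x.
Proof.
move=> fx gx; have cf := lip_at_continuous fx; have cg := lip_at_continuous gx.
case: fx gx => M M0 Hf [N N0 Hg].
exists ((`|f x| + 1) * N + (`|g x| + 1) * M); first by rewrite addr_ge0// mulr_ge0// addr_ge0.
have bf : \forall p \near (x, x), `|f p.1| <= `|f x| + 1.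
  have c : (fun p : V * V => `|f p.1|) @ (x, x) --> `|f x|.
    by apply: cvg_norm; apply: (cvg_comp _ _ cvg_fst cf).
  by apply: (cvgr_le _ c); rewrite ltrDl.
have bg : \forall p \near (x, x), `|g p.2| <= `|g x| + 1.
  have c : (fun p : V * V => `|g p.2|) @ (x, x) --> `|g x|.
    by apply: cvg_norm; apply: (cvg_comp _ _ cvg_snd cg).
  by apply: (cvgr_le _ c); rewrite ltrDl.
have H1 := @filterI _ (nbhs (x, x)) _ _ _ bf bg.
have H2 := @filterI _ (nbhs (x, x)) _ _ _ Hf Hg.
apply: filterS2 (H1 _) (H2 _) => p [hf hg] [lf lg].
have -> : f p.1 * g p.1 - f p.2 * g p.2 =
    f p.1 * (g p.1 - g p.2) + g p.2 * (f p.1 - f p.2) by ring.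
apply: le_trans (ler_normD _ _) _; rewrite mulrDl -!mulrA !normrM.
by apply: lerD; apply: ler_pM.
Qed.

Lemma lip_at_sum (W : normedModType R) (I : Type) (r : seq I) (P : pred I) (f : I -> V -> W) x :
  (forall i, lip_at (f i) x) -> lip_at (fun y => \sum_(i <- r | P i) f i y) x.
Proof.
move=> fx; elim: r => [|i r IH].
  by under eq_fun do rewrite big_nil; exact: lip_at_cst.
under eq_fun do rewrite big_cons.
by case: (P i) => //; exact: lip_atD.
Qed.

Lemma lip_at_prod (I : Type) (r : seq I) (P : pred I) (f : I -> V -> R) x :
  (forall i, lip_at (f i) x) -> lip_at (fun y => \prod_(i <- r | P i) f i y) x.
Proof.
move=> fx; elim: r => [|i r IH].
  by under eq_fun do rewrite big_nil; exact: lip_at_cst.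
under eq_fun do rewrite big_cons.
by case: (P i) => //; exact: lip_atM.
Qed.

Lemma lip_atX (f : V -> R) (i : nat) x : lip_at f x -> lip_at (fun y => f y ^+ i) x.
Proof.
move=> fx; elim: i => [|i IH]; first exact: lip_at_cst.
by under eq_fun do rewrite exprS; exact: lip_atM.
Qed.

Lemma max0_lip (a b : R) : `|Num.max 0 a - Num.max 0 b| <= `|a - b|.
Proof.
have := ler_norm (a - b); have := ler_norm (- (a - b)); rewrite normrN.
by rewrite ler_norml; case: (leP 0 a); case: (leP 0 b); lra.
Qed.

Lemma min0_lip (a b : R) : `|Num.min 0 a - Num.min 0 b| <= `|a - b|.
Proof.
have := ler_norm (a - b); have := ler_norm (- (a - b)); rewrite normrN.
by rewrite ler_norml; case: (leP 0 a); case: (leP 0 b); lra.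
Qed.

Lemma lip_at_max0 (f : V -> R) x : lip_at f x -> lip_at (fun y => Num.max 0 (f y)) x.
Proof.
move=> [M M0 Hf]; exists M => //; apply: filterS Hf => p.
exact: le_trans (max0_lip _ _).
Qed.

Lemma lip_at_min0 (f : V -> R) x : lip_at f x -> lip_at (fun y => Num.min 0 (f y)) x.
Proof.
move=> [M M0 Hf]; exists M => //; apply: filterS Hf => p.
exact: le_trans (min0_lip _ _).
Qed.

End LipschitzAt.

Section LipschitzMatrix.
Context {R : realType} {V : normedModType R}.
Implicit Types (x : V).

(** Entrywise, because determinants and adjugates are polynomials in the entries. *)
Definition lip_mx p q (M : V -> 'M[R]_(p, q)) x :=
  forall i j, lip_at (fun y => M y i j) x.

Lemma lip_mx_at p q (M : V -> 'M[R]_(p, q)) x : lip_mx M x -> lip_at M x.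
Proof.
move=> Mx.
have H (ij : 'I_p * 'I_q) : exists L : R, 0 <= L /\ \forall r \near (x, x),
    `|M r.1 ij.1 ij.2 - M r.2 ij.1 ij.2| <= L * `|r.1 - r.2|.
  by have [L] := Mx ij.1 ij.2; exists L.
have [L HL] := choice H; clear H.
have L0 ij : 0 <= L ij by case: (HL ij).
exists (\sum_ij L ij); first by apply: sumr_ge0.
have : \forall r \near (x, x), forall ij,
    `|M r.1 ij.1 ij.2 - M r.2 ij.1 ij.2| <= L ij * `|r.1 - r.2|.
  by apply: (@filter_forall _ _ _ (nbhs (x, x))) => ij; case: (HL ij).
apply: filterS => r H; apply: mx_norm_le; first by rewrite mulr_ge0// sumr_ge0.
move=> i j; rewrite !mxE; apply: le_trans (H (i, j)) _.
rewrite ler_wpM2r// (bigD1 (i, j))//= lerDl sumr_ge0//.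
Qed.

Lemma lip_mx_cst p q (c : 'M[R]_(p, q)) x : lip_mx (fun=> c) x.
Proof. by move=> i j; exact: lip_at_cst. Qed.

Lemma lip_mxD p q (M N : V -> 'M[R]_(p, q)) x :
  lip_mx M x -> lip_mx N x -> lip_mx (fun y => M y + N y) x.
Proof.
by move=> Mx Nx i j; under eq_fun do rewrite mxE; exact: lip_atD.
Qed.

Lemma lip_mxB p q (M N : V -> 'M[R]_(p, q)) x :
  lip_mx M x -> lip_mx N x -> lip_mx (fun y => M y - N y) x.
Proof.
by move=> Mx Nx i j; under eq_fun do rewrite !mxE; exact: lip_atB.
Qed.

Lemma lip_mxZ p q (c : V -> R) (M : V -> 'M[R]_(p, q)) x :
  lip_at c x -> lip_mx M x -> lip_mx (fun y => c y *: M y) x.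
Proof.
by move=> cx Mx i j; under eq_fun do rewrite mxE; exact: lip_atM.
Qed.

Lemma lip_mxM p q r (M : V -> 'M[R]_(p, q)) (N : V -> 'M[R]_(q, r)) x :
  lip_mx M x -> lip_mx N x -> lip_mx (fun y => M y *m N y) x.
Proof.
move=> Mx Nx i j; under eq_fun do rewrite mxE.
by apply: lip_at_sum => l; exact: lip_atM.
Qed.

Lemma lip_mxT p q (M : V -> 'M[R]_(p, q)) x :
  lip_mx M x -> lip_mx (fun y => (M y)^T) x.
Proof. by move=> Mx i j; under eq_fun do rewrite mxE; exact: Mx. Qed.

Lemma lip_det p (M : V -> 'M[R]_p) x : lip_mx M x -> lip_at (fun y => \det (M y)) x.
Proof.
move=> Mx; rewrite /determinant; apply: lip_at_sum => s.
by apply: lip_atM; [exact: lip_at_cst|apply: lip_at_prod].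
Qed.

Lemma lip_adj p (M : V -> 'M[R]_p) x : lip_mx M x -> lip_mx (fun y => \adj (M y)) x.
Proof.
move=> Mx i j; under eq_fun do rewrite mxE /cofactor.
apply: lip_atM; first exact: lip_at_cst.
by apply: lip_det => a b; under eq_fun do rewrite !mxE; exact: Mx.
Qed.

Lemma lip_pos_part p (M : V -> 'cV[R]_p) x :
  lip_mx M x -> lip_mx (fun y => pos_part (M y)) x.
Proof. by move=> Mx i j; under eq_fun do rewrite mxE; exact: lip_at_max0. Qed.

Lemma lip_neg_part p (M : V -> 'cV[R]_p) x :
  lip_mx M x -> lip_mx (fun y => neg_part (M y)) x.
Proof. by move=> Mx i j; under eq_fun do rewrite mxE; exact: lip_at_min0. Qed.

Lemma lip_diag p (M : V -> 'cV[R]_p) x :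
  lip_mx M x -> lip_mx (fun y => diag (M y)) x.
Proof.
move=> Mx i j; under eq_fun do rewrite !mxE mulrb.
by case: (i == j); [exact: Mx|exact: lip_at_cst].
Qed.

End LipschitzMatrix.

Section LipschitzClasses.
Context {R : realType} {n : nat}.
Implicit Types (phi : 'cV[R]_n -> R) (x : 'cV[R]_n).

Lemma locally_lipschitz_at phi x : locally_lipschitz phi -> lip_at phi x.
Proof.
move=> /(_ x) [U Ux [M [_ HM]]]; exists (`|M| + 1); first exact: addr_ge0.
exists (U, U) => // p [U1 U2] /=.
by apply: (HM (`|M| + 1)); [rewrite (le_lt_trans (ler_norm _))// ltrDl|].
Qed.

Lemma mulmx_row_le (g : 'rV[R]_n) (v : 'cV[R]_n) :
  `|(g *m v) 0 0| <= n%:R * `|g| * `|v|.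
Proof.
rewrite mxE; apply: le_trans (ler_norm_sum _ _ _) _.
apply: (@le_trans _ _ (\sum_(i < n) `|g| * `|v|)).
  by apply: ler_sum => i _; rewrite normrM ler_pM// mx_norm_coord.
by rewrite sumr_const card_ord -mulrA mulr_natl.
Qed.

(** The mean value theorem on the segment from [z] to [y], inside a ball on which continuity bounds
    the gradient by its norm at [x] plus 1. *)
Lemma C1_lip_at phi x : C1 phi -> lip_at phi x.
Proof.
move=> [dphi cg]; pose G := `|grad phi x| + 1.
have G0 : 0 <= G by exact: addr_ge0.
have [e e0 He] : exists2 e : R, 0 < e & forall y, `|x - y| < e -> `|grad phi y| <= G.
  have : \forall y \near x, `|grad phi x - grad phi y| <= 1.
    by have /cvgrPdist_le/(_ _ ltr01) := cg x.
  have le1 y : `|grad phi x - grad phi y| <= 1 -> `|grad phi y| <= G.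
    by move=> h; have := ler_normB (grad phi x) (grad phi x - grad phi y); rewrite subKr /G; lra.
  move=> /(filterS le1).
  move=> /nbhs_ballP [e /= e0 He]; exists e => // y xy; apply: He.
  by rewrite -ball_normE.
exists (n%:R * G); first exact: mulr_ge0.
have near1 : \forall y \near x, `|x - y| < e by exact: near_norm_lt.
exists ([set y | `|x - y| < e], [set y | `|x - y| < e]); first by split.
move=> [y z] /= [xy xz].
pose c (t : R) : 'cV[R]_n := z + t *: (y - z).
have dc (t : R) : is_derive t 1 c (y - z).
  apply: is_derive_mx => i j.
  have -> : (fun s => c s i j) = cst (z i j) + (fun s : R => s * (y - z) i j).
    by apply/funext => s; rewrite !mxE.
  rewrite -[X in is_derive _ _ _ X]add0r; apply: is_deriveD.
  have -> : (fun s : R => s * (y - z) i j) = (y - z) i j *: (@id R).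
    by apply/funext => s; rewrite /GRing.scale/= mulrC.
  by rewrite -[X in is_derive _ _ _ X]mulr1; exact: is_deriveZ.
have dpc (t : R) : is_derive t 1 (phi \o c) ((grad phi (c t) *m (y - z)) 0 0).
  by apply: is_derive_comp_grad.
have cont : {within `[0, 1], continuous (phi \o c)}.
  by apply: within_continuousT; exact: is_derive_continuous dpc.
have [t t01 E] := MVT_segment ler01 (fun t _ => dpc t) cont.
have -> : phi y - phi z = (grad phi (c t) *m (y - z)) 0 0.
  by move: E; rewrite /c /= scale1r scale0r addr0 subr0 mulr1 (addrC z) subrK.
apply: le_trans (mulmx_row_le _ _) _; rewrite ler_wpM2r// ler_wpM2l//.
(* Convexity of the ball: the difference from [x] is a convex combination of the differences for the
   two endpoints. *)
apply: He; have -> : x - c t = (1 - t) *: (x - z) + t *: (x - y).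
  by apply/matrixP => i j; rewrite !mxE; ring.
move: t01; rewrite in_itv/= => /andP[t0 t1].
apply: le_lt_trans (ler_normD _ _) _; rewrite !normrZ !ger0_norm ?subr_ge0//.
have [t0'|t0'] := eqVneq t 0; first by rewrite t0' subr0 mul1r mul0r addr0.
have : t * `|x - y| < t * e by rewrite ltr_pM2l// lt0r t0' t0.
have : (1 - t) * `|x - z| <= (1 - t) * e by rewrite ler_wpM2l ?subr_ge0// ltW.
by lra.
Qed.

Lemma cV_ball_compact (r : R) : compact [set x : 'cV[R]_n | `|x| <= r].
Proof.
have c : compact [set x : 'rV[R]_n | `|x| <= r].
  apply: bounded_closed_compact.
    exists r; split; first exact: num_real.
    by move=> M rM x /= /le_trans; apply; exact: ltW.
  have -> : [set x : 'rV[R]_n | `|x| <= r] =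
    (fun x : 'rV[R]_n => `|x|) @^-1` [set t : R | t <= r] by [].
  by apply: closed_comp => [x _|]; [exact: norm_continuous|exact: closed_le].
have -> : [set x : 'cV[R]_n | `|x| <= r] = trmx @` [set x : 'rV[R]_n | `|x| <= r].
  have nT (p q : nat) (M : 'M[R]_(p, q)) : `|M^T| <= `|M|.
    by apply: mx_norm_le => // i j; rewrite mxE; exact: mx_norm_coord.
  apply/seteqP; split => x /=.
    by move=> xr; exists x^T; [exact: le_trans (nT _ _ _) _|exact: trmxK].
  by move=> [y yr <-]; exact: le_trans (nT _ _ _) _.
apply: continuous_compact c; apply: continuous_subspaceT => x.
apply: (@cvg_mx R _ _ _ (nbhs x) _ trmx) => i j; under eq_fun do rewrite mxE; rewrite mxE.
exact: coord_continuous.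
Qed.

End LipschitzClasses.

(** * Lipschitz bounds on compact sets *)

Section LipschitzCompact.
Context {R : realType} {V W : normedModType R}.

(** [K] need not be convex, so the cover is taken on [K * K]. Near the diagonal the local constant
    works; off it, the increment of [f] is bounded and the distance is bounded below. *)
Lemma lip_at_compact (f : V -> W) (K : set V) : compact K ->
  (forall x, lip_at f x) ->
  exists2 M : R, 0 <= M & forall y z, K y -> K z -> `|f y - f z| <= M * `|y - z|.
Proof.
move=> cK fx.
have cKK : compact (K `*` K) by exact: compact_setX.
pose P (M : R) (p : V * V) := `|f p.1 - f p.2| <= M * `|p.1 - p.2|.
suff : \forall M \near +oo, (K `*` K) `<=` P M.
  move=> H; near (+oo : set_system R) => M; exists M; first by near: M; apply: nbhs_pinfty_ge; exact: num_real.
  move=> y z Ky Kz; have HM : (K `*` K) `<=` P M by near: M.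
  exact: (HM (y, z)).
apply: (compact_near_coveringP _).1 => // -[y z] [/= Ky Kz].
have [<-|yz] := eqVneq y z.
  have [M M0 HM] := fx y.
  have HM' : \forall N \near (+oo : set_system R), M <= N by apply: nbhs_pinfty_ge; exact: num_real.
  exists ([set p | `|f p.1 - f p.2| <= M * `|p.1 - p.2|], [set N | M <= N]) => /=; first by split.
  move=> [p N] [/= Hp MN]; apply: le_trans Hp _.
  by rewrite ler_wpM2r.
have yz0 : 0 < `|y - z| by rewrite normr_gt0 subr_eq0.
pose B := `|f y - f z| + 1.
have c1 : `|f p.1 - f p.2| @[p --> (y, z)] --> `|f y - f z|.
  apply: cvg_norm; apply: cvgB.
    by apply: (cvg_comp _ _ cvg_fst); exact: lip_at_continuous.
  by apply: (cvg_comp _ _ cvg_snd); exact: lip_at_continuous.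
have c2 : `|p.1 - p.2| @[p --> (y, z)] --> `|y - z|.
  by apply: cvg_norm; apply: cvgB; [exact: cvg_fst|exact: cvg_snd].
have n1 : \forall p \near (y, z), `|f p.1 - f p.2| <= B.
  by apply: (cvgr_le _ c1); rewrite ltrDl.
have n2 : \forall p \near (y, z), `|y - z| / 2 <= `|p.1 - p.2|.
  by apply: (cvgr_ge _ c2); lra.
have n3 : \forall N \near (+oo : set_system R), B / (`|y - z| / 2) <= N.
  by apply: nbhs_pinfty_ge; exact: num_real.
have n12 := filterI n1 n2.
exists ([set p | `|f p.1 - f p.2| <= B /\ `|y - z| / 2 <= `|p.1 - p.2|],
  [set N | B / (`|y - z| / 2) <= N]) => /=.
  by split; [exact: (n12 _)|exact: n3].
move=> [p N] [/= [p1 p2] BN]; apply: le_trans p1 _.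
have h0 : 0 < `|y - z| / 2 by rewrite divr_gt0.
apply: (@le_trans _ _ (B / (`|y - z| / 2) * `|p.1 - p.2|)).
  by rewrite mulrAC ler_pdivlMr// ler_wpM2l// addr_ge0.
by rewrite ler_wpM2r.
Unshelve. all: by end_near. Qed.

Lemma continuous_compact_bounded (f : V -> W) (K : set V) : compact K ->
  continuous f -> exists2 M : R, 0 < M & forall y, K y -> `|f y| <= M.
Proof.
move=> cK cf.
have cfK : compact (f @` K).
  by apply: continuous_compact => //; exact: continuous_subspaceT.
have [M [_ HM]] := compact_bounded cfK.
exists (`|M| + 1); first by rewrite ltr_wpDl.
by move=> y Ky; apply: HM; [rewrite (le_lt_trans (ler_norm _))// ltrDl|exists y].
Qed.

End LipschitzCompact.

Section Cutoff.
Context {R : realType} {n : nat}.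
Variable rho : R.

Definition cutoff (x : 'cV[R]_n) : R := Num.max 0 (Num.min 1 (rho + 1 - `|x|)).

Lemma cutoff_ge0 x : 0 <= cutoff x.
Proof. by rewrite le_max lexx. Qed.

Lemma cutoff_le1 x : cutoff x <= 1.
Proof. by rewrite ge_max ler01 ge_min lexx. Qed.

Lemma cutoff1 x : `|x| <= rho -> cutoff x = 1.
Proof.
move=> xr; rewrite /cutoff; have /min_idPl -> : 1 <= rho + 1 - `|x| by lra.
by apply/max_idPr.
Qed.

Lemma cutoff0 x : rho + 1 < `|x| -> cutoff x = 0.
Proof. by move=> xr; apply/max_idPl; rewrite ge_min; apply/orP; right; lra. Qed.

Lemma cutoff_lip x y : `|cutoff x - cutoff y| <= `|x - y|.
Proof.
apply: le_trans (max0_lip _ _) _.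
have h1 := lerB_dist x y; have := lerB_dist y x; rewrite distrC => h2.
have := normr_ge0 (x - y) => h3.
by rewrite ler_norml; case: (leP 1 (rho + 1 - `|x|)); case: (leP 1 (rho + 1 - `|y|)); lra.
Qed.

(** On the ball of radius [rho + 1] this is the product rule. If one point lies outside, its cutoff
    is 0, so the cutoff of the other point is a difference of cutoffs and is at most the
    distance. *)
Lemma cutoff_globally_lipschitz (f : 'cV[R]_n -> 'cV[R]_n) :
  (forall x, lip_at f x) ->
  exists2 L : R, 0 < L &
    forall x y, `|cutoff x *: f x - cutoff y *: f y| <= L * `|x - y|.
Proof.
move=> fx; have cK := @cV_ball_compact R n (rho + 1).
have [M M0 HM] := lip_at_compact cK fx.
have [|N N0 HN] := continuous_compact_bounded cK (f := f).
  by move=> x; exact: lip_at_continuous.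
exists (M + N); first by rewrite ltr_wpDl.
have out x y : `|x| <= rho + 1 -> rho + 1 < `|y| ->
    `|cutoff x *: f x - cutoff y *: f y| <= (M + N) * `|x - y|.
  move=> xr yr; rewrite (cutoff0 yr) scale0r subr0 normrZ -[cutoff x]subr0 -(cutoff0 yr).
  rewrite mulrC mulrDl; apply: (@le_trans _ _ (N * `|x - y|)).
    by apply: ler_pM => //; [exact: HN|exact: cutoff_lip].
  by rewrite lerDr mulr_ge0.
move=> x y; have [xr|xr] := leP `|x| (rho + 1); have [yr|yr] := leP `|y| (rho + 1).
- have -> : cutoff x *: f x - cutoff y *: f y =
      cutoff y *: (f x - f y) + (cutoff x - cutoff y) *: f x.
    by rewrite scalerBr scalerBl [RHS]addrC subrKA.
  apply: le_trans (ler_normD _ _) _; rewrite mulrDl; apply: lerD.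
    rewrite normrZ ger0_norm ?cutoff_ge0//; apply: le_trans (HM _ _ xr yr).
    by rewrite ler_piMl// cutoff_le1.
  rewrite normrZ mulrC; apply: ler_pM => //; [exact: HN|exact: cutoff_lip].
- exact: out.
- by rewrite distrC (distrC x); exact: out.
- by rewrite (cutoff0 xr) (cutoff0 yr) !scale0r subrr normr0 !mulr_ge0// addr_ge0// ltW.
Qed.

End Cutoff.

(** * Uniqueness, flows and limit sets *)

Section Uniqueness.
Context {R : realType} {n : nat}.
Variable f : 'cV[R]_n -> 'cV[R]_n.
Implicit Types (x y : R -> 'cV[R]_n) (I J : interval R).

Lemma sub_interval I (a b : R) : a \in I -> b \in I -> `[a, b] `<=` [set` I].
Proof.
move=> aI bI t /=; rewrite in_itv/=.
by move=> tab; apply: (@interval_is_interval _ I a b).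
Qed.

Hypothesis fx : forall p, lip_at f p.

(** On a segment common to both intervals the curves have compact images, on whose union [f] is
    Lipschitz. Grönwall propagates the equality at time 0, in the backward form for negative
    times. *)
Lemma solution_unique I J x y : 0 \in I -> 0 \in J -> x 0 = y 0 ->
  solves f I x -> solves f J y -> forall t, t \in I -> t \in J -> y t = x t.
Proof.
move=> I0 J0 xy0 sx sy.
have main a b : a <= b -> `[a, b] `<=` [set` I] -> `[a, b] `<=` [set` J] ->
    exists c, sqn (x b - y b) <= sqn (x a - y a) * expR (c * (b - a)) /\
              sqn (x a - y a) <= sqn (x b - y b) * expR (c * (b - a)).
  move=> ab abI abJ.
  have cx := solves_within_continuous sx abI.
  have cy := solves_within_continuous sy abJ.
  have ooI : `]a, b[ `<=` [set` I] by apply: subset_trans abI; exact: subset_itv_oo_cc.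
  have ooJ : `]a, b[ `<=` [set` J] by apply: subset_trans abJ; exact: subset_itv_oo_cc.
  have cK : compact (x @` `[a, b] `|` y @` `[a, b]).
    by apply: compactU; apply: continuous_compact => //; exact: segment_compact.
  have [M M0 HM] := lip_at_compact cK fx.
  exists (2 * n%:R * M); apply: (sqnB_gronwall ab (solves_is_derive_oo sx ooI)
    (solves_is_derive_oo sy ooJ)) => // t tab.
  have tcc : `[a, b]%classic t.
    by move/andP: tab => [ta tb]; rewrite /= in_itv/= !ltW.
  by apply: HM; [left; exists t|right; exists t].
have e0 : sqn (x 0 - y 0) = 0.
  by rewrite xy0 subrr /sqn big1// => i _; rewrite mxE expr0n.
move=> t It Jt; apply/esym/eqP; rewrite -subr_eq0; apply/eqP/sqn0_eq0.
have [t0|t0] := leP 0 t.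
  have [c [+ _]] := main _ _ t0 (sub_interval I0 It) (sub_interval J0 Jt).
  by rewrite e0 mul0r.
have [c [_]] := main _ _ (ltW t0) (sub_interval It I0) (sub_interval Jt J0).
by rewrite e0 mul0r.
Qed.

Lemma unique_solutionP I p x : 0 \in I -> x 0 = p -> solves f I x ->
  unique_solution f I p x.
Proof.
move=> I0 x0 sx; split => // J y J0 y0 sy t It Jt.
by apply: (solution_unique I0 J0) => //; rewrite x0 y0.
Qed.

End Uniqueness.

Section GlobalFlow.
Context {R : realType} {n : nat}.
Variables (f : 'cV[R]_n -> 'cV[R]_n) (L : R).
Hypothesis L0 : 0 < L.
Hypothesis fL : forall x y, `|f x - f y| <= L * `|x - y|.
Implicit Types (x y : R -> 'cV[R]_n).

Lemma is_derive_shift (V : normedModType R) (y : R -> V) (s t : R) v :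
  is_derive (s + t) 1 y v -> is_derive t 1 (fun r => y (s + r)) v.
Proof.
move=> [/derivable1_diffP dy <-].
have dg : is_derive t 1 (fun r : R => s + r) 1.
  by rewrite -[X in is_derive _ _ _ X]add0r; apply: is_deriveD.
have dg' : differentiable (fun r : R => s + r) t by apply/derivable1_diffP; case: dg.
have dc : differentiable (y \o (fun r => s + r)) t by exact: differentiable_comp.
split; first exact/derivable1_diffP.
rewrite deriveE// diff_comp//= deriveE//.
by have -> : 'd (fun r : R => s + r) t 1 = (1 : R) by rewrite -deriveE// derive_val.
Qed.

(** Continuous dependence on initial values: [K] depends on [t] but not on the curves. The added 1
    makes it positive. *)
Lemma flow_dist (t : R) : exists2 K : R, 0 < K & forall x y,
  (forall s : R, is_derive s 1 x (f (x s))) ->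
  (forall s : R, is_derive s 1 y (f (y s))) ->
  `|x t - y t| <= K * `|x 0 - y 0|.
Proof.
pose e := expR (2 * n%:R * L * `|t|).
exists (Num.sqrt (n%:R * e) + 1); first by rewrite ltr_wpDl ?sqrtr_ge0.
move=> x y dx dy.
have H : sqn (x t - y t) <= sqn (x 0 - y 0) * e.
  have cx (A : set R) : {within A, continuous x}.
    by apply: within_continuousT; exact: is_derive_continuous dx.
  have cy (A : set R) : {within A, continuous y}.
    by apply: within_continuousT; exact: is_derive_continuous dy.
  have [t0|t0] := leP 0 t.
    have [+ _] := sqnB_gronwall t0 (fun s _ => dx s) (fun s _ => dy s)
      (fun s _ => fL _ _) (cx _) (cy _).
    by rewrite subr0 /e ger0_norm.
  have [_] := sqnB_gronwall (ltW t0) (fun s _ => dx s) (fun s _ => dy s)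
      (fun s _ => fL _ _) (cx _) (cy _).
  by rewrite sub0r /e ltr0_norm.
have K0 : 0 <= n%:R * e by rewrite mulr_ge0// expR_ge0.
apply: (@le_trans _ _ (Num.sqrt (n%:R * e) * `|x 0 - y 0|)); last first.
  by rewrite ler_wpM2r// lerDl.
rewrite -(@ler_pXn2r _ 2%N) ?nnegrE// ?mulr_ge0 ?sqrtr_ge0//.
apply: le_trans (norm_sqn _) _; apply: le_trans H _.
rewrite exprMn sqr_sqrtr// mulrAC ler_wpM2r ?expR_ge0//; exact: sqn_norm.
Qed.

End GlobalFlow.

(** * Positive limit sets of curves confined to a compact set *)

Section OmegaLimit.
Context {R : realType} {n : nat}.
Variable x : R -> 'cV[R]_n.
Local Notation om := (omega_limit x).

Lemma omega_limitP p :
  om p <-> forall U, nbhs p U -> forall T : R, exists2 t, T <= t & U (x t).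
Proof.
split.
  move=> [t [too xt]] U Up T.
  have h1 : \forall i \near \oo, U (x (t i)) by exact: xt.
  have h2 : \forall i \near \oo, T <= t i by move/cvgryPge: too; exact.
  by have [i [Ui Ti]] := filter_ex (filterI h1 h2); exists (t i).
move=> H.
have H' (i : nat) : exists t : R, i%:R <= t /\ `|p - x t| < i.+1%:R^-1.
  have i0 : 0 < i.+1%:R^-1 :> R by rewrite invr_gt0.
  by have [t it xt] := H _ (near_norm_lt p i0) i%:R; exists t.
have [t Ht] := choice H'; exists t; split.
  apply/cvgryPge => A; near=> i; apply: le_trans (Ht i).1.
  by near: i; exact: nbhs_infty_ger.
apply/cvgrPdist_lt => e e0; near=> i; apply: lt_trans (Ht i).2 _.
by near: i; exact: near_infty_natSinv_lt (PosNum e0).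
Unshelve. all: by end_near. Qed.

Lemma omega_limit_closed : closed om.
Proof.
move=> p clp; apply/omega_limitP => U Up T.
have [q [/omega_limitP omq Uq]] := clp _ (nbhs_interior Up).
exact: omq Uq T.
Qed.

Variable K : set 'cV[R]_n.
Hypotheses (cK : compact K) (xK : forall t, 0 <= t -> K (x t)).

Lemma omega_limit_sub : om `<=` K.
Proof.
have clK : closed K by apply: compact_closed => //; exact: norm_hausdorff.
move=> p /omega_limitP omp; apply: clK => U Up.
by have [t t0 Ut] := omp _ Up 0; exists (x t); split => //; exact: xK.
Qed.

(** A point of [K] outside the limit set has a neighbourhood that the curve leaves for good after
    some time. Compactness of [K] makes this time uniform. *)
Lemma omega_limit_near (O : set 'cV[R]_n) :
  (forall p, om p -> nbhs p O) -> \forall t \near +oo, O (x t).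
Proof.
move=> omO.
suff H : \forall t \near (+oo : set_system R), K `<=` (fun y => x t = y -> O y).
  have t0 : \forall t \near (+oo : set_system R), 0 <= t.
    by apply: nbhs_pinfty_ge; exact: num_real.
  by apply: filterS2 H t0 => t Ht t0; apply: Ht (xK t0) erefl.
apply: (compact_near_coveringP _).1 => // p Kp.
have [omp|nomp] := pselect (om p).
  exists (O, setT) => /=; first by split; [exact: omO|exact: filterT].
  by move=> [y t] /= [].
have [U [Up [T HT]]] : exists U, nbhs p U /\ exists T : R, forall t, T <= t -> ~ U (x t).
  apply: contrapT => nH; apply: nomp; apply/omega_limitP => U Up T.
  apply: contrapT => nT; apply: nH; exists U; split => //; exists T => t Tt Ut.
  by apply: nT; exists t.
exists (U, [set t | T <= t]) => /=.
  by split => //; apply: nbhs_pinfty_ge; exact: num_real.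
by move=> [y t] /= [Uy Tt] xty; case: (HT t Tt); rewrite xty.
Qed.

Lemma omega_limit_compact : compact om.
Proof. exact: subclosed_compact omega_limit_closed cK omega_limit_sub. Qed.

(** Were the limit set empty, the empty set would be a neighbourhood of all its points, and the
    curve would end up in it. *)
Lemma omega_limit_nonempty : om !=set0.
Proof.
apply: contrapT => om0.
have : \forall t \near +oo, (set0 : set 'cV[R]_n) (x t).
  by apply: omega_limit_near => p omp; case: om0; exists p.
by move=> /filter_ex [].
Qed.

Hypothesis cx : {within `[0, +oo[, continuous x}.

(** A proper clopen part [B] and its complement [B'] are compact, at some distance [e > 0]. Their
    [e / 2]-neighbourhoods are disjoint and contain a tail of the curve, which is connected yet
    visits both. *)
Lemma omega_limit_connected : connected om.
Proof.
move=> B [b0 Bb0] [C1 oC1 BC1] [C2 cC2 BC2].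
apply: contrapT => BO.
have Bom : B `<=` om by rewrite BC1 => y [].
have [b1 omb1 nBb1] : exists2 b1, om b1 & ~ B b1.
  apply: contrapT => H; apply: BO; apply/seteqP; split => // y omy.
  by apply: contrapT => nBy; apply: H; exists y.
pose B' := om `&` ~` C1.
have B'E y : om y -> ~ B y -> B' y.
  by move=> omy nBy; split => // C1y; apply: nBy; rewrite BC1.
have cB : compact B by rewrite BC2; apply: compact_closedI => //; exact: omega_limit_compact.
have cB' : compact B'.
  by apply: compact_closedI; [exact: omega_limit_compact|exact: open_closedC].
have [e e0 He] : exists2 e : R, 0 < e & forall y z, B y -> B' z -> e <= `|y - z|.
  have H : \forall e \near (0 : R)^'+, (B `*` B') `<=` (fun p => e <= `|p.1 - p.2|).
    apply: (compact_near_coveringP _).1; first exact: compact_setX.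
    move=> [y z] [/= By [omz nC1z]].
    have yz : 0 < `|y - z|.
      rewrite normr_gt0 subr_eq0; apply/eqP => yz; apply: nC1z.
      by rewrite -yz; move: By; rewrite BC1 => -[].
    have c : `|p.1 - p.2| @[p --> (y, z)] --> `|y - z|.
      by apply: cvg_norm; apply: cvgB; [exact: cvg_fst|exact: cvg_snd].
    have n1 : \forall p \near (y, z), `|y - z| / 2 <= `|p.1 - p.2|.
      by apply: (cvgr_ge _ c); lra.
    exists ([set p | `|y - z| / 2 <= `|p.1 - p.2|], [set e | e <= `|y - z| / 2]) => /=.
      by split=> //; apply: nbhs_right_le; rewrite divr_gt0.
    by move=> [p e] /= [p1 e1]; exact: le_trans e1 p1.
  have H0 : \forall e \near (0 : R)^'+, 0 < e by exact: nbhs_right_gt.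
  have [e [He e0]] := filter_ex (filterI H H0).
  by exists e => // y z By B'z; exact: (He (y, z)).
pose U (D : set 'cV[R]_n) := [set y | exists2 b, D b & `|b - y| < e / 2].
have nU (D : set 'cV[R]_n) b : D b -> nbhs b (U D).
  move=> Db; have : \forall y \near b, `|b - y| < e / 2 by apply: near_norm_lt; rewrite divr_gt0.
  by apply: filterS => y by_; exists b.
have oU D : open (U D).
  rewrite openE => y [b Db dby]; pose r := e / 2 - `|b - y|.
  have r0 : 0 < r by rewrite subr_gt0.
  have := near_norm_lt y r0; apply: filterS => z yz; exists b => //.
  by have := ler_distD y b z; rewrite /r in yz; lra.
have disj y : U B y -> U B' y -> False.
  move=> [b Bb by_] [b' Bb' b'y]; have := He _ _ Bb Bb'; have := ler_distD y b b'.
  by rewrite (distrC y b'); lra.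
have ev : \forall t \near +oo, (U B `|` U B') (x t).
  apply: omega_limit_near => p omp.
  have [Bp|nBp] := pselect (B p).
    by apply: filterS (nU _ _ Bp) => y; left.
  by apply: filterS (nU _ _ (B'E _ omp nBp)) => y; right.
have t0 : \forall t \near (+oo : set_system R), 0 <= t.
  by apply: nbhs_pinfty_ge; exact: num_real.
have [T [_ HT]] := filterI ev t0.
(* The neighbourhood of infinity is given by a strict inequality, hence [T + 1]; the maximum with 0
   keeps the tail where [x] is known to be continuous. *)
pose T' := Num.max 0 (T + 1).
have HT' t : T' <= t -> (U B `|` U B') (x t).
  by rewrite ge_max => /andP[_ Tt]; apply: (HT t _).1; lra.
have conn : connected (x @` `[T', +oo[).
  apply: connected_continuous_connected.
    by apply/connected_intervalP; exact: interval_is_interval.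
  apply: continuous_subspaceW cx => t /=; rewrite !in_itv/= !andbT.
  by rewrite ge_max => /andP[].
have sep : separated (U B) (U B').
  split; apply/seteqP; split => // y [].
    by move=> clU UB'y; have [z [Uz U'z]] := clU _ (open_nbhs_nbhs (conj (oU B') UB'y)); exact: disj Uz U'z.
  by move=> UBy clU; have [z [Uz U'z]] := clU _ (open_nbhs_nbhs (conj (oU B) UBy)); exact: disj U'z Uz.
have sub : x @` `[T', +oo[ `<=` U B `|` U B'.
  by move=> _ [t /= + <-]; rewrite in_itv/= andbT; exact: HT'.
have hit (D : set 'cV[R]_n) b : om b -> D b -> exists2 t, T' <= t & U D (x t).
  by move=> /omega_limitP omb Db; exact: omb (nU D b Db) T'.
have [t1 Tt1 U1] := hit B b0 (Bom _ Bb0) Bb0.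
have [t2 Tt2 U2] := hit B' b1 omb1 (B'E _ omb1 nBb1).
have mem t : T' <= t -> (x @` `[T', +oo[) (x t).
  by move=> Tt; exists t => //=; rewrite in_itv/= andbT.
have [S|S] := connected_subset sep sub conn.
  exact: disj (S _ (mem _ Tt2)) U2.
exact: disj U1 (S _ (mem _ Tt1)).
Qed.

End OmegaLimit.

Section OmegaFlow.
Context {R : realType} {n : nat}.
Variables (f : 'cV[R]_n -> 'cV[R]_n) (L : R).
Hypothesis fL : forall x y, `|f x - f y| <= L * `|x - y|.

(** When [x s] is close to [y 0], [x (s + t)] is close to [y t] by continuous dependence. Taking
    [s >= T + |t|] keeps [s + t >= T] for negative [t] as well. *)
Lemma omega_limit_flow (x y : R -> 'cV[R]_n) :
  (forall s : R, is_derive s 1 x (f (x s))) ->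
  (forall s : R, is_derive s 1 y (f (y s))) ->
  omega_limit x (y 0) -> forall t, omega_limit x (y t).
Proof.
move=> dx dy /omega_limitP omp t; apply/omega_limitP => U Uy T.
have [K K0 HK] := flow_dist fL t.
have /nbhs_ballP [e /= e0 He] := Uy.
have near0 : \forall q \near y 0, `|y 0 - q| < e / K by apply: near_norm_lt; rewrite divr_gt0.
have [s Ts xs] := omp _ near0 (T + `|t|).
exists (s + t); first by have := ler_norm (- t); rewrite normrN; lra.
apply: He; rewrite -ball_normE/= distrC.
have dxs (r : R) : is_derive r 1 (fun r => x (s + r)) (f (x (s + r))).
  exact: (is_derive_shift (dx (s + r))).
have := HK _ _ dxs dy; rewrite addr0 => /le_lt_trans; apply.
by rewrite mulrC -ltr_pdivlMr// distrC.
Qed.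

End OmegaFlow.

(** * The penalty function *)

Section PositivePartSquare.
Context {R : realType}.

(** The remainder of the linear approximation is at most [(s - t) ^+ 2] for all combinations of
    signs, hence also across the kink. *)
Lemma is_derive_max0_sq (t : R) :
  is_derive t 1 (fun s => Num.max 0 s ^+ 2) (2 * Num.max 0 t).
Proof.
have rem (s : R) :
    `|Num.max 0 s ^+ 2 - Num.max 0 t ^+ 2 - 2 * Num.max 0 t * (s - t)| <= (s - t) ^+ 2.
  have h1 := sqr_ge0 (s - t); have h2 := sqr_ge0 s; have h3 := sqr_ge0 t.
  rewrite ler_norml; case: (leP 0 s) => s0; case: (leP 0 t) => t0.
  - by apply/andP; split; lra.
  - by have := mulr_ge0_le0 s0 (ltW t0); rewrite !expr2 in h1 h2 h3 *; move=> h4; apply/andP; split; lra.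
  - by have := mulr_ge0_le0 t0 (ltW s0); rewrite !expr2 in h1 h2 h3 *; move=> h4; apply/andP; split; lra.
  - by apply/andP; split; lra.
apply/is_derive_quotientP/cvgrPdist_le => e e0.
have H : \forall s \near t, `|t - s| <= e by exact: near_norm_le.
suff : \forall s \near t, s != t ->
    `|2 * Num.max 0 t - (s - t)^-1 *: (Num.max 0 s ^+ 2 - Num.max 0 t ^+ 2)| <= e by [].
apply: filterS H => s ts st; have st0 : s - t != 0 by rewrite subr_eq0.
apply: le_trans ts; rewrite -(ler_pM2l (_ : 0 < `|s - t|)) ?normr_gt0//.
rewrite -normrM mulrBr /GRing.scale/= mulVKf// (distrC t) -normrM -expr2 ger0_norm ?sqr_ge0//.
by rewrite distrC mulrC; exact: rem.
Qed.

End PositivePartSquare.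

Section EuclideanNorm.
Context {R : realType}.

Lemma enorm_sqr p q (M : 'M[R]_(p, q)) : enorm M ^+ 2 = \sum_i \sum_j M i j ^+ 2.
Proof. by rewrite sqr_sqrtr// !sumr_ge0// => i _; rewrite sumr_ge0// => j _; exact: sqr_ge0. Qed.

Lemma enorm_sqr_row p (u : 'rV[R]_p) : enorm u ^+ 2 = (u *m u^T) 0 0.
Proof.
rewrite enorm_sqr big_ord1 mxE; apply: eq_bigr => j _.
by rewrite mxE expr2.
Qed.

Lemma enorm_sqr_col p (u : 'cV[R]_p) : enorm u ^+ 2 = sqn u.
Proof. by rewrite enorm_sqr /sqn; apply: eq_bigr => i _; rewrite big_ord1. Qed.

End EuclideanNorm.

Section Penalty.
Context {R : realType} {n m k : nat}.
Variables (h : 'I_m -> 'cV[R]_n -> R) (g : 'I_k -> 'cV[R]_n -> R).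
Implicit Types (x v : 'cV[R]_n).
Hypotheses (dh : forall i x, differentiable (h i) x) (dg : forall j x, differentiable (g j) x).

Lemma penaltyE x : penalty h g x =
  2^-1 * (\sum_i h i x ^+ 2) + 2^-1 * (\sum_j Num.max 0 (g j x) ^+ 2).
Proof.
rewrite /penalty !enorm_sqr_col /sqn; congr (_ * _ + _ * _).
  by apply: eq_bigr => i _; rewrite mxE.
by apply: eq_bigr => i _; rewrite !mxE.
Qed.

Lemma penalty_ge0 x : 0 <= penalty h g x.
Proof. by rewrite /penalty addr_ge0// mulr_ge0// sqr_ge0. Qed.

Lemma penalty_eq0 x : penalty h g x = 0 <-> feasible h g x.
Proof.
rewrite penaltyE; split; last first.
  move=> [h0 g0]; rewrite !big1 ?mulr0 ?addr0// => i _.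
    by have /max_idPl -> := g0 i; rewrite expr0n.
  by rewrite h0 expr0n.
have s1 : 0 <= \sum_i h i x ^+ 2 by rewrite sumr_ge0// => i _; exact: sqr_ge0.
have s2 : 0 <= \sum_j Num.max 0 (g j x) ^+ 2.
  by rewrite sumr_ge0// => i _; exact: sqr_ge0.
move=> E; have /eqP : \sum_i h i x ^+ 2 = 0 by lra.
have /eqP : \sum_j Num.max 0 (g j x) ^+ 2 = 0 by lra.
rewrite !psumr_eq0; try by move=> i _; exact: sqr_ge0.
move=> /allP G0 /allP H0; split => i.
  by have := H0 i (mem_index_enum i); rewrite /= sqrf_eq0 => /eqP.
have := G0 i (mem_index_enum i); rewrite /= sqrf_eq0 => /eqP <-.
by rewrite le_max lexx orbT.
Qed.

Lemma differentiable_sumr (I : finType) (F : I -> 'cV[R]_n -> R) x :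
  (forall i, differentiable (F i) x) -> differentiable (fun y => \sum_i F i y) x.
Proof.
move=> dF; have -> : (fun y => \sum_i F i y) = \sum_i F i.
  by apply/funext => y; rewrite fct_sumE.
by elim/big_rec : _ => [|i u _ du]; [exact: differentiable_cst|exact: differentiableD].
Qed.

Let dsq (u : 'cV[R]_n -> R) x : differentiable u x -> differentiable (fun y => u y ^+ 2) x.
Proof. by move=> du; exact: (differentiableX 1 du). Qed.

Let dmax (u : 'cV[R]_n -> R) x : differentiable u x ->
  differentiable (fun y => Num.max 0 (u y) ^+ 2) x.
Proof.
move=> du; apply: (differentiable_comp du (g := fun s : R => Num.max 0 s ^+ 2)).
by apply/derivable1_diffP; case: (is_derive_max0_sq (u x)).
Qed.

Let diff_max (u : 'cV[R]_n -> R) x v : differentiable u x ->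
  'd (fun y => Num.max 0 (u y) ^+ 2) x v = 2 * Num.max 0 (u x) * 'd u x v.
Proof.
move=> du; have [ds' dsE] := is_derive_max0_sq (u x).
have ds : differentiable (fun s : R => Num.max 0 s ^+ 2) (u x) by exact/derivable1_diffP.
have -> : 'd (fun y => Num.max 0 (u y) ^+ 2) x v =
    'd (fun s : R => Num.max 0 s ^+ 2) (u x) ('d u x v).
  by have := congr1 (fun F => F v) (diff_comp du ds).
have -> : 'd u x v = 'd u x v *: (1 : R) by rewrite /GRing.scale/= mulr1.
have E1 : 'd (fun s : R => Num.max 0 s ^+ 2) (u x) 1 = 2 * Num.max 0 (u x).
  by rewrite -deriveE//; exact: dsE.
by rewrite linearZ/= E1 /GRing.scale/= mulr1 mulrC.
Qed.

Lemma differentiable_penalty x : differentiable (penalty h g) x.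
Proof.
have -> : penalty h g = (2^-1 *: (fun y => \sum_i h i y ^+ 2)) +
    (2^-1 *: (fun y => \sum_j Num.max 0 (g j y) ^+ 2)).
  by apply/funext => y; rewrite penaltyE.
apply: differentiableD; apply: differentiableZ; apply: differentiable_sumr => i.
  exact: dsq.
exact: dmax.
Qed.

Lemma derive_sumr (I : finType) (F : I -> 'cV[R]_n -> R) x v :
  (forall i, differentiable (F i) x) ->
  'd (fun y => \sum_i F i y) x v = \sum_i 'd (F i) x v.
Proof.
move=> dF; have -> : (fun y => \sum_i F i y) = \sum_i F i.
  by apply/funext => y; rewrite fct_sumE.
suff : differentiable (\sum_i F i) x /\ 'd (\sum_i F i) x v = \sum_i 'd (F i) x v by case.
elim/big_rec2 : _ => [|i a u _ [du E]].
  by split; [exact: differentiable_cst|rewrite diff_cst].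
by split; [exact: differentiableD|rewrite diffD//= E].
Qed.

Lemma grad_penalty x : grad (penalty h g) x =
  (hvec h x)^T *m Amx h x + (pos_part (gvec g x))^T *m Bmx g x.
Proof.
apply/rowP => l; rewrite mxE deriveE; last exact: differentiable_penalty.
set v := delta_mx l 0.
have -> : penalty h g = (2^-1 *: (fun y => \sum_i h i y ^+ 2)) +
    (2^-1 *: (fun y => \sum_j Num.max 0 (g j y) ^+ 2)).
  by apply/funext => y; rewrite penaltyE.
have d1 : differentiable (fun y => \sum_i h i y ^+ 2) x.
  by apply: differentiable_sumr => i; exact: dsq.
have d2 : differentiable (fun y => \sum_j Num.max 0 (g j y) ^+ 2) x.
  by apply: differentiable_sumr => j; exact: dmax.
rewrite diffD; [|exact: differentiableZ..].
rewrite /= !diffZ//= derive_sumr; last by move=> i; exact: dsq.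
rewrite derive_sumr; last by move=> j; exact: dmax.
rewrite [RHS]mxE; congr (_ + _).
  rewrite [RHS]mxE /GRing.scale/= big_distrr/=; apply: eq_bigr => i _.
  have -> : (hvec h x)^T 0 i = h i x by rewrite mxE mxE.
  have -> : Amx h x i l = 'd (h i) x v by rewrite mxE mxE deriveE; [|exact: dh].
  have -> : 'd (fun y => h i y ^+ 2) x v = 2 * h i x * 'd (h i) x v.
    by rewrite (diffX 1 (dh i x))/= expr1.
  by rewrite !mulrA mulVf// mul1r.
rewrite [RHS]mxE /GRing.scale/= big_distrr/=; apply: eq_bigr => j _.
have -> : (pos_part (gvec g x))^T 0 j = Num.max 0 (g j x) by rewrite mxE mxE mxE.
have -> : Bmx g x j l = 'd (g j) x v by rewrite mxE mxE deriveE; [|exact: dg].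
rewrite diff_max; last exact: dg.
by rewrite !mulrA mulVf// mul1r.
Qed.

End Penalty.

(** * Independence of the active gradients in terms of multipliers *)

Section Licq.
Context {R : realType} {n m k : nat}.
Variables (h : 'I_m -> 'cV[R]_n -> R) (g : 'I_k -> 'cV[R]_n -> R).

Lemma free_map_lin_indep (I : eqType) (s : seq I) (G : I -> 'rV[R]_n) (c : I -> R) :
  free (map G s) -> \sum_(e <- s) c e *: G e = 0 -> forall e, e \in s -> c e = 0.
Proof.
elim: s => [//|e s IH] /=; rewrite free_cons big_cons => /andP[es fs] E.
have ce : c e = 0.
  apply/eqP/negP => /negP ce0; move/negP: es; apply.
  have -> : G e = - (c e)^-1 *: (\sum_(e <- s) c e *: G e).
    apply/(scalerI ce0); rewrite scalerA mulrN divff// scaleN1r.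
    by apply/eqP; rewrite -addr_eq0 E.
  apply: memvZ; rewrite big_seq; apply: memv_suml => e' e's.
  by apply: memvZ; apply: memv_span; exact: map_f.
move: E; rewrite ce scale0r add0r => E e'; rewrite inE => /predU1P[->//|].
exact: IH.
Qed.

(** The active gradients are the image of one list of indices in a disjoint sum, so that
    coefficients belong to indices rather than to vectors. Multipliers of inactive constraints are 0
    and drop out of the sum. *)
Lemma free_active_gradients x : free (active_gradients h g x) ->
  forall (lambda : 'cV[R]_m) (mu : 'cV[R]_k),
  (forall j, g j x != 0 -> mu j 0 = 0) ->
  (Amx h x)^T *m lambda + (Bmx g x)^T *m mu = 0 -> lambda = 0 /\ mu = 0.
Proof.
move=> fr lambda mu mu0 E.
pose s : seq ('I_m + 'I_k) :=
  map inl (enum 'I_m) ++ map inr (enum [pred j | g j x == 0]).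
pose G (e : 'I_m + 'I_k) := match e with inl i => grad (h i) x | inr j => grad (g j) x end.
pose c (e : 'I_m + 'I_k) := match e with inl i => lambda i 0 | inr j => mu j 0 end.
have frs : free (map G s).
  suff -> : map G s = active_gradients h g x by [].
  by rewrite map_cat -[in X in X ++ _]map_comp -[in X in _ ++ X]map_comp.
have : \sum_(e <- s) c e *: G e = 0.
  rewrite big_cat !big_map/= !big_enum/=.
  apply: trmx_inj; rewrite trmx0 -[RHS]E linearD/= !linear_sum/=; congr (_ + _).
    apply/colP => l; rewrite summxE mxE; apply: eq_bigr => i _.
    by rewrite !mxE mulrC.
  apply/colP => l; rewrite summxE mxE [RHS](bigID (fun j => g j x == 0))/=.
  rewrite [X in _ = _ + X]big1 ?addr0; last by move=> j /mu0 ->; rewrite mulr0.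
  by apply: eq_big => [j|j _]; rewrite ?inE// !mxE mulrC.
move=> /(free_map_lin_indep frs) H; split; apply/colP => i; rewrite mxE.
  apply: (H (inl i)); rewrite mem_cat; apply/orP; left.
  by apply: map_f; rewrite mem_enum.
have [gi|/mu0//] := eqVneq (g i x) 0.
apply: (H (inr i)); rewrite mem_cat; apply/orP; right.
by apply: map_f; rewrite mem_enum inE gi.
Qed.

End Licq.

(** * The vector field *)

Section NLPPointwise.
Context {R : realType} {n m k : nat}.
Variable theta : 'cV[R]_n -> R.
Variables (h : 'I_m -> 'cV[R]_n -> R) (g : 'I_k -> 'cV[R]_n -> R).
Hypotheses (theta_C2 : C2 theta) (h_C2 : forall i, C2 (h i)) (g_C2 : forall j, C2 (g j)).
Implicit Types (x : 'cV[R]_n).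
Local Notation V := (penalty h g).
Local Notation F := (Ffield theta h g).

Lemma dtheta x : differentiable theta x.
Proof. by case: theta_C2 => -[+ _] _; exact. Qed.

Lemma dh i x : differentiable (h i) x.
Proof. by case: (h_C2 i) => -[+ _] _; exact. Qed.

Lemma dg j x : differentiable (g j) x.
Proof. by case: (g_C2 j) => -[+ _] _; exact. Qed.

Lemma dV x : differentiable V x.
Proof. by apply: differentiable_penalty; [exact: dh|exact: dg]. Qed.

Lemma gradV x : grad V x =
  (hvec h x)^T *m Amx h x + (pos_part (gvec g x))^T *m Bmx g x.
Proof. by apply: grad_penalty; [exact: dh|exact: dg]. Qed.

Lemma lip_grad (phi : 'cV[R]_n -> R) x : C2 phi -> lip_mx (grad phi) x.
Proof.
move=> [_ H] i j; rewrite (ord1 i).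
exact: C1_lip_at (H j).
Qed.

Lemma lip_hvec x : lip_mx (hvec h) x.
Proof.
move=> i j; under eq_fun do rewrite mxE.
by apply: C1_lip_at; case: (h_C2 i).
Qed.

Lemma lip_gvec x : lip_mx (gvec g) x.
Proof.
move=> i j; under eq_fun do rewrite mxE.
by apply: C1_lip_at; case: (g_C2 i).
Qed.

Lemma lip_Amx x : lip_mx (Amx h) x.
Proof.
move=> i j; under eq_fun do rewrite mxE.
exact: (lip_grad x (h_C2 i) 0 j).
Qed.

Lemma lip_Bmx x : lip_mx (Bmx g) x.
Proof.
move=> i j; under eq_fun do rewrite mxE.
exact: (lip_grad x (g_C2 i) 0 j).
Qed.

Lemma lip_gradV x : lip_mx (grad V) x.
Proof.
have -> : grad V = fun x => (hvec h x)^T *m Amx h x + (pos_part (gvec g x))^T *m Bmx g x.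
  by apply/funext => y; exact: gradV.
apply: lip_mxD; apply: lip_mxM; [apply: lip_mxT|exact: lip_Amx|apply: lip_mxT|exact: lip_Bmx].
  exact: lip_hvec.
by apply: lip_pos_part; exact: lip_gvec.
Qed.

Lemma lip_dfun x : lip_at (dfun h) x.
Proof.
by apply: lip_det; apply: lip_mxM; [exact: lip_Amx|apply: lip_mxT; exact: lip_Amx].
Qed.

Lemma lip_Hmx x : lip_mx (Hmx h) x.
Proof.
have lA := @lip_Amx x; have lAT := lip_mxT lA.
apply: lip_mxB; first by apply: lip_mxZ; [exact: lip_dfun|exact: lip_mx_cst].
apply: lip_mxM => //; apply: lip_mxM => //.
by apply: lip_adj; exact: lip_mxM.
Qed.

Lemma lip_Qmx x : lip_mx (Qmx h g) x.
Proof.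
have lB := @lip_Bmx x; have lBT := lip_mxT lB; have ld := @lip_dfun x.
apply: lip_mxB; apply: lip_mxZ => //.
- by apply: lip_mxM => //; apply: lip_mxM => //; exact: lip_Hmx.
- exact: lip_atX.
- by apply: lip_diag; apply: lip_neg_part; exact: lip_gvec.
Qed.

Lemma lip_Rmx x : lip_mx (Rmx h g) x.
Proof.
apply: lip_mxM; last by apply: lip_adj; exact: lip_Qmx.
by apply: lip_mxM; [exact: lip_Hmx|apply: lip_mxT; exact: lip_Bmx].
Qed.

Lemma lip_Ffield x : lip_mx F x.
Proof.
have lB := @lip_Bmx x; have lBT := lip_mxT lB; have ld := @lip_dfun x.
have lR := @lip_Rmx x; have lRT := lip_mxT lR.
have lv := lip_mxT (lip_grad x theta_C2); have lq := lip_det (@lip_Qmx x).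
have ld4 := lip_atX 4 ld; have l1 := @lip_mx_cst R _ n n 1%:M x.
apply: lip_mxB; first apply: lip_mxB; apply: lip_mxZ => //.
- apply: lip_mxM => //; apply: lip_mxM => //; apply: lip_mxM => //.
  by apply: lip_diag; apply: lip_neg_part; exact: lip_gvec.
- by apply: lip_mxM => //; apply: lip_pos_part; exact: lip_mxM.
- apply: lip_mxM => //; apply: lip_mxM; last first.
    by apply: lip_mxB; apply: lip_mxZ => //; exact: lip_mxM.
  apply: lip_mxM; last exact: lip_Hmx.
  by apply: lip_mxB; apply: lip_mxZ => //; exact: lip_mxM.
Qed.

Lemma lip_nlp_field (s psi1 psi2 : 'cV[R]_n -> R) x : lip_at s x -> lip_at psi1 x -> lip_at psi2 x ->
  lip_at (nlp_field theta h g s psi1 psi2) x.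
Proof.
move=> ls l1 l2; apply: lip_mx_at.
have lV := @lip_gradV x; have lVT := lip_mxT lV.
have lv := lip_mxT (lip_grad x theta_C2).
apply: lip_mxB; apply: lip_mxZ => //; [exact: lip_atM|exact: lip_Ffield|].
apply: lip_mxD; first exact: lip_mxZ.
apply: lip_mxM => //; apply: lip_mxB; last exact: lip_mxM.
apply: lip_mxZ; last exact: lip_mx_cst.
under eq_fun do rewrite enorm_sqr.
by do 2!apply: lip_at_sum => ?; exact: lip_atX.
Qed.

Lemma gradV_F_le0 x : (grad V x *m F x) 0 0 <= 0.
Proof.
rewrite gradV mulmxDl -mulmxA [Amx h x *m F x]A_field mulmx0 add0r.
exact: gB_field_le0.
Qed.

Lemma gradtheta_F_le0 x : (grad theta x *m F x) 0 0 <= 0.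
Proof. by rewrite -[grad theta x]trmxK; exact: v_field_le0. Qed.

Lemma row_dotC p (u w : 'rV[R]_p) : (u *m w^T) 0 0 = (w *m u^T) 0 0.
Proof. by rewrite !mxE; apply: eq_bigr => j _; rewrite !mxE mulrC. Qed.

Lemma cauchy_schwarz p (u w : 'rV[R]_p) :
  (u *m w^T) 0 0 ^+ 2 <= enorm u ^+ 2 * enorm w ^+ 2.
Proof.
have [w0|w0] := eqVneq (enorm w ^+ 2) 0.
  have -> : w = 0.
    apply: trmx_inj; rewrite trmx0; apply: sumsq_eq0.
    by rewrite /sumsq trmxK -enorm_sqr_row w0.
  by rewrite trmx0 mulmx0 mxE expr0n/= mulr_ge0// sqr_ge0.
have wp : 0 < enorm w ^+ 2 by rewrite lt0r w0 sqr_ge0.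
set a := (u *m w^T) 0 0; set W := enorm w ^+ 2 in wp *; set U := enorm u ^+ 2.
have E : enorm (W *: u - a *: w) ^+ 2 = W * (W * U - a ^+ 2).
  have aE : a = \sum_j u 0 j * w 0 j by rewrite /a mxE; apply: eq_bigr => j _; rewrite mxE.
  have UE : U = \sum_j u 0 j ^+ 2 by rewrite /U enorm_sqr big_ord1.
  have WE : W = \sum_j w 0 j ^+ 2 by rewrite /W enorm_sqr big_ord1.
  have -> : W * (W * U - a ^+ 2) = W ^+ 2 * U - 2 * W * a * a + a ^+ 2 * W by ring.
  have H (b c : R) : \sum_j (b * u 0 j - c * w 0 j) ^+ 2 =
      b ^+ 2 * (\sum_j u 0 j ^+ 2) - 2 * b * c * (\sum_j u 0 j * w 0 j)
      + c ^+ 2 * (\sum_j w 0 j ^+ 2).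
    by rewrite !big_distrr/= -sumrB -big_split/=; apply: eq_bigr => j _; ring.
  rewrite [X in _ - _ * X + _]aE [X in _ + _ * X]WE [X in _ * X - _ + _]UE -H.
  by rewrite enorm_sqr big_ord1; apply: eq_bigr => j _; rewrite !mxE.
have := sqr_ge0 (enorm (W *: u - a *: w)).
by rewrite E pmulr_rge0// subr_ge0 mulrC.
Qed.

Section Field.
Variables (s psi1 psi2 : 'cV[R]_n -> R).
Hypotheses (psi1_gt0 : forall x, 0 < psi1 x) (psi2_gt0 : forall x, 0 < psi2 x).
Local Notation f := (nlp_field theta h g s psi1 psi2).
Local Notation a := (afun theta h g psi1 psi2).

Lemma mul_nlp_field (u : 'rV[R]_n) x : (u *m f x) 0 0 =
  s x * psi1 x * (u *m F x) 0 0
  - s x * (psi2 x * (u *m (grad V x)^T) 0 0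
           + (enorm (grad V x) ^+ 2 * (u *m (grad theta x)^T) 0 0
              - (u *m (grad V x)^T) 0 0 * (grad V x *m (grad theta x)^T) 0 0)).
Proof.
have E1 (M : 'cV[R]_n) : u *m ((enorm (grad V x) ^+ 2 *: 1%:M - (grad V x)^T *m grad V x) *m M) =
    enorm (grad V x) ^+ 2 *: (u *m M) - u *m (grad V x)^T *m (grad V x *m M).
  by rewrite mulmxBl -scalemxAl mul1mx mulmxBr -scalemxAr !mulmxA.
rewrite /nlp_field mulmxBr -[u *m (_ *: F x)]scalemxAr -[u *m (s x *: _)]scalemxAr.
rewrite [u *m (psi2 x *: _ + _)]mulmxDr -[u *m (psi2 x *: _)]scalemxAr E1.
move: (u *m F x) (u *m (grad V x)^T) (u *m (grad theta x)^T)
  (grad V x *m (grad theta x)^T) => p1 p2 p3 p4.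
by rewrite !mxE big_ord1; ring.
Qed.

(** The projected gradient of [theta] is orthogonal to [grad V], and [F] contributes a nonpositive
    term; the [psi2] term remains. *)
Lemma gradV_field x : 0 <= s x ->
  (grad V x *m f x) 0 0 <= - (s x * psi2 x * enorm (grad V x) ^+ 2).
Proof.
move=> s0; rewrite mul_nlp_field -enorm_sqr_row.
have h1 : s x * psi1 x * (grad V x *m F x) 0 0 <= 0.
  by rewrite mulr_ge0_le0 ?gradV_F_le0// mulr_ge0// ltW.
have -> : s x * psi2 x * enorm (grad V x) ^+ 2 = s x * (psi2 x * enorm (grad V x) ^+ 2
   + (enorm (grad V x) ^+ 2 * (grad V x *m (grad theta x)^T) 0 0
     - enorm (grad V x) ^+ 2 * (grad V x *m (grad theta x)^T) 0 0)) by ring.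
by lra.
Qed.

(** This is where [afun] comes from: up to the weight, it is the derivative of [theta] along the
    field. *)
Lemma gradtheta_field x : (grad theta x *m f x) 0 0 = s x * a x.
Proof.
rewrite mul_nlp_field -enorm_sqr_row /afun (row_dotC (grad theta x)).
move: ((grad theta x *m F x) 0 0) ((grad V x *m _) 0 0) (enorm _) (enorm _) => b D v t.
by rewrite real_normK ?num_real//; ring.
Qed.

(** The two terms of degree four add up to something nonpositive by Cauchy-Schwarz, and the [F] term
    is nonpositive; only the [psi2] term may be positive. In particular [a <= 0] where [grad V]
    vanishes. *)
Lemma afun_le x : a x <= psi2 x * (enorm (grad V x) * enorm (grad theta x)).
Proof.
have h1 : psi1 x * (grad theta x *m F x) 0 0 <= 0.
  by rewrite mulr_ge0_le0 ?gradtheta_F_le0// ltW.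
have p2 := psi2_gt0 x.
have v0 : 0 <= enorm (grad V x) by exact: sqrtr_ge0.
have t0 : 0 <= enorm (grad theta x) by exact: sqrtr_ge0.
have := cauchy_schwarz (grad V x) (grad theta x); rewrite /afun; move: h1 p2 v0 t0.
move: (psi1 x * _) (psi2 x) ((grad V x *m _) 0 0) (enorm (grad V x)) (enorm (grad theta x)).
move=> b c D v t b0 c0 v0 t0 cs; rewrite real_normK ?num_real//.
have h2 : - D <= v * t.
  apply: le_trans (ler_norm _) _; rewrite normrN.
  by rewrite -(@ler_pXn2r _ 2%N) ?nnegrE ?mulr_ge0// real_normK ?num_real// exprMn.
have h3 : c * - D <= c * (v * t) by rewrite ler_pM2l.
by lra.
Qed.

End Field.

Hypothesis A2 : forall x, feasible h g x -> free (active_gradients h g x).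
Hypothesis A3 : forall x, (Amx h x)^T *m hvec h x + (Bmx g x)^T *m pos_part (gvec g x) = 0 ->
  hvec h x = 0 /\ pos_part (gvec g x) = 0.

Lemma gradV_eq0 x : grad V x = 0 <-> feasible h g x.
Proof.
split=> [|fx].
  rewrite gradV => /(congr1 trmx); rewrite linearD/= !trmx_mul !trmxK trmx0.
  move=> /A3 [hx gx]; split => [i|j].
    by have /colP/(_ i) := hx; rewrite !mxE.
  by have /colP/(_ j) := gx; rewrite !mxE => <-; rewrite le_max lexx orbT.
case: fx => hx gx; rewrite gradV.
have -> : hvec h x = 0 by apply/colP => i; rewrite !mxE hx.
have -> : pos_part (gvec g x) = 0 by apply/colP => j; rewrite !mxE; apply/max_idPl.
by rewrite !trmx0 !mul0mx addr0.
Qed.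

Let licq x : feasible h g x ->
  (forall j, gvec g x j 0 <= 0) /\
  forall (lambda : 'cV[R]_m) (mu : 'cV[R]_k),
  (forall j, gvec g x j 0 < 0 -> mu j 0 = 0) ->
  (Amx h x)^T *m lambda + (Bmx g x)^T *m mu = 0 -> lambda = 0 /\ mu = 0.
Proof.
move=> fx; have gx j : gvec g x j 0 <= 0 by rewrite mxE; case: fx.
split=> // lambda mu mu0; apply: free_active_gradients (A2 fx) _ _ _ => j gj.
by apply: mu0; rewrite lt_neqAle gx andbT mxE.
Qed.

Lemma KKT_gradtheta_F x : feasible h g x -> (grad theta x *m F x) 0 0 = 0 ->
  KKT theta h g x.
Proof.
move=> fx; have [gx li] := licq fx; rewrite -[grad theta x]trmxK => /(v_field_eq0 gx li).
by move=> [lambda [mu H]]; split=> //; exists lambda, mu.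
Qed.

Lemma KKT_F x : KKT theta h g x -> F x = 0.
Proof.
move=> [fx [lambda [mu [mu0 E mug]]]]; have [gx li] := licq fx.
exact: field_eq0 gx li lambda mu mu0 E mug.
Qed.

(** For the converse, multiplying [f x = 0] by [grad V] gives [grad V = 0], hence feasibility. The
    field is then a positive multiple of [F], and multiplying by [grad theta] yields the criterion
    for KKT points. *)
Lemma KKT_equilibrium (s psi1 psi2 : 'cV[R]_n -> R) x :
  (forall x, 0 < s x) -> (forall x, 0 < psi1 x) -> (forall x, 0 < psi2 x) ->
  KKT theta h g x <-> equilibrium (nlp_field theta h g s psi1 psi2) x.
Proof.
move=> s0 p1 p2; split => [Kx|fx0].
  have /gradV_eq0 G0 : feasible h g x by case: Kx.
  rewrite /equilibrium /nlp_field KKT_F// G0 trmx0 enorm_sqr_row mul0mx mxE.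
  by rewrite !(mul0mx, scale0r, oppr0, scaler0, addr0).
have G0 : enorm (grad V x) ^+ 2 = 0.
  have := @gradV_field s psi1 psi2 p1 x (ltW (s0 x)).
  rewrite fx0 mulmx0 mxE oppr_ge0 => h0; apply/eqP; rewrite eq_le sqr_ge0 andbT.
  by rewrite -(pmulr_rle0 _ (mulr_gt0 (s0 x) (p2 x))).
have {}G0 : grad V x = 0.
  apply: trmx_inj; rewrite trmx0; apply: sumsq_eq0.
  by rewrite /sumsq trmxK -enorm_sqr_row G0.
apply: KKT_gradtheta_F; first exact/gradV_eq0.
have := mul_nlp_field s psi1 psi2 (grad theta x) x.
rewrite fx0 mulmx0 G0 trmx0 mulmx0 enorm_sqr_row mul0mx !mxE.
rewrite !(mulr0, mul0r, subr0, addr0) => /esym/eqP.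
by rewrite mulf_eq0 gt_eqF ?mulr_gt0//= => /eqP.
Qed.

End NLPPointwise.

(** * An error bound for the penalty function *)

Section ErrorBound.
Context {R : realType} {n m k : nat}.
Variable theta : 'cV[R]_n -> R.
Variables (h : 'I_m -> 'cV[R]_n -> R) (g : 'I_k -> 'cV[R]_n -> R).
Hypotheses (h_C2 : forall i, C2 (h i)) (g_C2 : forall j, C2 (g j)).
Hypothesis A2 : forall x, feasible h g x -> free (active_gradients h g x).
Hypothesis A3 : forall x, (Amx h x)^T *m hvec h x + (Bmx g x)^T *m pos_part (gvec g x) = 0 ->
  hvec h x = 0 /\ pos_part (gvec g x) = 0.
Local Notation V := (penalty h g).

Lemma mulmx_norm_le p q r (M : 'M[R]_(p, q)) (N : 'M[R]_(q, r)) :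
  `|M *m N| <= q%:R * `|M| * `|N|.
Proof.
apply: mx_norm_le => [|i j]; first by rewrite !mulr_ge0.
rewrite mxE; apply: le_trans (ler_norm_sum _ _ _) _.
apply: (@le_trans _ _ (\sum_(l < q) `|M| * `|N|)).
  by apply: ler_sum => l _; rewrite normrM ler_pM// mx_norm_coord.
by rewrite sumr_const card_ord -mulrA mulr_natl.
Qed.

Let N x := col_mx (Amx h x) (Bmx g x).
Let u x := col_mx (hvec h x) (pos_part (gvec g x)).

Let gradVE x : (grad V x)^T = (N x)^T *m u x.
Proof.
rewrite (gradV h_C2 g_C2) linearD/= !trmx_mul !trmxK.
by rewrite /N /u tr_col_mx mul_row_col.
Qed.

Let N_continuous x : N y @[y --> x] --> N x.
Proof.
apply: (@cvg_mx R _ _ _ (nbhs x) _ N) => i j.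
rewrite /N; under eq_fun do rewrite mxE; rewrite mxE.
case: (fintype.split i) => l.
  exact: lip_at_continuous (lip_Amx h_C2 x l j).
exact: lip_at_continuous (lip_Bmx g_C2 x l j).
Qed.

Let V_le x : V x <= (m + k)%:R * `|u x| ^+ 2.
Proof.
have -> : V x = 2^-1 * sqn (u x).
  rewrite penaltyE /sqn /u big_split_ord/= mulrDr; congr (_ * _ + _ * _).
    by apply: eq_bigr => i _; rewrite col_mxEu mxE.
  by apply: eq_bigr => i _; rewrite col_mxEd !mxE.
apply: (@le_trans _ _ (sqn (u x))); last exact: sqn_norm.
by rewrite ler_piMl ?sqn_ge0// invf_le1// ler1n.
Qed.

Let grad_norm_le x : `|(grad V x)^T| ^+ 2 <= enorm (grad V x) ^+ 2.
Proof.
apply: le_trans (norm_sqn _) _; rewrite enorm_sqr big_ord1 /sqn.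
by apply: ler_sum => i _; rewrite mxE.
Qed.

(* Take [P = (N N' + D)^-1 N], where [D] projects onto the inactive rows. *)
Let left_inverse p : feasible h g p ->
  exists P : 'M[R]_(m + k, n), forall v : 'cV[R]_(m + k),
  (forall j, g j p != 0 -> v (rshift m j) 0 = 0) -> P *m ((N p)^T *m v) = v.
Proof.
move=> fp; pose c (j : 'I_k) : R := (g j p != 0)%:R.
pose D : 'M[R]_(m + k) := diag_mx (row_mx 0 (\row_j c j)).
have DE (v : 'cV[R]_(m + k)) i : (D *m v) i 0 = (row_mx 0 (\row_j c j)) 0 i * v i 0.
  by rewrite /D mul_diag_mx mxE.
pose G := N p *m (N p)^T + D.
have Gu : G \in unitmx.
  rewrite unitmxE unitfE; apply: injective_det_neq0 => v Gv.
  have E : sumsq ((N p)^T *m v) + (v^T *m (D *m v)) 0 0 = 0.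
    have -> : sumsq ((N p)^T *m v) + (v^T *m (D *m v)) 0 0 = (v^T *m (G *m v)) 0 0.
      rewrite /G mulmxDl mulmxDr [RHS]mxE; congr (_ + _).
      by rewrite /sumsq trmx_mul trmxK !mulmxA.
    by rewrite Gv mulmx0 mxE.
  have sE : (v^T *m (D *m v)) 0 0 = \sum_j c j * v (rshift m j) 0 ^+ 2.
    rewrite mxE big_split_ord/= big1 ?add0r => [|i _]; last first.
      by rewrite DE row_mxEl !mxE mul0r mulr0.
    by apply: eq_bigr => j _; rewrite DE row_mxEr !mxE mulrCA expr2.
  have s0 : 0 <= \sum_j c j * v (rshift m j) 0 ^+ 2.
    by rewrite sumr_ge0// => j _; rewrite mulr_ge0// ?ler0n// sqr_ge0.
  have q0 := sumsq_ge0 ((N p)^T *m v).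
  have Nv : (N p)^T *m v = 0 by apply: sumsq_eq0; lra.
  have /eqP : \sum_j c j * v (rshift m j) 0 ^+ 2 = 0 by lra.
  rewrite psumr_eq0; last by move=> j _; rewrite mulr_ge0// ?ler0n// sqr_ge0.
  move=> /allP vj.
  have vr j : g j p != 0 -> dsubmx v j 0 = 0.
    move=> gj; have := vj j (mem_index_enum j); rewrite /= /c gj mul1r sqrf_eq0.
    by move=> /eqP; rewrite mxE.
  have [lu mu] : usubmx v = 0 /\ dsubmx v = 0.
    apply: free_active_gradients (A2 fp) _ _ vr _.
    by move: Nv; rewrite -{1}[v]vsubmxK /N tr_col_mx mul_row_col.
  by rewrite -[v]vsubmxK lu mu col_mx0.
exists (invmx G *m N p) => v vr.
have Dv : D *m v = 0.
  apply/colP => i; rewrite DE [RHS]mxE; case: (split_ordP i) => j ->.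
    by rewrite row_mxEl mxE mul0r.
  by rewrite row_mxEr mxE /c; case: eqVneq => [|/vr ->]; rewrite ?mul0r ?mulr0.
rewrite -mulmxA (mulmxA (N p)) -[RHS](mulKmx Gu); congr (_ *m _).
by rewrite /G mulmxDl Dv addr0.
Qed.

(** [P] recovers [u x] from [(N p)' u x], which differs from [grad V] by an error controlled by
    [|N p - N x|] times [|u x|]. Near [p] this error is absorbed, so [|u x|] is bounded by the
    gradient, and [V] is half the sum of squares of [u x]. *)
Let local_bound p : feasible h g p ->
  exists2 c : R, 0 < c & \forall x \near p, V x <= c * enorm (grad V x) ^+ 2.
Proof.
move=> fp; have [P HP] := left_inverse fp.
pose a : R := n%:R * `|P|; have a0 : 0 <= a by rewrite mulr_ge0.
pose b : R := (m + k)%:R; have b0 : 0 <= b by rewrite ler0n.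
pose C : R := (m + k)%:R * (2 * a) ^+ 2 + 1.
have C0 : 0 < C by rewrite ltr_wpDl// mulr_ge0 ?ler0n// sqr_ge0.
exists C => //.
(* Constraints inactive at [p] stay nonpositive nearby, so the corresponding entries of [u x]
   vanish, as [P] requires. *)
have act : \forall x \near p, forall j, g j p != 0 -> g j x <= 0.
  apply: (@filter_forall _ _ _ (nbhs p)) => j; have [gj0|gj0] := eqVneq (g j p) 0; first exact: nearW.
  have gj : g j p < 0 by rewrite lt_neqAle gj0/=; case: fp => _; exact.
  have cg : g j y @[y --> p] --> g j p.
    by apply: lip_at_continuous; apply: C1_lip_at; case: (g_C2 j).
  by apply: filterS (cvgr_le _ cg _ gj) => x.
(* With this radius [a * b * |N p - N x|] is at most one half. *)
have e0 : 0 < (2 * (a * b) + 1)^-1 by rewrite invr_gt0 ltr_wpDl// !mulr_ge0.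
have nearN : \forall x \near p, `|N p - N x| <= (2 * (a * b) + 1)^-1.
  by have /cvgrPdist_le := @N_continuous p; exact.
apply: filterS2 act nearN => x actx Nx.
have uE : P *m ((N p)^T *m u x) = u x.
  apply: HP => j gj; rewrite /u col_mxEd !mxE; apply/max_idPl; exact: actx.
have le1 : `|u x| <= a * `|(grad V x)^T| + a * (b * `|N p - N x| * `|u x|).
  rewrite -{1}uE; have -> : (N p)^T *m u x = (grad V x)^T + (N p - N x)^T *m u x.
    by rewrite gradVE -mulmxDl -linearD/= addrC subrK.
  rewrite mulmxDr; apply: le_trans (ler_normD _ _) _; apply: lerD.
    exact: mulmx_norm_le.
  apply: le_trans (mulmx_norm_le _ _) _; rewrite ler_wpM2l//.
  apply: le_trans (mulmx_norm_le _ _) _; rewrite ler_wpM2r// ler_wpM2l//.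
  by apply: mx_norm_le => // i j; rewrite mxE; exact: mx_norm_coord.
have le2 : a * (b * `|N p - N x| * `|u x|) <= 2^-1 * `|u x|.
  rewrite !mulrA ler_wpM2r//; apply: (@le_trans _ _ (a * b * (2 * (a * b) + 1)^-1)).
    by rewrite ler_wpM2l// mulr_ge0.
  have ab : 0 <= a * b by rewrite mulr_ge0.
  by rewrite ler_pdivrMr ?ltr_wpDl ?mulr_ge0//; lra.
have le3 : `|u x| <= 2 * a * `|(grad V x)^T| by lra.
apply: le_trans (V_le x) _; rewrite /C mulrDl mul1r.
apply: (@le_trans _ _ ((m + k)%:R * (2 * a) ^+ 2 * enorm (grad V x) ^+ 2)); last first.
  by rewrite lerDl sqr_ge0.
rewrite -mulrA ler_wpM2l ?ler0n//.
apply: (@le_trans _ _ ((2 * a) ^+ 2 * `|(grad V x)^T| ^+ 2)).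
  by rewrite -exprMn lerXn2r ?nnegrE ?mulr_ge0.
by rewrite ler_wpM2l ?sqr_ge0.
Qed.

(** At a zero of [grad V], (A3) gives feasibility and the local bound applies. Elsewhere the
    gradient is bounded below and [V] above on a neighbourhood. Compactness yields one [e] for all
    points. *)
Lemma penalty_error_bound (K : set 'cV[R]_n) : compact K ->
  exists2 e : R, 0 < e & forall x, K x -> e * V x <= enorm (grad V x) ^+ 2.
Proof.
move=> cK.
suff H : \forall e \near (0 : R)^'+, K `<=` (fun x => e * V x <= enorm (grad V x) ^+ 2).
  have H0 : \forall e \near (0 : R)^'+, 0 < e by exact: nbhs_right_gt.
  by have [e [He e0]] := filter_ex (filterI H H0); exists e.
apply: (compact_near_coveringP _).1 => // p Kp.
have [G0|G0] := pselect (grad V p = 0).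
  have /gradV_eq0 fp := G0.
  have [c c0 Hc] := local_bound (fp h_C2 g_C2 A3).
  exists ([set x | V x <= c * enorm (grad V x) ^+ 2], [set e | 0 < e /\ e <= c^-1]) => /=.
    split => //; apply: filterI; first exact: nbhs_right_gt.
    by apply: nbhs_right_le; rewrite invr_gt0.
  move=> [x e] /= [Vx [e0 ec]].
  apply: (@le_trans _ _ (e * (c * enorm (grad V x) ^+ 2))); first by rewrite ler_pM2l.
  rewrite mulrA ler_piMl ?sqr_ge0//.
  by rewrite -(mulVf (lt0r_neq0 c0)) ler_pM2r.
have cV : V x @[x --> p] --> V p.
  exact: differentiable_continuous (dV h_C2 g_C2 p).
have Gp : 0 < `|grad V p| by rewrite normr_gt0; apply/eqP.
have n1 : \forall x \near p, `|grad V p| / 2 <= `|grad V x|.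
  have cG := lip_at_continuous (lip_mx_at (lip_gradV h_C2 g_C2 p)).
  have Gp2 : 0 < `|grad V p| / 2 by rewrite divr_gt0.
  have /cvgrPdist_le/(_ _ Gp2) := cG; apply: filterS => x Hx.
  have := le_trans (lerB_dist (grad V p) (grad V x)) Hx.
  by rewrite lerBlDr -lerBlDl {1}[`|grad V p|]splitr addrK.
have n2 : \forall x \near p, V x <= V p + 1 by apply: (cvgr_le _ cV); rewrite ltrDl.
have Vp := penalty_ge0 h g p.
(* A local lower bound of the squared gradient divided by a local upper bound of [V]. *)
pose e1 := (`|grad V p| / 2) ^+ 2 / (V p + 1).
have e10 : 0 < e1 by rewrite divr_gt0 ?exprn_gt0 ?divr_gt0// ltr_wpDl.
exists ([set x | `|grad V p| / 2 <= `|grad V x| /\ V x <= V p + 1],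
  [set e | 0 < e /\ e <= e1]) => /=.
  by split; [exact: filterI|apply: filterI; [exact: nbhs_right_gt|exact: nbhs_right_le]].
move=> [x e] /= [[Gx Vx] [e0 ee]].
apply: (@le_trans _ _ (e1 * (V p + 1))).
  by apply: ler_pM => //; [exact: ltW|exact: penalty_ge0].
rewrite /e1 divfK ?gt_eqF ?ltr_wpDl//.
have sq (r1 r2 : R) : 0 <= r1 -> r1 <= r2 -> r1 ^+ 2 <= r2 ^+ 2.
  by move=> r10 r12; rewrite lerXn2r ?nnegrE// (le_trans r10).
apply: (@le_trans _ _ (`|grad V x| ^+ 2)).
  by apply: sq => //; exact: divr_ge0.
apply: le_trans (grad_norm_le x); apply: sq; first exact: normr_ge0.
by apply: mx_norm_le => [|i j]; [exact: normr_ge0|have := mx_norm_coord (grad V x)^T j i; rewrite mxE].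
Qed.

End ErrorBound.

(** * Trajectories and stability *)

Section RealTimes.
Context {R : realType}.

Lemma first_time (u : R -> R) (a b c : R) : continuous u -> a <= b -> u b <= c ->
  exists t0, [/\ a <= t0 <= b, u t0 <= c & forall t, a <= t < t0 -> c < u t].
Proof.
move=> cu ab ub.
have cl : closed (u @^-1` [set r | r <= c]).
  by apply: closed_comp => [t _|]; [exact: cu|exact: closed_le].
have cZ := compact_closedI (@segment_compact R a b) cl.
have [||t0 t0Z t0min] := @compact_EVT_min _ R id _ _ cZ.
- by exists b; split => //=; rewrite in_itv/= ab lexx.
- exact: within_continuousT (fun t => cvg_id).
have [/= t0ab ut0] : (`[a, b] `&` u @^-1` [set r | r <= c]) t0 by exact: set_mem.
exists t0; split; [by move: t0ab; rewrite in_itv|exact: ut0|].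
move=> t /andP[at_ tt0]; rewrite ltNge; apply/negP => ut.
have := t0min t; rewrite leNgt tt0 => /(_ _)/negP; apply => //.
apply: mem_set; split => //=; rewrite in_itv/= at_ (le_trans (ltW tt0))//.
by move: t0ab; rewrite in_itv/= => /andP[].
Qed.

Lemma last_time (u : R -> R) (a b c : R) : continuous u -> a <= b -> u a <= c ->
  exists t0, [/\ a <= t0 <= b, u t0 <= c & forall t, t0 < t <= b -> c < u t].
Proof.
move=> cu ab ua.
have cl : closed (u @^-1` [set r | r <= c]).
  by apply: closed_comp => [t _|]; [exact: cu|exact: closed_le].
have cZ := compact_closedI (@segment_compact R a b) cl.
have [||t0 t0Z t0max] := @compact_EVT_max _ R id _ _ cZ.
- by exists a; split => //=; rewrite in_itv/= ab lexx.
- exact: within_continuousT (fun t => cvg_id).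
have [/= t0ab ut0] : (`[a, b] `&` u @^-1` [set r | r <= c]) t0 by exact: set_mem.
exists t0; split; [by move: t0ab; rewrite in_itv|exact: ut0|].
move=> t /andP[tt0 tb]; rewrite ltNge; apply/negP => ut.
have := t0max t; rewrite leNgt tt0 => /(_ _)/negP; apply => //.
apply: mem_set; split => //=; rewrite in_itv/= tb andbT (le_trans _ (ltW tt0))//.
by move: t0ab; rewrite in_itv/= => /andP[].
Qed.

(** By the intermediate value theorem, a time with [w >= r] is preceded by one with [w = r]. The
    first zero of [|w - r|] is thus the first contact, and [w <= r] before it. *)
Lemma first_hit (w : R -> R) (a b r : R) : continuous w -> a <= b -> w a <= r -> r <= w b ->
  exists t0, [/\ a <= t0 <= b, w t0 = r & forall t, a <= t <= t0 -> w t <= r].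
Proof.
move=> cw ab wa wb.
have hit t : a <= t -> r <= w t -> exists2 t', a <= t' <= t & w t' = r.
  move=> at_ rt.
  have [|t' + wt'] := @IVT R w a t r at_ (within_continuousT cw).
    by rewrite ge_min wa le_max rt orbT.
  by rewrite in_itv/= => t'at; exists t'.
have [b' /andP[ab' b'b] wb'] := hit b ab wb.
pose u t := `|w t - r|.
have cu : continuous u.
  by move=> t; apply: cvg_norm; apply: cvgB; [exact: cw|exact: cvg_cst].
have [|t0 [/andP[at0 t0b'] ut0 Ht0]] := @first_time u a b' 0 cu ab'.
  by rewrite /u wb' subrr normr0.
exists t0; split.
- by rewrite at0 (le_trans t0b').
- by apply/eqP; rewrite -subr_eq0 -normr_le0.
move=> t /andP[at_ tt0]; rewrite leNgt; apply/negP => rt.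
have [t' /andP[at' t't] wt'] := hit t at_ (ltW rt).
have {}tt0 : t < t0.
  rewrite lt_neqAle tt0 andbT; apply/eqP => tE.
  by move: ut0; rewrite /u -tE normr_le0 subr_eq0 gt_eqF.
have := Ht0 t'; rewrite at' (le_lt_trans t't tt0) => /(_ isT).
by rewrite /u wt' subrr normr0 ltxx.
Qed.

(** After the last time before [t] with [u <= c], [u] stays above [c] and therefore does not
    increase. *)
Lemma barrier (u du : R -> R) (c : R) : (forall t : R, is_derive t 1 u (du t)) ->
  u 0 <= c -> (forall t, 0 < t -> c < u t -> du t <= 0) ->
  forall t, 0 <= t -> u t <= c.
Proof.
move=> dudt u0 H t t0; have cu := is_derive_continuous dudt.
have [t1 [/andP[t10 t1t] ut1 Ht1]] := last_time cu t0 u0.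
apply: le_trans ut1; apply: (is_derive_nincr t1t (fun r _ => dudt r)).
  move=> r /andP[t1r rt]; apply: H; first exact: le_lt_trans t1r.
  by apply: Ht1; rewrite t1r ltW.
exact: within_continuousT.
Qed.

End RealTimes.

Lemma enorm0 {R : realType} p q : enorm (0 : 'M[R]_(p, q)) = 0.
Proof.
rewrite /enorm big1 ?sqrtr0// => i _; rewrite big1// => j _.
by rewrite mxE expr0n.
Qed.

Section OmegaCompare.
Context {R : realType} {n : nat}.

(** Compare a time when the curve is near [p] with a later one when it is near [q]. The function
    [xi] measures the failure of [phi] to be monotone, and is small near [p]. *)
Lemma omega_limit_le (x : R -> 'cV[R]_n) (phi xi : 'cV[R]_n -> R) p q :
  continuous phi -> continuous xi ->
  (forall a b, 0 <= a -> a <= b -> phi (x b) <= phi (x a) + xi (x a)) ->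
  omega_limit x p -> omega_limit x q -> xi p = 0 -> phi q <= phi p.
Proof.
move=> cphi cxi H /omega_limitP omp /omega_limitP omq xip.
rewrite leNgt; apply/negP => pq; pose e := (phi q - phi p) / 3.
have e0 : 0 < e by rewrite divr_gt0// subr_gt0.
have n1 : \forall y \near p, phi y < phi p + e by apply: (cvgr_lt _ (cphi p)); rewrite ltrDl.
have n2 : \forall y \near p, xi y < e by apply: (cvgr_lt _ (cxi p)); rewrite xip.
have n3 : \forall y \near q, phi q - e < phi y by apply: (cvgr_gt _ (cphi q)); lra.
have [a a0 [/= h1 h2]] := omp _ (filterI n1 n2) 0.
have [b ab h3] := omq _ n3 a.
by have := H a b a0 ab; rewrite /e in h1 h2 h3 *; lra.
Qed.

End OmegaCompare.

Section Trajectories.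
Context {R : realType} {n m k : nat}.
Variable theta : 'cV[R]_n -> R.
Variables (h : 'I_m -> 'cV[R]_n -> R) (g : 'I_k -> 'cV[R]_n -> R).
Hypotheses (theta_C2 : C2 theta) (h_C2 : forall i, C2 (h i)) (g_C2 : forall j, C2 (g j)).
Hypothesis A1 : forall z y : 'cV[R]_n, penalty h g y <= penalty h g z ->
  compact [set x : 'cV[R]_n | penalty h g x <= penalty h g z /\ theta x <= theta y].
Hypothesis A2 : forall x, feasible h g x -> free (active_gradients h g x).
Hypothesis A3 : forall x, (Amx h x)^T *m hvec h x + (Bmx g x)^T *m pos_part (gvec g x) = 0 ->
  hvec h x = 0 /\ pos_part (gvec g x) = 0.
Variables psi1 psi2 : 'cV[R]_n -> R.
Hypotheses (psi1_lip : locally_lipschitz psi1) (psi2_lip : locally_lipschitz psi2).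
Hypotheses (psi1_gt0 : forall x, 0 < psi1 x) (psi2_gt0 : forall x, 0 < psi2 x).
Hypothesis A4 : forall z : 'cV[R]_n, exists yz : 'cV[R]_n,
  [/\ penalty h g yz <= penalty h g z, theta z <= theta yz &
      [set x : 'cV[R]_n | 0 < afun theta h g psi1 psi2 x /\
                          penalty h g x <= penalty h g z]
      `<=` [set x : 'cV[R]_n | theta x <= theta yz]].
Variable sigma : 'cV[R]_n -> R.
Hypotheses (sigma_lip : locally_lipschitz sigma) (sigma_gt0 : forall x, 0 < sigma x).

Local Notation V := (penalty h g).
Local Notation field s := (nlp_field theta h g s psi1 psi2).
Local Notation f := (field sigma).
Implicit Types (s : 'cV[R]_n -> R) (x : R -> 'cV[R]_n).

(** The weight is a parameter so that truncations of [sigma] are covered. Times range over the whole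
    line, with two-sided derivatives. *)
Definition integral_curve s x := forall t : R, is_derive t 1 x (field s (x t)).

Let dVx s x : integral_curve s x -> forall t : R,
  is_derive t 1 (V \o x) ((grad V (x t) *m field s (x t)) 0 0).
Proof. by move=> dx t; apply: is_derive_comp_grad (dx t) _; exact: dV. Qed.

Let dthetax s x : integral_curve s x -> forall t : R,
  is_derive t 1 (theta \o x) (s (x t) * afun theta h g psi1 psi2 (x t)).
Proof.
move=> dx t; rewrite -gradtheta_field.
by apply: is_derive_comp_grad (dx t) _; exact: dtheta.
Qed.

Let cV : continuous V.
Proof. by move=> y; apply: differentiable_continuous; exact: dV. Qed.

Let ctheta : continuous theta.
Proof. by move=> y; apply: differentiable_continuous; exact: dtheta. Qed.

Lemma penalty_nincr s x a b : (forall y, 0 <= s y) -> integral_curve s x ->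
  a <= b -> V (x b) <= V (x a).
Proof.
move=> s0 dx ab; have dv := dVx dx.
apply: (is_derive_nincr ab (fun t _ => dv t)); last first.
  by apply: within_continuousT; exact: is_derive_continuous dv.
move=> t _; apply: le_trans (gradV_field theta h_C2 g_C2 psi2 psi1_gt0 (s0 _)) _.
by rewrite oppr_le0 mulr_ge0 ?sqr_ge0// mulr_ge0// ltW.
Qed.

(* [theta + c * sqrt V] decreases along the curve while [V > 0]; once [V = 0],
   [theta] decreases itself. *)
Lemma theta_bound (K : set 'cV[R]_n) : compact K -> exists2 c : R, 0 <= c &
  forall s x a b, (forall y, 0 <= s y) -> integral_curve s x -> a <= b ->
  (forall t, a <= t <= b -> K (x t)) ->
  theta (x b) <= theta (x a) + c * Num.sqrt (V (x a)).
Proof.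
move=> cK; have [e e0 He] := penalty_error_bound h_C2 g_C2 A2 A3 cK.
have cgt : continuous (grad theta) by case: theta_C2 => -[].
have [M M0 HM] := continuous_compact_bounded cK cgt.
pose T := Num.sqrt (n%:R * M ^+ 2).
have HT y : K y -> enorm (grad theta y) <= T.
  move=> Ky; rewrite /enorm ler_wsqrtr// big_ord1.
  apply: (@le_trans _ _ (\sum_(j < n) M ^+ 2)); last first.
    by rewrite sumr_const card_ord mulr_natl.
  apply: ler_sum => j _; rewrite -real_normK ?num_real//.
  rewrite lerXn2r ?nnegrE//; first exact: ltW.
  by apply: le_trans (HM _ Ky); exact: mx_norm_coord.
have T0 : 0 <= T by exact: sqrtr_ge0.
have se0 : 0 < Num.sqrt e by rewrite sqrtr_gt0.
(* With [E = |grad V|], [sqrt V] decays at least at rate [s psi2 E^2 / (2 sqrt V)], where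
   [E >= sqrt e * sqrt V]. This [c] makes the decay of [c * sqrt V] outweigh [s psi2 E T], a bound
   for the growth of [theta]; [s] cancels. *)
pose c := 2 * T / Num.sqrt e.
have c0 : 0 <= c by rewrite divr_ge0 ?mulr_ge0// ltW.
exists c => // s x a b s0 dx ab xK.
have dv := dVx dx; have dt := dthetax dx.
have cVx := is_derive_continuous dv; have cthetax := is_derive_continuous dt.
(* The square root is not differentiable at 0, so the decreasing quantity is used only up to the
   first zero of [V]. *)
have main t0 : a <= t0 <= b -> (forall t, a < t < t0 -> 0 < V (x t)) ->
    theta (x t0) <= theta (x a) + c * Num.sqrt (V (x a)).
  move=> /andP[at0 t0b] Vpos.
  pose W t := theta (x t) + c * Num.sqrt (V (x t)).
  pose dW t := s (x t) * afun theta h g psi1 psi2 (x t)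
    + c * ((2 * Num.sqrt (V (x t)))^-1 * (grad V (x t) *m field s (x t)) 0 0).
  have dWt (t : R) : a < t < t0 -> is_derive t 1 W (dW t).
    move=> tt; have ds := is_derive1_sqrt (Vpos t tt).
    have H := @is_derive1_comp _ Num.sqrt (V \o x) t _ _ ds (dv t).
    exact: (is_deriveD (dt t) (is_deriveZ c H)).
  have : W t0 <= W a.
    apply: (is_derive_nincr at0 dWt); last first.
      apply: within_continuousT => t; apply: cvgD; first exact: cthetax.
      apply: cvgM; first exact: cvg_cst.
      apply: (continuous_comp (cVx t)); exact: sqrt_continuous.
    move=> t tt; have Kt : K (x t).
      by apply: xK; move/andP: tt => [ta tt0]; rewrite ltW//= (le_trans (ltW tt0)).
    have Vt := Vpos t tt; have sV : 0 < Num.sqrt (V (x t)) by rewrite sqrtr_gt0.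
    set E := enorm (grad V (x t)); have E0 : 0 <= E by exact: sqrtr_ge0.
    pose r := s (x t) * psi2 (x t); have r0 : 0 <= r by rewrite mulr_ge0// ltW.
    have h1 : s (x t) * afun theta h g psi1 psi2 (x t) <= r * (E * T).
      rewrite /r -mulrA ler_wpM2l//.
      apply: le_trans (afun_le theta h g psi1_gt0 psi2_gt0 (x t)) _.
      by rewrite ler_pM2l// ler_wpM2l// HT.
    have h2 := gradV_field theta h_C2 g_C2 psi2 psi1_gt0 (s0 (x t)).
    have h3 : Num.sqrt e * Num.sqrt (V (x t)) <= E.
      rewrite -(@ler_pXn2r _ 2%N) ?nnegrE ?mulr_ge0 ?sqrtr_ge0//.
      by rewrite exprMn (sqr_sqrtr (ltW e0)) (sqr_sqrtr (penalty_ge0 h g (x t))); exact: He.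
    have h4 : c * ((2 * Num.sqrt (V (x t)))^-1 * (grad V (x t) *m field s (x t)) 0 0)
        <= - (r * (E * T)).
      apply: (@le_trans _ _ (c * ((2 * Num.sqrt (V (x t)))^-1 * - (r * E ^+ 2)))).
        by rewrite ler_wpM2l// ler_wpM2l// invr_ge0 mulr_ge0// ltW.
      rewrite !mulrN lerN2.
      have -> : c * ((2 * Num.sqrt (V (x t)))^-1 * (r * E ^+ 2)) =
          r * E * T * (E / (Num.sqrt e * Num.sqrt (V (x t)))).
        by rewrite /c; field; rewrite !gt_eqF.
      rewrite mulrA; apply: ler_peMr; first by apply: mulr_ge0 => //; exact: mulr_ge0.
      by rewrite ler_pdivlMr ?mul1r// mulr_gt0.
    by rewrite /dW; lra.
  by apply: le_trans; rewrite lerDl mulr_ge0// sqrtr_ge0.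
have [Vb|Vb] := leP (V (x b)) 0; last first.
  apply: main; rewrite ?ab ?lexx// => t /andP[_ tb].
  by apply: lt_le_trans Vb _; apply: penalty_nincr dx _ => //; exact: ltW.
have [t0 [/andP[at0 t0b] Vt0 Ht0]] := first_time cVx ab Vb.
have le1 : theta (x t0) <= theta (x a) + c * Num.sqrt (V (x a)).
  apply: main; rewrite ?at0// => t /andP[at_ tt0]; apply: Ht0.
  by rewrite ltW.
apply: le_trans le1; apply: (is_derive_nincr t0b (fun t _ => dt t)); last first.
  exact: within_continuousT.
move=> t /andP[t0t tb].
have fx : feasible h g (x t).
  apply/penalty_eq0/eqP; rewrite eq_le penalty_ge0 andbT.
  by apply: le_trans Vt0; apply: penalty_nincr dx _ => //; exact: ltW.
rewrite mulr_ge0_le0//; apply: le_trans (afun_le theta h g psi1_gt0 psi2_gt0 _) _.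
have -> : grad V (x t) = 0 by apply/gradV_eq0.
by rewrite enorm0 mul0r mulr0.
Qed.

Let f_lip y : lip_at f y.
Proof. by apply: lip_nlp_field => //; exact: locally_lipschitz_at. Qed.

Lemma field_scale (c : 'cV[R]_n -> R) y :
  field (fun y => c y * sigma y) y = c y *: f y.
Proof.
by rewrite [LHS]/nlp_field [in RHS]/nlp_field [RHS]scalerBr !scalerA !mulrA.
Qed.

(* Multiplying [sigma] by a cutoff only slows trajectories down: the field
   becomes globally Lipschitz and the sublevel sets of (A1) stay invariant. *)
Lemma confined_curve (x0 : 'cV[R]_n) : exists s K (L : R),
  [/\ compact K, forall y, 0 <= s y, forall y, K y -> field s y = f y /\ 0 < s y,
      0 < L /\ forall y z, `|field s y - field s z| <= L * `|y - z| &
      forall x, integral_curve s x -> x 0 = x0 -> forall t, 0 <= t -> K (x t)].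
Proof.
have [y0 [Vy0 ty0 Hy0]] := A4 x0.
pose K := [set x : 'cV[R]_n | V x <= V x0 /\ theta x <= theta y0].
have cK : compact K by exact: A1.
have [M [_ HM]] := compact_bounded cK.
pose rho := M + 1; have Krho y : K y -> `|y| <= rho.
  by move=> Ky; apply: (HM rho); rewrite // /rho ltrDl.
pose s y := cutoff rho y * sigma y.
have s0 y : 0 <= s y by rewrite mulr_ge0 ?cutoff_ge0// ltW.
have [L L0 HL] := cutoff_globally_lipschitz rho f_lip.
exists s, K, L; split => //.
- move=> y /Krho yr; rewrite /s; split; last by rewrite cutoff1// mul1r.
  by rewrite field_scale cutoff1// scale1r.
- by split=> // y z; rewrite !field_scale; exact: HL.
- move=> x dx x00 t t0; split; first by rewrite -x00; exact: penalty_nincr dx t0.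
  (* [theta] can increase only where [afun] is positive. There (A4) applies, since [V] has not
     increased, and gives [theta <= theta y0]; above this level [theta] cannot grow. *)
  apply: (@barrier _ (theta \o x) _ _ (dthetax dx)) t0; first by rewrite /= x00.
  move=> r r0 thr; rewrite mulr_ge0_le0// leNgt; apply/negP => a0.
  have Vr : V (x r) <= V x0.
    by rewrite -x00; apply: penalty_nincr dx _ => //; exact: ltW.
  by have := Hy0 (x r) (conj a0 Vr); rewrite /= leNgt => /negP; apply.
Qed.

(** The solution [y] through a limit point stays in the limit set, so the derivatives at time 0 of
    [V] and [theta] along [y] vanish once these functions are constant there. [V] comes first:
    [theta] is monotone only up to [c * sqrt V], an error that disappears once the limit set is
    known to be feasible. *)
Lemma omega_limit_KKT s K (L : R) x : compact K -> (forall y, 0 <= s y) ->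
  (forall y, K y -> 0 < s y) -> 0 < L ->
  (forall y z, `|field s y - field s z| <= L * `|y - z|) ->
  integral_curve s x -> (forall t, 0 <= t -> K (x t)) ->
  omega_limit x `<=` KKT theta h g.
Proof.
move=> cK s0 sK L0 HL dx xK p omp.
have Kp : K p by exact: (omega_limit_sub cK xK).
have [y y0 dy] := global_solution L0 HL p.
have omy t : omega_limit x (y t).
  have om0 : omega_limit x (y 0) by rewrite y0.
  exact: (omega_limit_flow HL dx dy om0).
have Veq q q' : omega_limit x q -> omega_limit x q' -> V q' <= V q.
  move=> omq omq'; apply: (@omega_limit_le _ _ x V (cst 0)) omq omq' _ => //.
    exact: cst_continuous.
  by move=> a b a0 ab; rewrite addr0; exact: penalty_nincr dx ab.
have cst_der (u : R -> R) (c v : R) : (forall t, u t = c) -> is_derive (0 : R) 1 u v -> v = 0.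
  move=> uc [_ <-]; have -> : u = cst c by apply/funext => t; rewrite uc.
  exact: derive_cst.
have G0 : grad V p = 0.
  have E : (grad V p *m field s p) 0 0 = 0.
    rewrite -y0; apply: (cst_der _ (V p) _ _ (dVx dy 0)) => t /=.
    by apply/eqP; rewrite eq_le !Veq.
  have := @gradV_field _ _ _ _ theta _ _ h_C2 g_C2 s psi1 psi2 psi1_gt0 p (s0 p).
  rewrite E oppr_ge0 pmulr_rle0 ?mulr_gt0 ?sK// => E2.
  apply: trmx_inj; rewrite trmx0; apply: sumsq_eq0.
  by rewrite /sumsq trmxK -enorm_sqr_row.
have fpp : feasible h g p by apply/(gradV_eq0 h_C2 g_C2 A3).
have Vom q : omega_limit x q -> V q = 0.
  move=> omq; apply/eqP; rewrite eq_le penalty_ge0 andbT.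
  by have /penalty_eq0 <- := fpp; exact: Veq.
have [c c0 Hc] := theta_bound cK.
have teq q q' : omega_limit x q -> omega_limit x q' -> theta q' <= theta q.
  move=> omq omq'; have Vq := Vom q omq.
  apply: (@omega_limit_le _ _ x theta (fun z => c * Num.sqrt (V z))) omq omq' _ => //.
  - have cg : continuous (fun r : R => c * Num.sqrt r).
      by move=> r; apply: cvgM; [exact: cvg_cst|exact: sqrt_continuous].
    by move=> z; exact: (continuous_comp (@cV z) (cg _)).
  - move=> a b a0 ab; apply: (Hc s) => // t /andP[at_ _].
    by apply: xK; exact: le_trans at_.
  - by rewrite /= Vq sqrtr0 mulr0.
have E : s p * afun theta h g psi1 psi2 p = 0.
  rewrite -y0; apply: (cst_der _ (theta p) _ _ (dthetax dy 0)) => t /=.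
  by apply/eqP; rewrite eq_le !teq.
apply: KKT_gradtheta_F => //.
have := gradtheta_field theta h g s psi1 psi2 p; rewrite E mul_nlp_field G0.
rewrite trmx0 mulmx0 enorm_sqr_row mul0mx !mxE !(mulr0, mul0r, subr0, addr0) => /eqP.
by rewrite mulf_eq0 gt_eqF ?mulr_gt0 ?sK//= => /eqP.
Qed.

(** The curve of the truncated field solves the original equation for [t >= 0], where it stays in
    [K]. Curves in the limit set stay in [K] in both time directions, which gives invariance under
    [f] itself. The weight [s] is kept for later use of monotonicity. *)
Lemma trajectory (x0 : 'cV[R]_n) : exists s K x,
  [/\ forall y, 0 <= s y, integral_curve s x,
      x 0 = x0 /\ unique_solution f `[0, +oo[ x0 x,
      compact K /\ (forall t, 0 <= t -> K (x t)) &
      invariant f (omega_limit x) /\ omega_limit x `<=` KKT theta h g].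
Proof.
have [s [K [L [cK s0 sK [L0 HL] Hx]]]] := confined_curve x0.
have [x x00 dx] := global_solution L0 HL x0.
have xK := Hx x dx x00; have sub := omega_limit_sub cK xK.
exists s, K, x; split => //.
- split=> //; apply: unique_solutionP => //; first by rewrite in_itv/= lexx.
  apply: (@eq_solves _ _ (field s)) => [t|].
    by rewrite in_itv/= andbT => t0; case: (sK _ (xK t t0)).
  by apply: is_derive_solves => t _; exact: dx.
- split; last by apply: (omega_limit_KKT cK s0 _ L0 HL dx xK) => y /sK[].
  move=> p omp; have [y y0 dy] := global_solution L0 HL p.
  have omy t : omega_limit x (y t).
    have om0 : omega_limit x (y 0) by rewrite y0.
    exact: (omega_limit_flow HL dx dy om0).
  exists y; split; last exact: omy.
  apply: unique_solutionP => //.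
  apply: (@eq_solves _ _ (field s)) => [t _|]; first by case: (sK _ (sub _ (omy t))).
  by apply: is_derive_solves => t _; exact: dy.
Qed.

Let dist_continuous (p : 'cV[R]_n) : continuous (fun y : 'cV[R]_n => `|p - y|).
Proof.
apply: continuousP_dist => y e e0; apply: filterS (near_norm_le y e0) => z.
apply: le_trans; apply: le_trans (ler_dist_dist _ _) _.
by rewrite opprB addrC addrA subrK distrC.
Qed.

(* On a small sphere around [p], almost feasible points have
   [theta >= theta p + e]; by [theta_bound] no curve starting close to [p] can
   reach such a point. *)
Let confinement p U : isolated_KKT theta h g p -> strict_local_min theta h g p ->
  nbhs p U -> exists K, [/\ compact K, K `<=` U, forall y, K y -> KKT theta h g y -> y = p &
    \forall q \near p, forall s x, (forall y, 0 <= s y) -> integral_curve s x -> x 0 = q ->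
      forall t, 0 <= t -> K (x t)].
Proof.
move=> [_ iso] [fp smin] Up.
have N : nbhs p (U `&` ([set y | KKT theta h g y -> y = p] `&`
    [set y | feasible h g y -> y <> p -> theta p < theta y])).
  by apply: filterI => //; exact: filterI.
have /nbhs_ballP [d /= d0 Hd] := N.
pose r := d / 2; have r0 : 0 < r by rewrite divr_gt0.
pose K : set 'cV[R]_n := [set y | `|p - y| <= r].
have KB y : K y -> U y /\ (KKT theta h g y -> y = p) /\
    (feasible h g y -> y <> p -> theta p < theta y).
  by move=> Ky; apply: Hd; rewrite -ball_normE/=; apply: le_lt_trans Ky _; rewrite /r; lra.
have clK : closed K.
  apply: (@closed_comp _ _ (fun y : 'cV[R]_n => `|p - y|) [set z : R | z <= r]) => [z _|].
    exact: dist_continuous.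
  exact: closed_le.
have cK : compact K.
  apply: subclosed_compact clK (@cV_ball_compact R n (`|p| + r)) _ => y Ky /=.
  by have := ler_normB p (p - y); rewrite subKr; move: Ky; rewrite /K/=; lra.
have cS : compact (K `&` [set y | r <= `|p - y|]).
  apply: compact_closedI cK _.
  apply: (@closed_comp _ _ (fun y : 'cV[R]_n => `|p - y|) [set z : R | r <= z]) => [z _|].
    exact: dist_continuous.
  exact: closed_ge.
(* Near a feasible point of the sphere, [theta] exceeds [theta p] by a margin; near an infeasible
   one, [V] is bounded below and [V y <= e] fails for small [e]. Compactness gives a common [e]. *)
have [e e0 He] : exists2 e : R, 0 < e &
    forall y, K y -> r <= `|p - y| -> V y <= e -> theta p + e <= theta y.
  have H : \forall e \near (0 : R)^'+, K `&` [set y | r <= `|p - y|] `<=`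
      (fun y => V y <= e -> theta p + e <= theta y).
    apply: (compact_near_coveringP _).1 => // y [Ky ry].
    have [_ [_ sm]] := KB y Ky.
    have [fy|nfy] := pselect (feasible h g y).
      have py : theta p < theta y.
        by apply: sm => // yp; move: ry; rewrite /= yp subrr normr0 leNgt r0.
      pose c := (theta y - theta p) / 2; have c0 : 0 < c by rewrite divr_gt0// subr_gt0.
      have yc : theta p + c < theta y by rewrite /c; lra.
      have n1 := cvgr_ge _ (@ctheta y) _ yc.
      exists ([set z | theta p + c <= theta z], [set e | e <= c]) => /=.
        by split; [exact: n1|exact: nbhs_right_le].
      by move=> [z e] /= [zc ec] _; apply: le_trans zc; rewrite lerD2l.
    have Vy : 0 < V y.
      by rewrite lt0r penalty_ge0 andbT; apply/eqP => /penalty_eq0.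
    have Vc : V y / 2 < V y by lra.
    have n1 := cvgr_gt _ (@cV y) _ Vc.
    exists ([set z | V y / 2 < V z], [set e | e <= V y / 2]) => /=.
      by split; [exact: n1|apply: nbhs_right_le; rewrite divr_gt0].
    by move=> [z e] /= [zc ec] ze; lra.
  have H0 : \forall e \near (0 : R)^'+, 0 < e by exact: nbhs_right_gt.
  by have [e [He e0]] := filter_ex (filterI H H0); exists e => // y Ky ry; exact: He.
have [c c0 Hc] := theta_bound cK.
exists K; split => //; first by move=> y /KB[].
  by move=> y /KB[_ []].
have Vp : V p = 0 by apply/penalty_eq0.
(* Half of the margin is spent on [theta q] and half on [c * sqrt (V q)], so that
   [theta < theta p + e] still holds at the first contact with the sphere. *)
have n1 : \forall q \near p, theta q < theta p + e / 2.
  by apply: (cvgr_lt _ (@ctheta p)); rewrite ltrDl divr_gt0.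
have n2 : \forall q \near p, c * Num.sqrt (V q) < e / 2.
  have cg : continuous (fun z : R => c * Num.sqrt z).
    by move=> z; apply: cvgM; [exact: cvg_cst|exact: sqrt_continuous].
  have cgV := continuous_comp (@cV p) (cg (V p)).
  by apply: (cvgr_lt _ cgV); rewrite /= Vp sqrtr0 mulr0 divr_gt0.
have n3 : \forall q \near p, V q <= e by apply: (cvgr_le _ (@cV p)); rewrite Vp.
have n4 : \forall q \near p, `|p - q| <= r by exact: near_norm_le.
apply: filterS2 (filterI n1 n2) (filterI n3 n4) => q [q1 q2] [q3 q4] s x s0 dx xq t t0.
rewrite /K/= leNgt; apply/negP => rt.
have cw : continuous (fun t => `|p - x t|).
  have cx := is_derive_continuous dx.
  by move=> t'; exact: (continuous_comp (@cx t') (@dist_continuous p (x t'))).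
have [|t1 [/andP[t10 t1t] wt1 Ht1]] := first_hit cw t0 _ (ltW rt); first by rewrite xq.
have Kx t' : 0 <= t' <= t1 -> K (x t') by exact: Ht1.
have := Hc s x 0 t1 s0 dx t10 Kx; rewrite xq.
have V1 : V (x t1) <= e by apply: le_trans q3; rewrite -xq; exact: penalty_nincr dx t10.
have := He (x t1) (Kx t1 _) _ V1; rewrite t10 lexx wt1 lexx => /(_ isT isT).
by lra.
Qed.

(** For attraction, the limit set consists of KKT points in a compact set whose only KKT point can
    be [p]. A curve confined to a compact set enters every neighbourhood of its limit set, hence
    tends to [p]. *)
Lemma KKT_locally_asymptotically_stable p : isolated_KKT theta h g p ->
  strict_local_min theta h g p -> locally_asymptotically_stable f p.
Proof.
move=> iso smin; split.
- by apply/KKT_equilibrium => //; case: iso.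
- move=> U /(confinement iso smin) [K [_ KU _]]; apply: filterS => q Hq.
  have [s [K' [x [s0 dx [x0 ux] _ _]]]] := trajectory q.
  by exists x; split=> // t t0; apply: KU; exact: Hq dx x0 t t0.
- have [K [cK _ Kp]] := confinement iso smin (@filterT _ (nbhs p) _).
  apply: filterS => q Hq.
  have [s [K' [x [s0 dx [x0 ux] _ [_ omK]]]]] := trajectory q.
  have xK := Hq s x s0 dx x0.
  exists x; split => // A Ap; apply: (omega_limit_near cK xK) => p' omp'.
  by rewrite (Kp p' (omega_limit_sub cK xK omp') (omK _ omp')).
Qed.

End Trajectories.

Theorem theorem5p3 (R : realType) (n m k : nat) (mn : (m < n)%N)
    (theta : 'cV[R]_n -> R)
    (h : 'I_m -> 'cV[R]_n -> R) (g : 'I_k -> 'cV[R]_n -> R)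
    (theta_C2 : C2 theta)
    (h_C2 : forall i, C2 (h i)) (g_C2 : forall j, C2 (g j))
    (A1 : forall z y : 'cV[R]_n, penalty h g y <= penalty h g z ->
       compact [set x : 'cV[R]_n |
                 penalty h g x <= penalty h g z /\ theta x <= theta y])
    (A2 : forall x : 'cV[R]_n, feasible h g x -> free (active_gradients h g x))
    (A3 : forall x : 'cV[R]_n,
       (Amx h x)^T *m hvec h x + (Bmx g x)^T *m pos_part (gvec g x) = 0 ->
       hvec h x = 0 /\ pos_part (gvec g x) = 0)
    (psi1 psi2 : 'cV[R]_n -> R)
    (psi1_cont : continuous psi1) (psi2_cont : continuous psi2)
    (psi1_lip : locally_lipschitz psi1) (psi2_lip : locally_lipschitz psi2)
    (psi1_gt0 : forall x, 0 < psi1 x) (psi2_gt0 : forall x, 0 < psi2 x)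
    (A4 : forall z : 'cV[R]_n, exists yz : 'cV[R]_n,
       [/\ penalty h g yz <= penalty h g z, theta z <= theta yz &
           [set x : 'cV[R]_n | 0 < afun theta h g psi1 psi2 x /\
                               penalty h g x <= penalty h g z]
           `<=` [set x : 'cV[R]_n | theta x <= theta yz]])
    (sigma : 'cV[R]_n -> R)
    (sigma_lip : locally_lipschitz sigma) (sigma_gt0 : forall x, 0 < sigma x) :
  let f := nlp_field theta h g sigma psi1 psi2 in
  [/\ forall x0 : 'cV[R]_n, exists x : R -> 'cV[R]_n,
        [/\ unique_solution f `[0, +oo[ x0 x,
            bounded_set (x @` `[0, +oo[) &
            [/\ omega_limit x !=set0,
                compact (omega_limit x),
                connected (omega_limit x),
                invariant f (omega_limit x) &
                omega_limit x `<=` KKT theta h g]],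
      forall x : 'cV[R]_n, KKT theta h g x <-> equilibrium f x,
      forall x : 'cV[R]_n, isolated_KKT theta h g x ->
        strict_local_min theta h g x -> locally_asymptotically_stable f x &
      positively_invariant f (feasible h g)].
Proof.
have traj := trajectory theta_C2 h_C2 g_C2 A1 A2 A3 psi1_lip psi2_lip psi1_gt0 psi2_gt0
  A4 sigma_lip sigma_gt0.
move=> f; split.
- move=> x0; have [s [K [x [_ dx [_ ux] [cK xK] [inv omK]]]]] := traj x0.
  exists x; split => //.
    have [M [Mr HM]] := compact_bounded cK; exists M; split => // M' MM' _ [t /= t0 <-].
    by apply: HM MM' _ _; apply: xK; move: t0; rewrite in_itv/= andbT.
  split => //.
  + exact: omega_limit_nonempty cK xK.
  + exact: omega_limit_compact cK xK.
  + exact: omega_limit_connected cK xK (within_continuousT (is_derive_continuous dx)).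
- by move=> x; exact: KKT_equilibrium.
- by move=> x; exact: KKT_locally_asymptotically_stable.
- move=> p fp; have [s [K [x [s0 dx [x0 ux] _ _]]]] := traj p.
  (* Feasibility is the vanishing of [V], which is nonnegative and never increases. *)
  exists x; split => // t t0; apply/penalty_eq0/eqP; rewrite eq_le penalty_ge0 andbT.
  have /penalty_eq0 <- := fp; rewrite -x0.
  exact: (penalty_nincr h_C2 g_C2 psi1_gt0 psi2_gt0 s0 dx t0).
Qed.
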